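(* Let $\mathcal G$ be a Gray category with duals. (1) The duality operation $*$ (acting as the identity on objects and 1-morphisms, and by $\mu\mapsto\mu^*$, $\Psi\mapsto\Psi^*$ on 2- and 3-morphisms) extends to a strict functor of 2-strict tricategories $*\colon\mathcal G\to\mathcal G^{op}$. (2) The duality operation $\#$ (acting as the identity on objects, by $F\mapsto F^\#$ on 1-morphisms, and on 2-morphisms $\nu\colon F\Rightarrow G$ and 3-morphisms $\Psi\colon\nu\Rrightarrow\mu$ by $\#\nu=(F^\#\Box\eta_G^* )\circ(F^\#\Box\nu\Box G^\#)\circ(\eta_{F^\#}\Box G^\#)\colon G^\#\Rightarrow F^\#$ and $\#\Psi=1_{F^\#\Box\eta_G^*}\circ(F^\#\Box\Psi\Box G^\#)\circ1_{\eta_{F^\#}\Box G^\#}\colon\#\nu\Rrightarrow\#\mu$) extends to a functor of 2-strict tricategories $\#\colon\mathcal G\to\mathcal G_{op}$.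
   Context: \textbf{Gray categories.} A Gray category $\mathcal G$ consists of: a set of objects; for any objects $\mathcal C,\mathcal D$ a strict 2-category $\mathcal G(\mathcal C,\mathcal D)$, whose objects, 1-morphisms and 2-morphisms are called 1-morphisms $F\colon\mathcal C\to\mathcal D$, 2-morphisms $\mu\colon F\Rightarrow G$ and 3-morphisms $\Psi\colon\mu\Rrightarrow\nu$ of $\mathcal G$, with horizontal composition $\circ$ and vertical composition $\cdot$ (the right factor is applied first); a Gray product $\Box$, giving $G\Box F\colon\mathcal C\to\mathcal E$ for 1-morphisms $F\colon\mathcal C\to\mathcal D$, $G\colon\mathcal D\to\mathcal E$ and products $\Phi\Box F$, $G\Box\Psi$ of a 1-morphism with a 2- or 3-morphism, such that $-\Box F$, $G\Box-$ are strict 2-functors and $\Box$ is strictly associative and unital (units $1_{\mathcal C}$); and invertible 3-morphisms (the tensorator) $\sigma_{\mu,\nu}\colon(\mu\Box F_2)\circ(G_1\Box\nu)\Rrightarrow(G_2\Box\nu)\circ(\mu\Box F_1)$ for $\nu\colon F_1\Rightarrow F_2$ in $\mathcal G(\mathcal C,\mathcal D)$, $\mu\colon G_1\Rightarrow G_2$ in $\mathcal G(\mathcal D,\mathcal E)$, which are identities if $\mu$ or $\nu$ is an identity, are natural in $\mu$ and $\nu$, and satisfy $\sigma_{\mu,\bar\nu\circ\nu}=((G_2\Box\bar\nu)\circ\sigma_{\mu,\nu})\cdot(\sigma_{\mu,\bar\nu}\circ(G_1\Box\nu))$, $\sigma_{\bar\mu\circ\mu,\nu}=(\sigma_{\bar\mu,\nu}\circ(\mu\Box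 F_1))\cdot((\bar\mu\Box F_2)\circ\sigma_{\mu,\nu})$, $\sigma_{\mu\Box F,\nu}=\sigma_{\mu,F\Box\nu}$, $\sigma_{F\Box\mu,\nu}=F\Box\sigma_{\mu,\nu}$, $\sigma_{\mu,\nu\Box F}=\sigma_{\mu,\nu}\Box F$ whenever defined. The Gray product of 2- or 3-morphisms $\Psi$ (over $G_1,G_2$) and $\Phi$ (over $F_1,F_2$) is $\Psi\Box\Phi=(\Psi\Box F_2)\circ(G_1\Box\Phi)$. \textbf{Duals.} For a 2-category $\mathcal C$, $\mathcal C^{op}$ is the 2-category with both compositions reversed and $\mathcal C_{op}$ the one with horizontal composition reversed and the same vertical composition. A planar 2-category is a 2-category $\mathcal C$ with a strict 2-functor $*\colon\mathcal C\to\mathcal C^{op}$ that is the identity on objects (so $a\colon A\to A'$, $\alpha\colon a\to b$ give $a^*\colon A'\to A$, $\alpha^*\colon b^*\to a^*$), with $**=1$, and 2-morphisms $\epsilon_a\colon1_{A'}\to a\circ a^*$ for all 1-morphisms $a\colon A\to A'$ such that, whenever defined, $(\alpha\circ1_{a^*})\cdot\epsilon_a=(1_b\circ\alpha^* )\cdot\epsilon_b$, $(1_a\circ\epsilon_{a^*}^* )\cdot(\epsilon_a\circ1_a)=1_a$, $(1_a\circ\epsilon_c\circ1_{a^*})\cdot\epsilon_a=\epsilon_{a\circ c}$. A Gray category with duals is a Gray category $\mathcal G$ with: (1) a planar structure on each $\mathcal G(\mathcal C,\mathcal D)$ (so $\mu\colon F\Rightarrow G$ has $\mu^*\colon G\Rightarrow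 F$ and $\epsilon_\mu\colon1_G\Rrightarrow\mu\circ\mu^*$) such that $(K\Box\mu\Box H)^*=K\Box\mu^*\Box H$ and $K\Box\epsilon_\mu\Box H=\epsilon_{K\Box\mu\Box H}$ for 1-morphisms $H,K$; (2) for each 1-morphism $F\colon\mathcal C\to\mathcal D$ a 1-morphism $F^\#\colon\mathcal D\to\mathcal C$, a 2-morphism (fold) $\eta_F\colon1_{\mathcal D}\Rightarrow F\Box F^\#$ and an invertible 3-morphism (triangulator) $T_F\colon(\eta_F^*\Box F)\circ(F\Box\eta_{F^\#})\Rrightarrow1_F$ such that (a) $F^{\#\#}=F$; (b) $1_{\mathcal C}^\#=1_{\mathcal C}$, $\eta_{1_{\mathcal C}}=1_{1_{\mathcal C}}$, $T_{1_{\mathcal C}}=1_{1_{1_{\mathcal C}}}$; (c) $(F\Box G)^\#=G^\#\Box F^\#$, $\eta_{F\Box G}=(F\Box\eta_G\Box F^\#)\circ\eta_F$, $T_{F\Box G}=(T_F\Box G\circ F\Box T_G)\cdot(1_{\eta_F^*\Box F\Box G}\circ\sigma_{F\Box\eta_G^*,\eta_{F^\#}\Box G}\circ1_{F\Box G\Box\eta_{G^\#}})$; (d) $(1_{\eta_F^*}\circ T_F\Box F^\#)\cdot(\sigma_{\eta_F^*,\eta_F^*}\circ1_{F\Box\eta_{F^\#}\Box F^\#})\cdot(1_{\eta_F^*}\circ F\Box T_{F^\#}^* )=1_{\eta_F^*}$. \textbf{Tricategories and functors.} A 2-strict tricategory $\mathcal T$ consists of objects, strict 2-categories $\mathcal T(\mathcal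 C,\mathcal D)$ and weak 2-functors $\Box\colon\mathcal T(\mathcal D,\mathcal E)\times\mathcal T(\mathcal C,\mathcal D)\to\mathcal T(\mathcal C,\mathcal E)$, strictly associative and unital, with coherence 3-isomorphisms $\Box_{\mu,\nu}\colon(\mu_1\Box\mu_2)\circ(\nu_1\Box\nu_2)\Rrightarrow(\mu_1\circ\nu_1)\Box(\mu_2\circ\nu_2)$. It is strict opcubical if $\Box_{\mu,\nu}$ is an identity whenever $\mu_2$ or $\nu_1$ is an identity, and strict cubical if this holds whenever $\mu_1$ or $\nu_2$ is an identity. A Gray category is strict opcubical with $\Box_{\mu,\nu}=1_{\mu_1\Box K_2}\circ\sigma^{-1}_{\nu_1,\mu_2}\circ1_{G_1\Box\nu_2}$ for $\mu=(\mu_1,\mu_2)\colon(H_1,H_2)\to(K_1,K_2)$, $\nu=(\nu_1,\nu_2)\colon(G_1,G_2)\to(H_1,H_2)$. $\mathcal G^{op}$ is the (cubical) tricategory with $\mathcal G^{op}(\mathcal C,\mathcal D)=\mathcal G(\mathcal C,\mathcal D)^{op}$, the same Gray product $\Box$, and coherence $(\Box^{op})_{\mu,\nu}=(\Box_{\nu,\mu}^{-1})^{op}$. $\mathcal G_{op}$ is the (opcubical) tricategory with $\mathcal G_{op}(\mathcal C,\mathcal D)=\mathcal G(\mathcal D,\mathcal C)_{op}$, Gray product $\Phi\,\widetilde\Box\,\Psi=\Psi\Box\Phi$, and coherence $\Box_{(\nu_2,\nu_1),(\mu_2,\mu_1)}$ at $(\mu,\nu)$. A functor $F\colon\mathcal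 T\to\mathcal S$ of 2-strict tricategories consists of a map on objects, weak 2-functors $F\colon\mathcal T(\mathcal C,\mathcal D)\to\mathcal S(F\mathcal C,F\mathcal D)$ with coherence 3-isomorphisms $\Phi_{\mu,\nu}\colon F(\mu)\circ F(\nu)\to F(\mu\circ\nu)$ (natural) and $\Phi_G\colon1_{F(G)}\to F(1_G)$ satisfying the usual associativity and unit axioms, such that $F(1_{\mathcal C})=1_{F\mathcal C}$ and $F(G\Box H)=F(G)\Box F(H)$ on 1-morphisms, and natural 3-isomorphisms $\kappa_{\mu,\nu}\colon F(\mu)\Box F(\nu)\to F(\mu\Box\nu)$ with: $F(\Box_{\mu,\nu})\cdot\Phi_{\mu_1\Box\mu_2,\nu_1\Box\nu_2}\cdot(\kappa_{\mu_1,\mu_2}\circ\kappa_{\nu_1,\nu_2})=\kappa_{\mu_1\circ\nu_1,\mu_2\circ\nu_2}\cdot(\Phi_{\mu_1,\nu_1}\Box\Phi_{\mu_2,\nu_2})\cdot\Box_{F\mu,F\nu}$; $\kappa_{1_G,1_H}\cdot(\Phi_G\Box\Phi_H)=\Phi_{G\Box H}$; $\kappa_{\nu,\mu\Box\rho}\cdot(1\Box\kappa_{\mu,\rho})=\kappa_{\nu\Box\mu,\rho}\cdot(\kappa_{\nu,\mu}\Box1)$; $\kappa_{\mu,1_{1_{\mathcal C}}}=\kappa_{1_{1_{\mathcal D}},\mu}=1_{F(\mu)}$ (all compositions on the left of an application of $F$ being those of $\mathcal S$). The operation ''extends to a functor'' means: there are coherence data making the given mappings (regarded as landing in the opposite tricategory)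 such a functor. A functor between (op)cubical tricategories is strict if all $\Phi_{\mu,\nu},\Phi_G$ are identities and $\kappa$ is: the identity if $\mathcal T,\mathcal S$ are both cubical or both opcubical; $\kappa_{\mu,\nu}=\Box^{-1}_{(F(1_{G_2}),F(\nu)),(F(\mu),F(1_{H_1}))}$ if $\mathcal T$ is cubical and $\mathcal S$ opcubical; $\kappa_{\mu,\nu}=\Box^{-1}_{(F(\mu),F(1_{H_2})),(F(1_{G_1}),F(\nu))}$ if $\mathcal T$ is opcubical and $\mathcal S$ cubical (coherence of $\mathcal S$; $\mu\colon G_1\Rightarrow G_2$, $\nu\colon H_1\Rightarrow H_2$). *)

(* Defs.v *)
(** Gray categories with duals and functors of 2-strict tricategories.

    Encoding.  Inside a 2-category there is one type of 1-morphisms and one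
    type of 2-morphisms, with source and target maps, instead of families
    indexed by their boundaries: strict associativity and unitality are then
    plain equations, without transport along equalities of boundaries.
    Compositions are total functions, but every law about a composite is
    required for composable arguments only; their values on other arguments
    are junk.  Families indexed by the objects of a Gray category or of a
    tricategory are dependent, because none of the laws equates objects. *)

Set Implicit Arguments.
Unset Strict Implicit.
Unset Printing Implicit Defensive.

Declare Scope gray_scope.
Open Scope gray_scope.

Reserved Notation "a ∘ b" (at level 40, left associativity).
Reserved Notation "x ⊛ y" (at level 40, left associativity).
Reserved Notation "x • y" (at level 45, left associativity).
Reserved Notation "g □ f" (at level 35, right associativity).
Reserved Notation "g ◁ m" (at level 35, right associativity).
Reserved Notation "g ◀ x" (at level 35, right associativity).
Reserved Notation "m ▷ f" (at level 34, left associativity).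
Reserved Notation "x ▶ f" (at level 34, left associativity).

(** [src], [tgt] are the boundary objects of a 1-morphism; [dom], [cod] are
    the boundary 1-morphisms of a 2-morphism.  The right factor of each
    composition is applied first. *)
Record TwoCatData : Type := MkTwoCatData {
  ob : Type;
  mor : Type;
  cell : Type;
  src : mor -> ob;
  tgt : mor -> ob;
  dom : cell -> mor;
  cod : cell -> mor;
  idm : ob -> mor;
  idc : mor -> cell;
  comp : mor -> mor -> mor;
  hcomp : cell -> cell -> cell;
  vcomp : cell -> cell -> cell
}.

Notation "a ∘ b" := (comp a b) : gray_scope.
Notation "x ⊛ y" := (hcomp x y) : gray_scope.
Notation "x • y" := (vcomp x y) : gray_scope.

Definition is_mor (C : TwoCatData) (a : mor C) (A B : ob C) : Prop :=
  src a = A /\ tgt a = B.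
Definition is_cell (C : TwoCatData) (x : cell C) (a b : mor C) : Prop :=
  dom x = a /\ cod x = b.

Class two_cat_laws (C : TwoCatData) : Prop := {
  src_cod : forall x : cell C, src (cod x) = src (dom x);
  tgt_cod : forall x : cell C, tgt (cod x) = tgt (dom x);
  src_idm : forall A : ob C, src (idm A) = A;
  tgt_idm : forall A : ob C, tgt (idm A) = A;
  dom_idc : forall a : mor C, dom (idc a) = a;
  cod_idc : forall a : mor C, cod (idc a) = a;
  src_comp : forall a b : mor C, src a = tgt b -> src (a ∘ b) = src b;
  tgt_comp : forall a b : mor C, src a = tgt b -> tgt (a ∘ b) = tgt a;
  dom_hcomp : forall x y : cell C, src (dom x) = tgt (dom y) ->
    dom (x ⊛ y) = dom x ∘ dom y;
  cod_hcomp : forall x y : cell C, src (dom x) = tgt (dom y) ->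
    cod (x ⊛ y) = cod x ∘ cod y;
  dom_vcomp : forall x y : cell C, dom x = cod y -> dom (x • y) = dom y;
  cod_vcomp : forall x y : cell C, dom x = cod y -> cod (x • y) = cod x;
  compA : forall a b c : mor C, src a = tgt b -> src b = tgt c ->
    a ∘ (b ∘ c) = a ∘ b ∘ c;
  comp1m : forall a : mor C, idm (tgt a) ∘ a = a;
  compm1 : forall a : mor C, a ∘ idm (src a) = a;
  vcompA : forall x y z : cell C, dom x = cod y -> dom y = cod z ->
    x • (y • z) = x • y • z;
  vcomp1c : forall x : cell C, idc (cod x) • x = x;
  vcompc1 : forall x : cell C, x • idc (dom x) = x;
  hcompA : forall x y z : cell C,
    src (dom x) = tgt (dom y) -> src (dom y) = tgt (dom z) ->
    x ⊛ (y ⊛ z) = x ⊛ y ⊛ z;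
  hcomp1c : forall x : cell C, idc (idm (tgt (dom x))) ⊛ x = x;
  hcompc1 : forall x : cell C, x ⊛ idc (idm (src (dom x))) = x;
  hcomp_idc : forall a b : mor C, src a = tgt b ->
    idc a ⊛ idc b = idc (a ∘ b);
  interchange : forall x x' y y' : cell C,
    dom x' = cod x -> dom y' = cod y -> src (dom x) = tgt (dom y) ->
    (x' • x) ⊛ (y' • y) = (x' ⊛ y') • (x ⊛ y)
}.

Record TwoCat : Type := MkTwoCat {
  two_cat_data :> TwoCatData;
  two_cat_ax : two_cat_laws two_cat_data
}.
#[export] Existing Instance two_cat_ax.

Definition inverse_cells (C : TwoCatData) (x y : cell C) : Prop :=
  is_cell y (cod x) (dom x) /\ x • y = idc (cod x) /\ y • x = idc (dom x).
Definition invertible (C : TwoCatData) (x : cell C) : Prop :=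
  exists y, inverse_cells x y.
Definition is_id_mor (C : TwoCatData) (a : mor C) : Prop := a = idm (src a).
Definition is_id_cell (C : TwoCatData) (x : cell C) : Prop := x = idc (dom x).

(** [C^op]: both compositions reversed.  [C_op]: only the horizontal one. *)
Definition op_data (C : TwoCatData) : TwoCatData := {|
  ob := ob C; mor := mor C; cell := cell C;
  src := @tgt C; tgt := @src C; dom := @cod C; cod := @dom C;
  idm := @idm C; idc := @idc C;
  comp a b := b ∘ a; hcomp x y := y ⊛ x; vcomp x y := y • x
|}.
Definition co_data (C : TwoCatData) : TwoCatData := {|
  ob := ob C; mor := mor C; cell := cell C;
  src := @tgt C; tgt := @src C; dom := @dom C; cod := @cod C;
  idm := @idm C; idc := @idc C;
  comp a b := b ∘ a; hcomp x y := y ⊛ x; vcomp x y := x • y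
|}.
Definition prod_data (C D : TwoCatData) : TwoCatData := {|
  ob := ob C * ob D; mor := mor C * mor D; cell := cell C * cell D;
  src a := (src (fst a), src (snd a)); tgt a := (tgt (fst a), tgt (snd a));
  dom x := (dom (fst x), dom (snd x)); cod x := (cod (fst x), cod (snd x));
  idm A := (idm (fst A), idm (snd A)); idc a := (idc (fst a), idc (snd a));
  comp a b := (fst a ∘ fst b, snd a ∘ snd b);
  hcomp x y := (fst x ⊛ fst y, snd x ⊛ snd y);
  vcomp x y := (fst x • fst y, snd x • snd y)
|}.

Record cat_map (C D : TwoCatData) : Type := CatMap {
  on0 : ob C -> ob D;
  on1 : mor C -> mor D;
  on2 : cell C -> cell D
}.

Class strict_functor_laws (C D : TwoCatData) (F : cat_map C D) : Prop := {
  sf_src : forall a, src (on1 F a) = on0 F (src a);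
  sf_tgt : forall a, tgt (on1 F a) = on0 F (tgt a);
  sf_dom : forall x, dom (on2 F x) = on1 F (dom x);
  sf_cod : forall x, cod (on2 F x) = on1 F (cod x);
  sf_idm : forall A, on1 F (idm A) = idm (on0 F A);
  sf_idc : forall a, on2 F (idc a) = idc (on1 F a);
  sf_comp : forall a b, src a = tgt b -> on1 F (a ∘ b) = on1 F a ∘ on1 F b;
  sf_hcomp : forall x y, src (dom x) = tgt (dom y) ->
    on2 F (x ⊛ y) = on2 F x ⊛ on2 F y;
  sf_vcomp : forall x y, dom x = cod y -> on2 F (x • y) = on2 F x • on2 F y
}.

(** [phi a b : F a ∘ F b -> F (a ∘ b)] and [phi1 A : 1_{F A} -> F 1_A],
    together with their (unique) inverses. *)
Record weak_coh (C D : TwoCatData) : Type := WeakCoh {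
  phi : mor C -> mor C -> cell D;
  phi_inv : mor C -> mor C -> cell D;
  phi1 : ob C -> cell D;
  phi1_inv : ob C -> cell D
}.

Class weak_functor_laws (C D : TwoCatData) (F : cat_map C D)
    (c : weak_coh C D) : Prop := {
  wf_src : forall a, src (on1 F a) = on0 F (src a);
  wf_tgt : forall a, tgt (on1 F a) = on0 F (tgt a);
  wf_dom : forall x, dom (on2 F x) = on1 F (dom x);
  wf_cod : forall x, cod (on2 F x) = on1 F (cod x);
  wf_idc : forall a, on2 F (idc a) = idc (on1 F a);
  wf_vcomp : forall x y, dom x = cod y -> on2 F (x • y) = on2 F x • on2 F y;
  phi_cell : forall a b, src a = tgt b ->
    is_cell (phi c a b) (on1 F a ∘ on1 F b) (on1 F (a ∘ b));
  phi_invP : forall a b, src a = tgt b ->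
    inverse_cells (phi c a b) (phi_inv c a b);
  phi1_cell : forall A,
    is_cell (phi1 c A) (idm (on0 F A)) (on1 F (idm A));
  phi1_invP : forall A, inverse_cells (phi1 c A) (phi1_inv c A);
  phi_nat : forall x y, src (dom x) = tgt (dom y) ->
    phi c (cod x) (cod y) • (on2 F x ⊛ on2 F y) =
    on2 F (x ⊛ y) • phi c (dom x) (dom y);
  phi_assoc : forall a b d, src a = tgt b -> src b = tgt d ->
    phi c (a ∘ b) d • (phi c a b ⊛ idc (on1 F d)) =
    phi c a (b ∘ d) • (idc (on1 F a) ⊛ phi c b d);
  phi_unitr : forall a,
    phi c a (idm (src a)) • (idc (on1 F a) ⊛ phi1 c (src a)) = idc (on1 F a);
  phi_unitl : forall a,
    phi c (idm (tgt a)) a • (phi1 c (tgt a) ⊛ idc (on1 F a)) = idc (on1 F a)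
}.

Record TricatData : Type := MkTricatData {
  tobj : Type;
  thom : tobj -> tobj -> TwoCat;
  tunit : forall C, ob (thom C C);
  tprod : forall C D E,
    cat_map (prod_data (thom D E) (thom C D)) (thom C E);
  tcoh : forall C D E,
    weak_coh (prod_data (thom D E) (thom C D)) (thom C E)
}.

Section TricatOps.
Context {T : TricatData} {C D E : tobj T}.
Definition tp0 (g : ob (thom D E)) (f : ob (thom C D)) : ob (thom C E) :=
  on0 (tprod C D E) (g, f).
Definition tp1 (m : mor (thom D E)) (n : mor (thom C D)) : mor (thom C E) :=
  on1 (tprod C D E) (m, n).
Definition tp2 (x : cell (thom D E)) (y : cell (thom C D)) :
  cell (thom C E) := on2 (tprod C D E) (x, y).
(** The coherence 3-isomorphism at [mu = (m1, m2)], [nu = (n1, n2)], from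
    the composite of [m1 □ m2] and [n1 □ n2] to the product of [m1 ∘ n1] and
    [m2 ∘ n2]. *)
Definition tphi (m1 : mor (thom D E)) (m2 : mor (thom C D))
    (n1 : mor (thom D E)) (n2 : mor (thom C D)) : cell (thom C E) :=
  phi (tcoh C D E) (m1, m2) (n1, n2).
Definition tphi_inv (m1 : mor (thom D E)) (m2 : mor (thom C D))
    (n1 : mor (thom D E)) (n2 : mor (thom C D)) : cell (thom C E) :=
  phi_inv (tcoh C D E) (m1, m2) (n1, n2).
End TricatOps.

Notation "g □₀ f" := (tp0 g f) (at level 35, right associativity) : gray_scope.
Notation "m □₁ n" := (tp1 m n) (at level 35, right associativity) : gray_scope.
Notation "x □₂ y" := (tp2 x y) (at level 35, right associativity) : gray_scope.

(** [□] is a weak 2-functor that preserves identity 2-morphisms strictly, so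
    that [tphi] is its only coherence; associativity and unitality are
    equalities of weak 2-functors, that is, they also concern [tphi]. *)
Class tricat_laws (T : TricatData) : Prop := {
  tprod_weak : forall C D E : tobj T,
    weak_functor_laws (tprod C D E) (tcoh C D E);
  tprod_idm : forall (C D E : tobj T) (g : ob (thom D E)) (f : ob (thom C D)),
    idm g □₁ idm f = idm (g □₀ f);
  tprod_phi1 : forall (C D E : tobj T) (g : ob (thom D E)) (f : ob (thom C D)),
    phi1 (tcoh C D E) (g, f) = idc (idm (g □₀ f));
  tprod0A : forall (B C D E : tobj T)
      (h : ob (thom D E)) (g : ob (thom C D)) (f : ob (thom B C)),
    h □₀ (g □₀ f) = (h □₀ g) □₀ f;
  tprod1A : forall (B C D E : tobj T)
      (l : mor (thom D E)) (m : mor (thom C D)) (n : mor (thom B C)),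
    l □₁ (m □₁ n) = (l □₁ m) □₁ n;
  tprod2A : forall (B C D E : tobj T)
      (x : cell (thom D E)) (y : cell (thom C D)) (z : cell (thom B C)),
    x □₂ (y □₂ z) = (x □₂ y) □₂ z;
  tphiA : forall (B C D E : tobj T)
      (l l' : mor (thom D E)) (m m' : mor (thom C D)) (n n' : mor (thom B C)),
    src l = tgt l' -> src m = tgt m' -> src n = tgt n' ->
    (tphi l m l' m' □₂ idc (n ∘ n')) • tphi (l □₁ m) n (l' □₁ m') n' =
    (idc (l ∘ l') □₂ tphi m n m' n') • tphi l (m □₁ n) l' (m' □₁ n');
  tprod1u0 : forall (C D : tobj T) (f : ob (thom C D)), tunit D □₀ f = f;
  tprodu10 : forall (C D : tobj T) (f : ob (thom C D)), f □₀ tunit C = f;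
  tprod1u1 : forall (C D : tobj T) (m : mor (thom C D)),
    idm (tunit D) □₁ m = m;
  tprodu11 : forall (C D : tobj T) (m : mor (thom C D)),
    m □₁ idm (tunit C) = m;
  tprod1u2 : forall (C D : tobj T) (x : cell (thom C D)),
    idc (idm (tunit D)) □₂ x = x;
  tprodu12 : forall (C D : tobj T) (x : cell (thom C D)),
    x □₂ idc (idm (tunit C)) = x;
  tphi1u : forall (C D : tobj T) (m n : mor (thom C D)), src m = tgt n ->
    tphi (idm (tunit D)) m (idm (tunit D)) n = idc (m ∘ n);
  tphiu1 : forall (C D : tobj T) (m n : mor (thom C D)), src m = tgt n ->
    tphi m (idm (tunit C)) n (idm (tunit C)) = idc (m ∘ n)
}.

Record Tricat : Type := MkTricat {
  tricat_data :> TricatData;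
  tricat_ax : tricat_laws tricat_data
}.
#[export] Existing Instance tricat_ax.

Definition opcubical (T : TricatData) : Prop :=
  forall (C D E : tobj T) (m1 n1 : mor (thom D E)) (m2 n2 : mor (thom C D)),
    src m1 = tgt n1 -> src m2 = tgt n2 ->
    is_id_mor m2 \/ is_id_mor n1 -> is_id_cell (tphi m1 m2 n1 n2).
Definition cubical (T : TricatData) : Prop :=
  forall (C D E : tobj T) (m1 n1 : mor (thom D E)) (m2 n2 : mor (thom C D)),
    src m1 = tgt n1 -> src m2 = tgt n2 ->
    is_id_mor m1 \/ is_id_mor n2 -> is_id_cell (tphi m1 m2 n1 n2).

Record tri_map (T S : TricatData) : Type := TriMap {
  fobj : tobj T -> tobj S;
  fhom : forall C D : tobj T, cat_map (thom C D) (thom (fobj C) (fobj D))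
}.

(** [kappa m n : F m □ F n -> F (m □ n)] *)
Record tri_coh (T S : TricatData) (F : tri_map T S) : Type := TriCoh {
  fcoh : forall C D : tobj T,
    weak_coh (thom C D) (thom (fobj F C) (fobj F D));
  kappa : forall C D E : tobj T, mor (thom D E) -> mor (thom C D) ->
    cell (thom (fobj F C) (fobj F E))
}.

Section TriFunctor.
Context (T S : TricatData) (F : tri_map T S) (c : tri_coh F).
Local Notation F0 f := (on0 (fhom F _ _) f).
Local Notation F1 m := (on1 (fhom F _ _) m).
Local Notation F2 x := (on2 (fhom F _ _) x).
Local Notation Phi m n := (phi (fcoh c _ _) m n).
Local Notation Phi1 f := (phi1 (fcoh c _ _) f).

Record tri_functor_laws : Prop := {
  fhom_weak : forall C D : tobj T,
    weak_functor_laws (fhom F C D) (fcoh c C D);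
  funit : forall C : tobj T, F0 (tunit C) = tunit (fobj F C);
  fprod : forall (C D E : tobj T) (g : ob (thom D E)) (f : ob (thom C D)),
    F0 (g □₀ f) = F0 g □₀ F0 f;
  kappa_cell : forall (C D E : tobj T)
      (m : mor (thom D E)) (n : mor (thom C D)),
    is_cell (kappa c m n) (F1 m □₁ F1 n) (F1 (m □₁ n));
  kappa_inv : forall (C D E : tobj T)
      (m : mor (thom D E)) (n : mor (thom C D)),
    invertible (kappa c m n);
  kappa_nat : forall (C D E : tobj T)
      (x : cell (thom D E)) (y : cell (thom C D)),
    kappa c (cod x) (cod y) • (F2 x □₂ F2 y) =
    F2 (x □₂ y) • kappa c (dom x) (dom y);
  kappa_tphi : forall (C D E : tobj T)
      (m1 n1 : mor (thom D E)) (m2 n2 : mor (thom C D)),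
    src m1 = tgt n1 -> src m2 = tgt n2 ->
    F2 (tphi m1 m2 n1 n2) • Phi (m1 □₁ m2) (n1 □₁ n2)
      • (kappa c m1 m2 ⊛ kappa c n1 n2) =
    kappa c (m1 ∘ n1) (m2 ∘ n2) • (Phi m1 n1 □₂ Phi m2 n2)
      • tphi (F1 m1) (F1 m2) (F1 n1) (F1 n2);
  kappa_id : forall (C D E : tobj T) (g : ob (thom D E)) (f : ob (thom C D)),
    kappa c (idm g) (idm f) • (Phi1 g □₂ Phi1 f) = Phi1 (g □₀ f);
  kappa_assoc : forall (B C D E : tobj T)
      (l : mor (thom D E)) (m : mor (thom C D)) (n : mor (thom B C)),
    kappa c l (m □₁ n) • (idc (F1 l) □₂ kappa c m n) =
    kappa c (l □₁ m) n • (kappa c l m □₂ idc (F1 n));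
  kappa_unitr : forall (C D : tobj T) (m : mor (thom C D)),
    kappa c m (idm (tunit C)) = idc (F1 m);
  kappa_unitl : forall (C D : tobj T) (m : mor (thom C D)),
    kappa c (idm (tunit D)) m = idc (F1 m)
}.

Record tri_functor_strict : Prop := {
  strict_dom : cubical T \/ opcubical T;
  strict_cod : cubical S \/ opcubical S;
  strict_Phi : forall (C D : tobj T) (m n : mor (thom C D)),
    src m = tgt n -> is_id_cell (Phi m n);
  strict_Phi1 : forall (C D : tobj T) (f : ob (thom C D)),
    is_id_cell (Phi1 f);
  strict_same : cubical T /\ cubical S \/ opcubical T /\ opcubical S ->
    forall (C D E : tobj T) (m : mor (thom D E)) (n : mor (thom C D)),
    is_id_cell (kappa c m n);
  strict_cub_opcub : cubical T -> opcubical S ->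
    forall (C D E : tobj T) (m : mor (thom D E)) (n : mor (thom C D)),
    kappa c m n =
    tphi_inv (F1 (idm (tgt m))) (F1 n) (F1 m) (F1 (idm (src n)));
  strict_opcub_cub : opcubical T -> cubical S ->
    forall (C D E : tobj T) (m : mor (thom D E)) (n : mor (thom C D)),
    kappa c m n =
    tphi_inv (F1 m) (F1 (idm (tgt n))) (F1 (idm (src m))) (F1 n)
}.
End TriFunctor.

Definition extends_to_functor (T S : TricatData) (F : tri_map T S) : Prop :=
  exists c : tri_coh F, tri_functor_laws c.
Definition extends_to_strict_functor (T S : TricatData) (F : tri_map T S) :
    Prop :=
  exists c : tri_coh F, tri_functor_laws c /\ tri_functor_strict c.

Ltac bd_ext := fail.
Ltac cat_bd :=
  repeat first
    [ bd_ext | rewrite src_cod | rewrite tgt_cod | rewrite src_idm | rewrite tgt_idm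
    | rewrite dom_idc | rewrite cod_idc
    | rewrite src_comp by cat_bd | rewrite tgt_comp by cat_bd
    | rewrite dom_hcomp by cat_bd | rewrite cod_hcomp by cat_bd
    | rewrite dom_vcomp by cat_bd | rewrite cod_vcomp by cat_bd ];
  try solve [ assumption | reflexivity | congruence ].

Ltac cat_assoc := cat_bd; rewrite ?compA by cat_bd; try reflexivity.

#[export] Instance prod_laws (C D : TwoCat) : two_cat_laws (prod_data C D).
Proof.
constructor; cbn; intros;
  repeat match goal with p : (_ * _)%type |- _ => destruct p end; cbn in *;
  repeat match goal with H : (_, _) = (_, _) |- _ => injection H; clear H; intros end;
  f_equal; cat_bd;
  solve [ apply compA; assumption | apply comp1m | apply compm1
        | apply vcompA; assumption | apply vcomp1c | apply vcompc1
        | apply hcompA; assumption | apply hcomp1c | apply hcompc1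
        | apply hcomp_idc; assumption | apply interchange; assumption ].
Qed.

#[export] Instance op_laws (C : TwoCat) : two_cat_laws (op_data C).
Proof.
constructor; cbn; intros;
  repeat match goal with
   | H : _ (cod _) = _ (cod _) |- _ =>
      rewrite src_cod in H || rewrite tgt_cod in H; rewrite ?src_cod, ?tgt_cod in H
  end; try solve [cat_bd]; rewrite ?src_cod, ?tgt_cod.
all: try
  solve [ symmetry; apply compA; auto | apply comp1m | apply compm1
        | symmetry; apply vcompA; auto | apply vcomp1c | apply vcompc1
        | symmetry; apply hcompA; auto | apply hcomp1c | apply hcompc1
        | apply hcomp_idc; auto | apply interchange; auto ].
apply interchange; auto.
rewrite <- src_cod, <- tgt_cod. congruence.
Qed.

#[export] Instance co_laws (C : TwoCat) : two_cat_laws (co_data C).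
Proof.
constructor; cbn; intros; try solve [cat_bd];
  solve [ symmetry; apply compA; auto | apply comp1m | apply compm1
        | apply vcompA; auto | apply vcomp1c | apply vcompc1
        | symmetry; apply hcompA; auto | apply hcomp1c | apply hcompc1
        | apply hcomp_idc; auto | apply interchange; auto ].
Qed.

Definition op_cat (C : TwoCat) : TwoCat := MkTwoCat (op_laws C).
Definition co_cat (C : TwoCat) : TwoCat := MkTwoCat (co_laws C).
Definition prod_cat (C D : TwoCat) : TwoCat := MkTwoCat (prod_laws C D).

Section Inverse.
Context (C : TwoCat).
Implicit Types x y z : cell C.

Lemma inverse_cells_sym x y : inverse_cells x y -> inverse_cells y x.
Proof. intros [[Hd Hc] [H1 H2]]; repeat split; congruence. Qed.

Lemma inverse_cells_unique x y z :
  inverse_cells x y -> inverse_cells x z -> y = z.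
Proof.
intros [[Hd Hc] [H1 H2]] [[Kd Kc] [K1 K2]].
rewrite <- (vcompc1 y), Hd, <- K1, vcompA, H2, <- Kc by congruence.
apply vcomp1c.
Qed.

Lemma inverse_cells_idc (a : mor C) : inverse_cells (idc a) (idc a).
Proof.
assert (H : idc a • idc a = idc a).
{ pose proof (vcomp1c (idc a)) as E; rewrite cod_idc in E; exact E. }
repeat split; rewrite ?dom_idc, ?cod_idc; auto.
Qed.

Lemma inverse_cells_vcomp x x' y y' : dom x = cod y ->
  inverse_cells x x' -> inverse_cells y y' -> inverse_cells (x • y) (y' • x').
Proof.
intros H [[Hd Hc] [H1 H2]] [[Kd Kc] [K1 K2]].
repeat split; cat_bd.
- rewrite vcompA, <- (vcompA (x:=x) (y:=y) (z:=y')), K1, <- H, vcompc1 by cat_bd; exact H1.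
- rewrite vcompA, <- (vcompA (x:=y') (y:=x') (z:=x)), H2, H, <- Kd, vcompc1 by cat_bd.
  exact K2.
Qed.

Lemma inverse_cells_hcomp x x' y y' : src (dom x) = tgt (dom y) ->
  inverse_cells x x' -> inverse_cells y y' -> inverse_cells (x ⊛ y) (x' ⊛ y').
Proof.
intros H [[Hd Hc] [H1 H2]] [[Kd Kc] [K1 K2]].
assert (src (dom x') = tgt (dom y')) by (rewrite Hd, Kd; cat_bd).
repeat split; cat_bd; rewrite <- interchange, ?H1, ?H2, ?K1, ?K2 by cat_bd;
 rewrite hcomp_idc; cat_bd.
Qed.

(** Conjugating a commuting square by invertible sides. *)
Lemma inverse_cells_square p p' q q' x y : dom p = cod x -> dom y = cod q ->
  inverse_cells p p' -> inverse_cells q q' -> p • x = y • q ->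
  x • q' = p' • y.
Proof.
intros Hp Hq [[Pd Pc] [P1 P2]] [[Qd Qc] [Q1 Q2]] H.
assert (dom x = dom q).
{ rewrite <- (dom_vcomp Hp), H; cat_bd. }
assert (cod p = cod y).
{ rewrite <- (cod_vcomp Hp), H; cat_bd. }
rewrite <- (vcomp1c x), <- Hp, <- P2, <- (vcompA (x:=p') (y:=p) (z:=x)), H by cat_bd.
rewrite vcompA, <- (vcompA (x:=p' • y) (y:=q) (z:=q')), Q1, <- Hq by cat_bd.
pose proof (vcompc1 (p' • y)) as E; rewrite dom_vcomp in E; cat_bd.
Qed.
End Inverse.

Definition op_map (C D : TwoCatData) (F : cat_map C D) :
    cat_map (op_data C) (op_data D) :=
  @CatMap (op_data C) (op_data D) (on0 F) (on1 F) (on2 F).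
Definition co_map (C D : TwoCatData) (F : cat_map C D) :
    cat_map (co_data C) (co_data D) :=
  @CatMap (co_data C) (co_data D) (on0 F) (on1 F) (on2 F).
Definition op_coh (C D : TwoCatData) (c : weak_coh C D) :
    weak_coh (op_data C) (op_data D) :=
  @WeakCoh (op_data C) (op_data D)
    (fun a b => phi_inv c b a) (fun a b => phi c b a) (phi1_inv c) (phi1 c).
Definition co_coh (C D : TwoCatData) (c : weak_coh C D) :
    weak_coh (co_data C) (co_data D) :=
  @WeakCoh (co_data C) (co_data D)
    (fun a b => phi c b a) (fun a b => phi_inv c b a) (phi1 c) (phi1_inv c).

Lemma co_weak (C D : TwoCat) (F : cat_map C D) (c : weak_coh C D) :
  weak_functor_laws F c -> weak_functor_laws (co_map F) (co_coh c).
Proof.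
intros [? ? ? ? ? ? Hc Hi Hc1 Hi1 ? Ha ? ?].
constructor; cbn; auto; intros.
- exact (Hc _ _ (eq_sym H)).
- exact (Hi _ _ (eq_sym H)).
- symmetry; auto.
Qed.

Ltac bd_ext ::=
  match goal with
  | H : dom (phi _ _ _) = _ |- _ => rewrite H
  | H : cod (phi _ _ _) = _ |- _ => rewrite H
  | H : dom (phi1 _ _) = _ |- _ => rewrite H
  | H : cod (phi1 _ _) = _ |- _ => rewrite H
  | H : forall _, src (on1 _ _) = _ |- _ => rewrite H
  | H : forall _, tgt (on1 _ _) = _ |- _ => rewrite H
  | H : forall _, dom (on2 _ _) = _ |- _ => rewrite H
  | H : forall _, cod (on2 _ _) = _ |- _ => rewrite H
  end.

Lemma op_weak (C D : TwoCat) (F : cat_map C D) (c : weak_coh C D) :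
  weak_functor_laws F c -> weak_functor_laws (op_map F) (op_coh c).
Proof.
intros [Fs Ft Fd Fc Fi Fv Hc Hi Hc1 Hi1 Hn Ha Hr Hl].
constructor; cbn; auto.
- intros a b H; symmetry in H.
  destruct (Hc _ _ H), (Hi _ _ H) as [[] []]; split; cbn; congruence.
- intros a b H; symmetry in H.
  destruct (Hc _ _ H), (Hi _ _ H) as [[] []]; repeat split; cbn; congruence.
- intros A; destruct (Hc1 A), (Hi1 A) as [[] []]; split; cbn; congruence.
- intros A; destruct (Hc1 A), (Hi1 A) as [[] []]; repeat split; cbn; congruence.
- intros x y H. rewrite src_cod, tgt_cod in H. symmetry in H.
  destruct (Hc (cod y) (cod x)) as [? ?]; [cat_bd|].
  destruct (Hc (dom y) (dom x)) as [? ?]; [cat_bd|].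
  assert (H' : src (dom (on2 F y)) = tgt (dom (on2 F x)))
    by (rewrite !Fd, Fs, Ft; congruence).
  apply inverse_cells_square
    with (phi c (cod y) (cod x)) (phi c (dom y) (dom x)).
  + rewrite cod_hcomp, !Fc; auto.
  + rewrite Fd, dom_hcomp; auto.
  + apply Hi; cat_bd.
  + apply Hi; cat_bd.
  + auto.
- intros a b d H1 H2; symmetry in H1, H2.
  destruct (Hc _ _ H1), (Hc _ _ H2).
  assert (src (d ∘ b) = tgt a) by cat_bd.
  assert (src d = tgt (b ∘ a)) by cat_bd.
  destruct (Hc (d ∘ b) a), (Hc d (b ∘ a)); auto.
  apply inverse_cells_unique
    with (phi c d (b ∘ a) • (idc (on1 F d) ⊛ phi c b a)).
  + apply inverse_cells_vcomp; auto.
    * cat_bd.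
    * apply inverse_cells_hcomp; auto using inverse_cells_idc; cat_bd.
  + rewrite <- Ha by auto.
    apply inverse_cells_vcomp; auto.
    * cat_bd.
    * apply inverse_cells_hcomp; auto using inverse_cells_idc; cat_bd.
- intros a.
  assert (H : src (idm (tgt a)) = tgt a) by cat_bd.
  destruct (Hc _ _ H), (Hc1 (tgt a)) as [K1 K2].
  apply inverse_cells_unique
    with (phi c (idm (tgt a)) a • (phi1 c (tgt a) ⊛ idc (on1 F a))).
  + apply inverse_cells_vcomp; auto; cat_bd.
    apply inverse_cells_hcomp; auto using inverse_cells_idc; cat_bd.
  + rewrite Hl; apply inverse_cells_idc.
- intros a.
  assert (H : src a = tgt (idm (src a))) by cat_bd.
  destruct (Hc _ _ H), (Hc1 (src a)) as [K1 K2].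
  apply inverse_cells_unique
    with (phi c a (idm (src a)) • (idc (on1 F a) ⊛ phi1 c (src a))).
  + apply inverse_cells_vcomp; auto; cat_bd.
    apply inverse_cells_hcomp; auto using inverse_cells_idc; cat_bd.
  + rewrite Hr; apply inverse_cells_idc.
Qed.

Definition swap_map (A B D : TwoCatData) (F : cat_map (prod_data A B) D) :
    cat_map (prod_data B A) D :=
  @CatMap (prod_data B A) D
    (fun X => on0 F (snd X, fst X)) (fun a => on1 F (snd a, fst a))
    (fun x => on2 F (snd x, fst x)).
Definition swap_coh (A B D : TwoCatData) (c : weak_coh (prod_data A B) D) :
    weak_coh (prod_data B A) D :=
  @WeakCoh (prod_data B A) D
    (fun a b => phi c (snd a, fst a) (snd b, fst b))
    (fun a b => phi_inv c (snd a, fst a) (snd b, fst b))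
    (fun X => phi1 c (snd X, fst X)) (fun X => phi1_inv c (snd X, fst X)).

Lemma swap_weak (A B D : TwoCatData) (F : cat_map (prod_data A B) D)
    (c : weak_coh (prod_data A B) D) :
  weak_functor_laws F c -> weak_functor_laws (swap_map F) (swap_coh c).
Proof.
intros [Fs Ft Fd Fc Fi Fv Hc Hi Hc1 Hi1 Hn Ha Hr Hl].
assert (P : forall (X Y X' Y' : Type) (f : X' * Y' -> X) (g : X' * Y' -> Y)
  (p q : X' * Y'), (f p, g p) = (f q, g q) -> (g p, f p) = (g q, f q))
  by (intros; congruence).
constructor; cbn.
- intros a; exact (Fs (snd a, fst a)).
- intros a; exact (Ft (snd a, fst a)).
- intros a; exact (Fd (snd a, fst a)).
- intros a; exact (Fc (snd a, fst a)).
- intros a; exact (Fi (snd a, fst a)).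
- intros x y H; apply (Fv (snd x, fst x) (snd y, fst y)); cbn; congruence.
- intros a b H; apply (Hc (snd a, fst a) (snd b, fst b)); cbn; congruence.
- intros a b H; apply (Hi (snd a, fst a) (snd b, fst b)); cbn; congruence.
- intros X; exact (Hc1 (snd X, fst X)).
- intros X; exact (Hi1 (snd X, fst X)).
- intros x y H; apply (Hn (snd x, fst x) (snd y, fst y)); cbn; congruence.
- intros a b d H1 H2.
  apply (Ha (snd a, fst a) (snd b, fst b) (snd d, fst d)); cbn; congruence.
- intros a; exact (Hr (snd a, fst a)).
- intros a; exact (Hl (snd a, fst a)).
Qed.

Lemma inverse_cells_on2 (C D : TwoCatData) (F : cat_map C D) (c : weak_coh C D)
    (x y : cell C) : weak_functor_laws F c ->
  inverse_cells x y -> inverse_cells (on2 F x) (on2 F y).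
Proof.
intros [Fs Ft Fd Fc Fi Fv _ _ _ _ _ _ _ _] [[H1 H2] [H3 H4]].
repeat split.
- rewrite Fd, Fc; congruence.
- rewrite Fd, Fc; congruence.
- rewrite <- Fv, H3, Fi, Fc; congruence.
- rewrite <- Fv, H4, Fi, Fd; congruence.
Qed.

Section Tricat.
Context (T : Tricat).

Lemma tprod2_inverse (C D E : tobj T) (x x' : cell (thom D E))
    (y y' : cell (thom C D)) : inverse_cells x x' -> inverse_cells y y' ->
  inverse_cells (x □₂ y) (x' □₂ y').
Proof.
intros [[? ?] [? ?]] [[? ?] [? ?]].
apply inverse_cells_on2 with (tcoh C D E); [apply tprod_weak|].
repeat split; cbn; congruence.
Qed.

Context (C D E : tobj T).
Lemma dom_tprod2 (x : cell (thom D E)) (y : cell (thom C D)) :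
  dom (x □₂ y) = dom x □₁ dom y.
Proof. destruct (tprod_weak C D E) as [_ _ H]; apply H. Qed.
Lemma cod_tprod2 (x : cell (thom D E)) (y : cell (thom C D)) :
  cod (x □₂ y) = cod x □₁ cod y.
Proof. destruct (tprod_weak C D E) as [_ _ _ H]; apply H. Qed.
Lemma src_tprod1 (x : mor (thom D E)) (y : mor (thom C D)) :
  src (x □₁ y) = src x □₀ src y.
Proof. destruct (tprod_weak C D E) as [H]; apply H. Qed.
Lemma tgt_tprod1 (x : mor (thom D E)) (y : mor (thom C D)) :
  tgt (x □₁ y) = tgt x □₀ tgt y.
Proof. destruct (tprod_weak C D E) as [_ H]; apply H. Qed.
Lemma tphi_cell (m1 n1 : mor (thom D E)) (m2 n2 : mor (thom C D)) :
  src m1 = tgt n1 -> src m2 = tgt n2 ->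
  is_cell (tphi m1 m2 n1 n2) ((m1 □₁ m2) ∘ (n1 □₁ n2))
    ((m1 ∘ n1) □₁ (m2 ∘ n2)).
Proof.
intros H1 H2; apply (phi_cell (weak_functor_laws := tprod_weak C D E)
  (a := (m1, m2)) (b := (n1, n2))); cbn; congruence.
Qed.
Lemma tphi_invP (m1 n1 : mor (thom D E)) (m2 n2 : mor (thom C D)) :
  src m1 = tgt n1 -> src m2 = tgt n2 ->
  inverse_cells (tphi m1 m2 n1 n2) (tphi_inv m1 m2 n1 n2).
Proof.
intros H1 H2.
apply (phi_invP (weak_functor_laws := tprod_weak C D E)
  (a := (m1, m2)) (b := (n1, n2))); cbn; congruence.
Qed.
End Tricat.

(** [T^op]: each [T(C, D)] is replaced by [T(C, D)^op], with the same [□]. *)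
Definition op_tricat_data (T : TricatData) : TricatData := {|
  tobj := tobj T;
  thom C D := op_cat (thom C D);
  tunit := @tunit T;
  tprod C D E := op_map (tprod C D E);
  tcoh C D E := op_coh (tcoh C D E)
|}.

(** [T_op]: [T_op(C, D)] is [T(D, C)_op], with [□] reversed. *)
Definition co_tricat_data (T : TricatData) : TricatData := {|
  tobj := tobj T;
  thom C D := co_cat (thom D C);
  tunit := @tunit T;
  tprod C D E := co_map (swap_map (tprod E D C));
  tcoh C D E := co_coh (swap_coh (tcoh E D C))
|}.

Lemma op_tricat_laws (T : Tricat) : tricat_laws (op_tricat_data T).
Proof.
constructor.
- intros C D E.
  exact (@op_weak (prod_cat (@thom T D E) (@thom T C D)) (@thom T C E)
    _ _ (tprod_weak (T := T) C D E)).
- intros C D E g f; exact (tprod_idm (T := T) g f).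
- intros C D E g f; cbn in C, D, E, g, f.
  change (phi1_inv (tcoh C D E) (g, f) = idc (idm (g □₀ f))).
  apply inverse_cells_unique with (phi1 (tcoh C D E) (g, f)).
  + apply (phi1_invP (weak_functor_laws := tprod_weak C D E)).
  + rewrite tprod_phi1; apply inverse_cells_idc.
- intros; apply (tprod0A (T := T)).
- intros; apply (tprod1A (T := T)).
- intros; apply (tprod2A (T := T)).
- intros B C D E l l' m m' n n' Hl Hm Hn; cbn in B, C, D, E, l, l', m, m', n, n', Hl, Hm, Hn.
  symmetry in Hl, Hm, Hn.
  change ((tphi_inv (l' □₁ m') n' (l □₁ m) n)
     • (tphi_inv l' m' l m □₂ idc (n' ∘ n)) =
    tphi_inv l' (m' □₁ n') l (m □₁ n)
     • (idc (l' ∘ l) □₂ tphi_inv m' n' m n)).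
  destruct (tphi_cell Hl Hm), (tphi_cell Hm Hn).
  assert (Hlm : src (l' □₁ m') = tgt (l □₁ m))
    by (rewrite src_tprod1, tgt_tprod1; congruence).
  assert (Hmn : src (m' □₁ n') = tgt (m □₁ n))
    by (rewrite src_tprod1, tgt_tprod1; congruence).
  destruct (tphi_cell Hlm Hn), (tphi_cell Hl Hmn).
  apply inverse_cells_unique with
    ((tphi l' m' l m □₂ idc (n' ∘ n)) • tphi (l' □₁ m') n' (l □₁ m) n).
  + apply inverse_cells_vcomp.
    * rewrite dom_tprod2, dom_idc; congruence.
    * apply tprod2_inverse; [now apply tphi_invP | apply inverse_cells_idc].
    * now apply tphi_invP.
  + rewrite tphiA by assumption.
    apply inverse_cells_vcomp.
    * rewrite dom_tprod2, dom_idc; congruence.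
    * apply tprod2_inverse; [apply inverse_cells_idc | now apply tphi_invP].
    * now apply tphi_invP.
- intros; apply (tprod1u0 (T := T)).
- intros; apply (tprodu10 (T := T)).
- intros; apply (tprod1u1 (T := T)).
- intros; apply (tprodu11 (T := T)).
- intros; apply (tprod1u2 (T := T)).
- intros; apply (tprodu12 (T := T)).
- intros C D m n H; cbn in C, D, m, n, H; symmetry in H.
  assert (K : src (idm (tunit D)) = tgt (idm (tunit D))) by cat_bd.
  change (tphi_inv (idm (tunit D)) n (idm (tunit D)) m = idc (n ∘ m)).
  apply inverse_cells_unique with (tphi (idm (tunit D)) n (idm (tunit D)) m).
  + now apply tphi_invP.
  + rewrite tphi1u by assumption; apply inverse_cells_idc.
- intros C D m n H; cbn in C, D, m, n, H; symmetry in H.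
  assert (K : src (idm (tunit C)) = tgt (idm (tunit C))) by cat_bd.
  change (tphi_inv n (idm (tunit C)) m (idm (tunit C)) = idc (n ∘ m)).
  apply inverse_cells_unique with (tphi n (idm (tunit C)) m (idm (tunit C))).
  + now apply tphi_invP.
  + rewrite tphiu1 by assumption; apply inverse_cells_idc.
Qed.

Lemma co_tricat_laws (T : Tricat) : tricat_laws (co_tricat_data T).
Proof.
constructor.
- intros C D E.
  exact (@co_weak (prod_cat (@thom T E D) (@thom T D C)) (@thom T E C)
    _ _ (swap_weak (tprod_weak (T := T) E D C))).
- intros C D E g f; exact (tprod_idm (T := T) f g).
- intros C D E g f; exact (tprod_phi1 (T := T) f g).
- intros; symmetry; apply (tprod0A (T := T)).
- intros; symmetry; apply (tprod1A (T := T)).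
- intros; symmetry; apply (tprod2A (T := T)).
- intros B C D E l l' m m' n n' Hl Hm Hn; cbn in *.
  symmetry; apply (tphiA (T := T) (eq_sym Hn) (eq_sym Hm) (eq_sym Hl)).
- intros; apply (tprodu10 (T := T)).
- intros; apply (tprod1u0 (T := T)).
- intros; apply (tprodu11 (T := T)).
- intros; apply (tprod1u1 (T := T)).
- intros; apply (tprodu12 (T := T)).
- intros; apply (tprod1u2 (T := T)).
- intros C D m n H; apply (tphiu1 (T := T) (eq_sym H)).
- intros C D m n H; apply (tphi1u (T := T) (eq_sym H)).
Qed.

Definition op_tricat (T : Tricat) : Tricat := MkTricat (op_tricat_laws T).
Definition co_tricat (T : Tricat) : Tricat := MkTricat (co_tricat_laws T).

(** [g □ f] is the Gray product of 1-morphisms, [g ◁ m] and [m ▷ f] its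
    extensions to a 2-morphism, [g ◀ x] and [x ▶ f] those to a 3-morphism;
    [tens m n] is the tensorator, [tens_inv m n] its inverse. *)
Record GrayData : Type := MkGrayData {
  gobj : Type;
  ghom : gobj -> gobj -> TwoCat;
  gunit : forall C, ob (ghom C C);
  gprod : forall C D E, ob (ghom D E) -> ob (ghom C D) -> ob (ghom C E);
  lwm : forall C D E, ob (ghom D E) -> mor (ghom C D) -> mor (ghom C E);
  lwc : forall C D E, ob (ghom D E) -> cell (ghom C D) -> cell (ghom C E);
  rwm : forall C D E, mor (ghom D E) -> ob (ghom C D) -> mor (ghom C E);
  rwc : forall C D E, cell (ghom D E) -> ob (ghom C D) -> cell (ghom C E);
  tens : forall C D E, mor (ghom D E) -> mor (ghom C D) -> cell (ghom C E);
  tens_inv : forall C D E, mor (ghom D E) -> mor (ghom C D) -> cell (ghom C E)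
}.
Arguments gunit {g} C.

Notation "g □ f" := (gprod g f) : gray_scope.
Notation "g ◁ m" := (lwm g m) : gray_scope.
Notation "m ▷ f" := (rwm m f) : gray_scope.
Notation "g ◀ x" := (lwc g x) : gray_scope.
Notation "x ▶ f" := (rwc x f) : gray_scope.

Definition lwhisker (G : GrayData) (C D E : gobj G) (g : ob (ghom D E)) :
    cat_map (ghom C D) (ghom C E) :=
  CatMap (fun f => g □ f) (fun m => g ◁ m) (fun x => g ◀ x).
Definition rwhisker (G : GrayData) (C D E : gobj G) (f : ob (ghom C D)) :
    cat_map (ghom D E) (ghom C E) :=
  CatMap (fun g => g □ f) (fun m => m ▷ f) (fun x => x ▶ f).

Class gray_laws (G : GrayData) : Prop := {
  lwhisker_functor : forall (C D E : gobj G) (g : ob (ghom D E)),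
    strict_functor_laws (lwhisker C g);
  rwhisker_functor : forall (C D E : gobj G) (f : ob (ghom C D)),
    strict_functor_laws (rwhisker E f);
  gprodA : forall (B C D E : gobj G)
      (h : ob (ghom D E)) (g : ob (ghom C D)) (f : ob (ghom B C)),
    h □ (g □ f) = (h □ g) □ f;
  lwmA : forall (B C D E : gobj G)
      (h : ob (ghom D E)) (g : ob (ghom C D)) (m : mor (ghom B C)),
    h ◁ (g ◁ m) = (h □ g) ◁ m;
  lrwmA : forall (B C D E : gobj G)
      (h : ob (ghom D E)) (m : mor (ghom C D)) (f : ob (ghom B C)),
    h ◁ (m ▷ f) = (h ◁ m) ▷ f;
  rwmA : forall (B C D E : gobj G)
      (m : mor (ghom D E)) (g : ob (ghom C D)) (f : ob (ghom B C)),
    m ▷ (g □ f) = (m ▷ g) ▷ f;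
  lwcA : forall (B C D E : gobj G)
      (h : ob (ghom D E)) (g : ob (ghom C D)) (x : cell (ghom B C)),
    h ◀ (g ◀ x) = (h □ g) ◀ x;
  lrwcA : forall (B C D E : gobj G)
      (h : ob (ghom D E)) (x : cell (ghom C D)) (f : ob (ghom B C)),
    h ◀ (x ▶ f) = (h ◀ x) ▶ f;
  rwcA : forall (B C D E : gobj G)
      (x : cell (ghom D E)) (g : ob (ghom C D)) (f : ob (ghom B C)),
    x ▶ (g □ f) = (x ▶ g) ▶ f;
  gprod1u : forall (C D : gobj G) (f : ob (ghom C D)), gunit D □ f = f;
  gprodu1 : forall (C D : gobj G) (f : ob (ghom C D)), f □ gunit C = f;
  lwm1u : forall (C D : gobj G) (m : mor (ghom C D)), gunit D ◁ m = m;
  rwmu1 : forall (C D : gobj G) (m : mor (ghom C D)), m ▷ gunit C = m;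
  lwc1u : forall (C D : gobj G) (x : cell (ghom C D)), gunit D ◀ x = x;
  rwcu1 : forall (C D : gobj G) (x : cell (ghom C D)), x ▶ gunit C = x;
  tens_cell : forall (C D E : gobj G)
      (m : mor (ghom D E)) (n : mor (ghom C D)),
    is_cell (tens m n) ((m ▷ tgt n) ∘ (src m ◁ n)) ((tgt m ◁ n) ∘ (m ▷ src n));
  tens_invP : forall (C D E : gobj G)
      (m : mor (ghom D E)) (n : mor (ghom C D)),
    inverse_cells (tens m n) (tens_inv m n);
  tens_id : forall (C D E : gobj G)
      (m : mor (ghom D E)) (n : mor (ghom C D)),
    is_id_mor m \/ is_id_mor n -> is_id_cell (tens m n);
  tens_nat : forall (C D E : gobj G)
      (x : cell (ghom D E)) (y : cell (ghom C D)),
    tens (cod x) (cod y)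
      • ((x ▶ tgt (dom y)) ⊛ (src (dom x) ◀ y)) =
    ((tgt (dom x) ◀ y) ⊛ (x ▶ src (dom y)))
      • tens (dom x) (dom y);
  tens_compr : forall (C D E : gobj G)
      (m : mor (ghom D E)) (n' n : mor (ghom C D)), src n' = tgt n ->
    tens m (n' ∘ n) =
    (idc (tgt m ◁ n') ⊛ tens m n) • (tens m n' ⊛ idc (src m ◁ n));
  tens_compl : forall (C D E : gobj G)
      (m' m : mor (ghom D E)) (n : mor (ghom C D)), src m' = tgt m ->
    tens (m' ∘ m) n =
    (tens m' n ⊛ idc (m ▷ src n)) • (idc (m' ▷ tgt n) ⊛ tens m n);
  tens_mid : forall (B C D E : gobj G)
      (m : mor (ghom D E)) (f : ob (ghom C D)) (n : mor (ghom B C)),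
    tens (m ▷ f) n = tens m (f ◁ n);
  tens_lw : forall (B C D E : gobj G)
      (f : ob (ghom D E)) (m : mor (ghom C D)) (n : mor (ghom B C)),
    tens (f ◁ m) n = f ◀ tens m n;
  tens_rw : forall (B C D E : gobj G)
      (m : mor (ghom D E)) (n : mor (ghom C D)) (f : ob (ghom B C)),
    tens m (n ▷ f) = tens m n ▶ f
}.

Record GrayCat : Type := MkGrayCat {
  gray_data :> GrayData;
  gray_ax : gray_laws gray_data
}.
#[export] Existing Instances gray_ax lwhisker_functor rwhisker_functor.

Definition gprod1 (G : GrayData) (C D E : gobj G)
    (m : mor (ghom D E)) (n : mor (ghom C D)) : mor (ghom C E) :=
  (m ▷ tgt n) ∘ (src m ◁ n).
Definition gprod2 (G : GrayData) (C D E : gobj G)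
    (x : cell (ghom D E)) (y : cell (ghom C D)) : cell (ghom C E) :=
  (x ▶ tgt (dom y)) ⊛ (src (dom x) ◀ y).

Definition gray_coh (G : GrayData) (C D E : gobj G) :
    weak_coh (prod_data (ghom D E) (ghom C D)) (ghom C E) :=
  @WeakCoh (prod_data (ghom D E) (ghom C D)) (ghom C E)
    (fun m n => idc (fst m ▷ tgt (snd m)) ⊛ tens_inv (fst n) (snd m)
                  ⊛ idc (src (fst n) ◁ snd n))
    (fun m n => idc (fst m ▷ tgt (snd m)) ⊛ tens (fst n) (snd m)
                  ⊛ idc (src (fst n) ◁ snd n))
    (fun g => idc (idm (fst g □ snd g)))
    (fun g => idc (idm (fst g □ snd g))).
Definition gray_tricat_data (G : GrayData) : TricatData := {|
  tobj := gobj G;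
  thom := @ghom G;
  tunit := @gunit G;
  tprod C D E := @CatMap (prod_data (ghom D E) (ghom C D)) (ghom C E)
    (fun g => fst g □ snd g) (fun m => gprod1 (fst m) (snd m))
    (fun x => gprod2 (fst x) (snd x));
  tcoh := @gray_coh G
|}.

Section Gray.
Context (G : GrayCat) (C D E : gobj G).
Implicit Types (g : ob (ghom D E)) (f : ob (ghom C D)).
Implicit Types (m : mor (ghom D E)) (n : mor (ghom C D)).
Implicit Types (x : cell (ghom D E)) (y : cell (ghom C D)).

Lemma src_lw g n : src (g ◁ n) = g □ src n.
Proof. exact (sf_src (F := lwhisker C g) n). Qed.
Lemma tgt_lw g n : tgt (g ◁ n) = g □ tgt n.
Proof. exact (sf_tgt (F := lwhisker C g) n). Qed.
Lemma dom_lw g y : dom (g ◀ y) = g ◁ dom y.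
Proof. exact (sf_dom (F := lwhisker C g) y). Qed.
Lemma cod_lw g y : cod (g ◀ y) = g ◁ cod y.
Proof. exact (sf_cod (F := lwhisker C g) y). Qed.
Lemma lw_idm g f : g ◁ idm f = idm (g □ f).
Proof. exact (sf_idm (F := lwhisker C g) f). Qed.
Lemma lw_idc g n : g ◀ idc n = idc (g ◁ n).
Proof. exact (sf_idc (F := lwhisker C g) n). Qed.
Lemma lw_comp g n n' : src n = tgt n' -> g ◁ (n ∘ n') = (g ◁ n) ∘ (g ◁ n').
Proof. exact (sf_comp (F := lwhisker C g) (a:=n) (b:=n')). Qed.
Lemma lw_hcomp g y y' : src (dom y) = tgt (dom y') ->
  g ◀ (y ⊛ y') = (g ◀ y) ⊛ (g ◀ y').
Proof. exact (sf_hcomp (F := lwhisker C g) (x:=y) (y:=y')). Qed.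
Lemma lw_vcomp g y y' : dom y = cod y' ->
  g ◀ (y • y') = (g ◀ y) • (g ◀ y').
Proof. exact (sf_vcomp (F := lwhisker C g) (x:=y) (y:=y')). Qed.
Lemma src_rw m f : src (m ▷ f) = src m □ f.
Proof. exact (sf_src (F := rwhisker E f) m). Qed.
Lemma tgt_rw m f : tgt (m ▷ f) = tgt m □ f.
Proof. exact (sf_tgt (F := rwhisker E f) m). Qed.
Lemma dom_rw x f : dom (x ▶ f) = dom x ▷ f.
Proof. exact (sf_dom (F := rwhisker E f) x). Qed.
Lemma cod_rw x f : cod (x ▶ f) = cod x ▷ f.
Proof. exact (sf_cod (F := rwhisker E f) x). Qed.
Lemma rw_idm g f : idm g ▷ f = idm (g □ f).
Proof. exact (sf_idm (F := rwhisker E f) g). Qed.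
Lemma rw_idc m f : idc m ▶ f = idc (m ▷ f).
Proof. exact (sf_idc (F := rwhisker E f) m). Qed.
Lemma rw_comp m m' f : src m = tgt m' -> (m ∘ m') ▷ f = (m ▷ f) ∘ (m' ▷ f).
Proof. exact (sf_comp (F := rwhisker E f) (a:=m) (b:=m')). Qed.
Lemma rw_hcomp x x' f : src (dom x) = tgt (dom x') ->
  (x ⊛ x') ▶ f = (x ▶ f) ⊛ (x' ▶ f).
Proof. exact (sf_hcomp (F := rwhisker E f) (x:=x) (y:=x')). Qed.
Lemma rw_vcomp x x' f : dom x = cod x' ->
  (x • x') ▶ f = (x ▶ f) • (x' ▶ f).
Proof. exact (sf_vcomp (F := rwhisker E f) (x:=x) (y:=x')). Qed.
Lemma dom_tens m n : dom (tens m n) = (m ▷ tgt n) ∘ (src m ◁ n).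
Proof. apply tens_cell. Qed.
Lemma cod_tens m n : cod (tens m n) = (tgt m ◁ n) ∘ (m ▷ src n).
Proof. apply tens_cell. Qed.
Lemma dom_tens_inv m n : dom (tens_inv m n) = (tgt m ◁ n) ∘ (m ▷ src n).
Proof. rewrite <- cod_tens; apply tens_invP. Qed.
Lemma cod_tens_inv m n : cod (tens_inv m n) = (m ▷ tgt n) ∘ (src m ◁ n).
Proof. rewrite <- dom_tens; apply tens_invP. Qed.
End Gray.

Ltac bd_ext ::= first
  [ match goal with
    | H : src ?a = _ |- context [src ?a] => is_var a; rewrite H
    | H : dom ?a = _ |- context [dom ?a] => is_var a; rewrite H
    | H : cod ?a = _ |- context [cod ?a] => is_var a; rewrite H
    end
  | rewrite src_lw | rewrite tgt_lw | rewrite dom_lw | rewrite cod_lw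
  | rewrite src_rw | rewrite tgt_rw | rewrite dom_rw | rewrite cod_rw
  | rewrite dom_tens | rewrite cod_tens
  | rewrite dom_tens_inv | rewrite cod_tens_inv ].

Section Tens.
Context (G : GrayCat) (C D E : gobj G).
Implicit Types (m : mor (ghom D E)) (n : mor (ghom C D)).

Lemma tens_inv_id m n :
  is_id_mor m \/ is_id_mor n -> is_id_cell (tens_inv m n).
Proof.
intros H.
assert (K : tens_inv m n = tens m n).
{ apply inverse_cells_unique with (tens m n); [apply tens_invP|].
  rewrite (tens_id H); apply inverse_cells_idc. }
rewrite K; now apply tens_id.
Qed.

Lemma tens_inv_nat (x : cell (ghom D E)) (y : cell (ghom C D)) :
  tens_inv (cod x) (cod y) • ((tgt (dom x) ◀ y) ⊛ (x ▶ src (dom y))) =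
  ((x ▶ tgt (dom y)) ⊛ (src (dom x) ◀ y)) • tens_inv (dom x) (dom y).
Proof.
symmetry.
apply inverse_cells_square with (tens (cod x) (cod y)) (tens (dom x) (dom y)).
- cat_bd.
- cat_bd.
- apply tens_invP.
- apply tens_invP.
- apply tens_nat.
Qed.

Lemma tens_inv_compr m (n' n : mor (ghom C D)) : src n' = tgt n ->
  tens_inv m (n' ∘ n) =
  (tens_inv m n' ⊛ idc (src m ◁ n)) • (idc (tgt m ◁ n') ⊛ tens_inv m n).
Proof.
intros H; apply inverse_cells_unique with (tens m (n' ∘ n)).
- apply tens_invP.
- rewrite tens_compr by assumption; apply inverse_cells_vcomp.
  + cat_assoc.
  + apply inverse_cells_hcomp; first [ apply tens_invP | apply inverse_cells_idc | cat_bd ].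
  + apply inverse_cells_hcomp; first [ apply tens_invP | apply inverse_cells_idc | cat_bd ].
Qed.

Lemma tens_inv_compl (m' m : mor (ghom D E)) n : src m' = tgt m ->
  tens_inv (m' ∘ m) n =
  (idc (m' ▷ tgt n) ⊛ tens_inv m n) • (tens_inv m' n ⊛ idc (m ▷ src n)).
Proof.
intros H; apply inverse_cells_unique with (tens (m' ∘ m) n).
- apply tens_invP.
- rewrite tens_compl by assumption; apply inverse_cells_vcomp.
  + cat_assoc.
  + apply inverse_cells_hcomp; first [ apply tens_invP | apply inverse_cells_idc | cat_bd ].
  + apply inverse_cells_hcomp; first [ apply tens_invP | apply inverse_cells_idc | cat_bd ].
Qed.
End Tens.

Lemma inverse_cells_sf (C D : TwoCatData) (F : cat_map C D) (x y : cell C) :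
  strict_functor_laws F -> inverse_cells x y ->
  inverse_cells (on2 F x) (on2 F y).
Proof.
intros [Fs Ft Fd Fc Fm Fi FC Fh Fv] [[H1 H2] [H3 H4]].
repeat split.
- rewrite Fd, Fc; congruence.
- rewrite Fd, Fc; congruence.
- rewrite <- Fv, H3, Fi, Fc; congruence.
- rewrite <- Fv, H4, Fi, Fd; congruence.
Qed.

Section TensWhisker.
Context (G : GrayCat) (B C D E : gobj G).
Lemma tens_inv_mid (m : mor (ghom D E)) (f : ob (ghom C D))
    (n : mor (ghom B C)) : tens_inv (m ▷ f) n = tens_inv m (f ◁ n).
Proof.
apply inverse_cells_unique with (tens (m ▷ f) n); [apply tens_invP|].
rewrite tens_mid; apply tens_invP.
Qed.
Lemma tens_inv_lw (f : ob (ghom D E)) (m : mor (ghom C D))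
    (n : mor (ghom B C)) : tens_inv (f ◁ m) n = f ◀ tens_inv m n.
Proof.
apply inverse_cells_unique with (tens (f ◁ m) n); [apply tens_invP|].
rewrite tens_lw.
apply (inverse_cells_sf (lwhisker_functor B f)), tens_invP.
Qed.
Lemma tens_inv_rw (m : mor (ghom D E)) (n : mor (ghom C D))
    (f : ob (ghom B C)) : tens_inv m (n ▷ f) = tens_inv m n ▶ f.
Proof.
apply inverse_cells_unique with (tens m (n ▷ f)); [apply tens_invP|].
rewrite tens_rw.
apply (inverse_cells_sf (rwhisker_functor E f)), tens_invP.
Qed.
End TensWhisker.

Section Interchange.
Context (C : TwoCat).
Lemma whisker_vcompl (a : mor C) (x y : cell C) :
  dom x = cod y -> src a = tgt (dom y) ->
  idc a ⊛ (x • y) = (idc a ⊛ x) • (idc a ⊛ y).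
Proof.
intros H1 H2.
rewrite <- interchange by cat_bd.
pose proof (vcomp1c (idc a)) as K; rewrite cod_idc in K; now rewrite K.
Qed.
Lemma whisker_vcompr (a : mor C) (x y : cell C) :
  dom x = cod y -> src (dom y) = tgt a ->
  (x • y) ⊛ idc a = (x ⊛ idc a) • (y ⊛ idc a).
Proof.
intros H1 H2.
rewrite <- interchange by cat_bd.
pose proof (vcomp1c (idc a)) as K; rewrite cod_idc in K; now rewrite K.
Qed.
Lemma interchange_swap (x y : cell C) : src (dom x) = tgt (dom y) ->
  (idc (cod x) ⊛ y) • (x ⊛ idc (dom y)) =
  (x ⊛ idc (cod y)) • (idc (dom x) ⊛ y).
Proof.
intros H; rewrite <- !interchange by cat_bd.
now rewrite !vcomp1c, !vcompc1.
Qed.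
End Interchange.

Ltac whisker_norm :=
  repeat first
    [ rewrite whisker_vcompl by cat_assoc | rewrite whisker_vcompr by cat_assoc ];
  repeat (rewrite <- hcomp_idc by cat_assoc);
  repeat (rewrite hcompA by cat_assoc);
  repeat (rewrite vcompA by cat_assoc).

Section CoherenceAssoc.
Context (C : TwoCat).

Lemma coh_assoc1 (A P Q Z V U W Y M N R S : mor C) (s t u : cell C) :
  is_cell t (M ∘ N) (P ∘ V) -> is_cell s (V ∘ U) (W ∘ Y) ->
  is_cell u (R ∘ S) (U ∘ Q) ->
  src A = tgt P -> src P = tgt V -> src V = tgt U -> src U = tgt Q ->
  src Q = tgt Z -> src M = tgt N -> src N = tgt R -> src R = tgt S ->
  tgt M = tgt P -> src N = src V -> tgt W = tgt V -> src W = tgt Y ->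
  src Y = src U -> src S = src Q -> tgt R = tgt U ->
  ((idc (A ∘ P) ⊛ ((s ⊛ idc Q) • (idc V ⊛ u))) ⊛ idc Z)
    • ((idc A ⊛ t ⊛ idc R) ⊛ idc (S ∘ Z)) =
  ((idc A ⊛ ((idc P ⊛ s) • (t ⊛ idc U))) ⊛ idc (Q ∘ Z))
    • (idc (A ∘ M) ⊛ (idc N ⊛ u ⊛ idc Z)).
Proof.
intros [dt ct] [ds cs] [du cu]; intros.
assert (K : idc A ⊛ ((idc (P ∘ V) ⊛ u) • (t ⊛ idc (R ∘ S))) ⊛ idc Z =
  idc A ⊛ ((t ⊛ idc (U ∘ Q)) • (idc (M ∘ N) ⊛ u)) ⊛ idc Z).
{ rewrite <- dt, <- ct, <- du, <- cu, interchange_swap; cat_bd. }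
revert K; whisker_norm; intros K.
rewrite <- vcompA, K by cat_assoc; whisker_norm; reflexivity.
Qed.

Lemma coh_assoc2 (L L1 L2 L' M M1 M2 M3 N0 N1 N2 Z : mor C) (s t u : cell C) :
  is_cell s (M ∘ L1) (L' ∘ M1) -> is_cell t (N0 ∘ L2) (L1 ∘ N1) ->
  is_cell u (N1 ∘ M2) (M3 ∘ N2) ->
  src L = tgt L' -> tgt M = tgt L' -> src M = tgt L1 -> src L' = tgt M1 ->
  src M1 = src L1 -> tgt N0 = tgt L1 -> src N0 = tgt L2 -> src L1 = tgt N1 ->
  src L2 = src N1 -> src N1 = tgt M2 -> src M3 = tgt N2 -> tgt M3 = tgt N1 ->
  src M2 = src N2 -> src N2 = tgt Z ->
  ((idc L ⊛ s ⊛ idc M3) ⊛ idc (N2 ∘ Z))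
    • (idc (L ∘ M) ⊛ ((idc L1 ⊛ u) • (t ⊛ idc M2)) ⊛ idc Z) =
  (idc (L ∘ L') ⊛ (idc M1 ⊛ u ⊛ idc Z))
    • (idc L ⊛ ((s ⊛ idc N1) • (idc M ⊛ t)) ⊛ idc (M2 ∘ Z)).
Proof.
intros [ds cs] [dt ct] [du cu]; intros.
assert (K : idc L ⊛ ((idc (L' ∘ M1) ⊛ u) • (s ⊛ idc (N1 ∘ M2))) ⊛ idc Z =
  idc L ⊛ ((s ⊛ idc (M3 ∘ N2)) • (idc (M ∘ L1) ⊛ u)) ⊛ idc Z).
{ rewrite <- ds, <- cs, <- du, <- cu, interchange_swap; cat_bd. }
revert K; whisker_norm; intros K.
rewrite <- K; reflexivity.
Qed.

Lemma coh_nat (p x y b s s' x' y' : cell C) :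
  s' • (x ⊛ y) = (y' ⊛ x') • s ->
  cod s = dom y' ∘ dom x' -> dom s' = cod x ∘ cod y ->
  dom s = dom x ∘ dom y -> cod s' = cod y' ∘ cod x' ->
  src (dom p) = tgt (dom x) -> src (dom x) = tgt (dom y) ->
  src (dom y) = tgt (dom b) -> src (dom y') = tgt (dom x') ->
  tgt (dom y') = tgt (dom x) -> src (dom x') = src (dom y) ->
  (idc (cod p) ⊛ s' ⊛ idc (cod b)) • ((p ⊛ x) ⊛ (y ⊛ b)) =
  ((p ⊛ y') ⊛ (x' ⊛ b)) • (idc (dom p) ⊛ s ⊛ idc (dom b)).
Proof.
intros H; intros.
transitivity (p ⊛ (s' • (x ⊛ y)) ⊛ b).
- rewrite hcompA, <- (hcompA (x:=p) (y:=x) (z:=y)) by cat_bd.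
  rewrite <- !interchange by cat_assoc.
  now rewrite !vcomp1c.
- rewrite H.
  rewrite hcompA, <- (hcompA (x:=p) (y:=y') (z:=x')) by cat_bd.
  rewrite <- !interchange by cat_assoc.
  now rewrite !vcompc1.
Qed.
End CoherenceAssoc.

Section GrayTricat.
Context (G : GrayCat).

Lemma gray_phi_cell (C D E : gobj G) (m1 n1 : mor (ghom D E))
    (m2 n2 : mor (ghom C D)) : src m1 = tgt n1 -> src m2 = tgt n2 ->
  is_cell (idc (m1 ▷ tgt m2) ⊛ tens_inv n1 m2 ⊛ idc (src n1 ◁ n2))
    (gprod1 m1 m2 ∘ gprod1 n1 n2) (gprod1 (m1 ∘ n1) (m2 ∘ n2)).
Proof.
intros H1 H2; unfold gprod1; split.
- cat_assoc. 
- cat_bd. rewrite lw_comp, rw_comp by assumption. cat_assoc.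
Qed.

Lemma gray_phi_inv (C D E : gobj G) (m1 n1 : mor (ghom D E))
    (m2 n2 : mor (ghom C D)) : src m1 = tgt n1 -> src m2 = tgt n2 ->
  inverse_cells
    (idc (m1 ▷ tgt m2) ⊛ tens_inv n1 m2 ⊛ idc (src n1 ◁ n2))
    (idc (m1 ▷ tgt m2) ⊛ tens n1 m2 ⊛ idc (src n1 ◁ n2)).
Proof.
intros H1 H2.
repeat apply inverse_cells_hcomp;
  first [ apply inverse_cells_sym, tens_invP | apply inverse_cells_idc
        | cat_bd ].
Qed.

Lemma gray_phi_id (C D E : gobj G) (m1 n1 : mor (ghom D E))
    (m2 n2 : mor (ghom C D)) : src m1 = tgt n1 -> src m2 = tgt n2 ->
  is_id_mor m2 \/ is_id_mor n1 ->
  idc (m1 ▷ tgt m2) ⊛ tens_inv n1 m2 ⊛ idc (src n1 ◁ n2) =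
  idc (gprod1 m1 m2 ∘ gprod1 n1 n2).
Proof.
intros H1 H2 H.
destruct (gray_phi_cell H1 H2) as [<- _].
assert (K : is_id_cell (tens_inv n1 m2)) by (apply tens_inv_id; tauto).
rewrite K, !hcomp_idc by cat_bd.
now rewrite dom_idc.
Qed.

Lemma gray_phi_nat (C D E : gobj G) (x y : cell (ghom D E))
    (x2 y2 : cell (ghom C D)) :
  src (dom x) = tgt (dom y) -> src (dom x2) = tgt (dom y2) ->
  (idc (cod x ▷ tgt (cod x2)) ⊛ tens_inv (cod y) (cod x2)
     ⊛ idc (src (cod y) ◁ cod y2)) • (gprod2 x x2 ⊛ gprod2 y y2) =
  gprod2 (x ⊛ y) (x2 ⊛ y2)
    • (idc (dom x ▷ tgt (dom x2)) ⊛ tens_inv (dom y) (dom x2)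
         ⊛ idc (src (dom y) ◁ dom y2)).
Proof.
intros H1 H2; unfold gprod2.
pose proof (tens_inv_nat y x2) as N.
pose proof (@coh_nat (ghom C E) (x ▶ tgt (dom x2)) (tgt (dom y) ◀ x2)
  (y ▶ src (dom x2)) (src (dom y) ◀ y2)
  (tens_inv (dom y) (dom x2)) (tens_inv (cod y) (cod x2))
  (src (dom y) ◀ x2) (y ▶ tgt (dom x2))) as K.
rewrite rw_hcomp, lw_hcomp by assumption.
revert K; cat_bd; rewrite H1, H2; intros K; apply K; auto; congruence.
Qed.

Lemma gray_phi_assoc (C D E : gobj G) (a1 b1 d1 : mor (ghom D E))
    (a2 b2 d2 : mor (ghom C D)) :
  src a1 = tgt b1 -> src a2 = tgt b2 -> src b1 = tgt d1 -> src b2 = tgt d2 ->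
  (idc ((a1 ∘ b1) ▷ tgt (a2 ∘ b2)) ⊛ tens_inv d1 (a2 ∘ b2)
     ⊛ idc (src d1 ◁ d2))
    • ((idc (a1 ▷ tgt a2) ⊛ tens_inv b1 a2 ⊛ idc (src b1 ◁ b2))
         ⊛ idc (gprod1 d1 d2)) =
  (idc (a1 ▷ tgt a2) ⊛ tens_inv (b1 ∘ d1) a2 ⊛ idc (src (b1 ∘ d1) ◁ (b2 ∘ d2)))
    • (idc (gprod1 a1 a2)
         ⊛ (idc (b1 ▷ tgt b2) ⊛ tens_inv d1 b2 ⊛ idc (src d1 ◁ d2))).
Proof.
intros H1 H2 H3 H4; unfold gprod1.
rewrite tens_inv_compr, tens_inv_compl by assumption.
rewrite rw_comp, lw_comp by assumption; cat_bd.
apply coh_assoc1 with (W := d1 ▷ tgt a2) (Y := src d1 ◁ a2)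
  (U := d1 ▷ tgt b2); try split; cat_bd.
Qed.

Lemma src_gprod1 (C D E : gobj G) (m : mor (ghom D E)) (n : mor (ghom C D)) :
  src (gprod1 m n) = src m □ src n.
Proof. unfold gprod1; cat_bd. Qed.
Lemma tgt_gprod1 (C D E : gobj G) (m : mor (ghom D E)) (n : mor (ghom C D)) :
  tgt (gprod1 m n) = tgt m □ tgt n.
Proof. unfold gprod1; cat_bd. Qed.
Lemma gprod1_idm (C D E : gobj G) (g : ob (ghom D E)) (f : ob (ghom C D)) :
  gprod1 (idm g) (idm f) = idm (g □ f).
Proof.
unfold gprod1; rewrite rw_idm, lw_idm; cat_bd.
pose proof (comp1m (idm (g □ f))) as K; rewrite tgt_idm in K; exact K.
Qed.

Lemma gray_phi_unitr (C D E : gobj G) (m : mor (ghom D E))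
    (n : mor (ghom C D)) :
  (idc (m ▷ tgt n) ⊛ tens_inv (idm (src m)) n
     ⊛ idc (src (idm (src m)) ◁ idm (src n)))
    • (idc (gprod1 m n) ⊛ idc (idm (src m □ src n))) = idc (gprod1 m n).
Proof.
rewrite gray_phi_id.
- rewrite gprod1_idm, hcomp_idc.
  + rewrite <- src_gprod1, compm1.
    pose proof (vcomp1c (idc (gprod1 m n))) as K.
    rewrite cod_idc in K; exact K.
  + rewrite src_gprod1; cat_bd.
- cat_bd.
- cat_bd.
- right; unfold is_id_mor; cat_bd.
Qed.

Lemma gray_phi_unitl (C D E : gobj G) (m : mor (ghom D E))
    (n : mor (ghom C D)) :
  (idc (idm (tgt m) ▷ tgt (idm (tgt n))) ⊛ tens_inv m (idm (tgt n))
     ⊛ idc (src m ◁ n))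
    • (idc (idm (tgt m □ tgt n)) ⊛ idc (gprod1 m n)) = idc (gprod1 m n).
Proof.
rewrite gray_phi_id.
- rewrite gprod1_idm, hcomp_idc.
  + rewrite <- tgt_gprod1, comp1m.
    pose proof (vcomp1c (idc (gprod1 m n))) as K.
    rewrite cod_idc in K; exact K.
  + rewrite tgt_gprod1; cat_bd.
- cat_bd.
- cat_bd.
- left; unfold is_id_mor; cat_bd.
Qed.

Lemma gray_weak (C D E : gobj G) :
  weak_functor_laws (tprod (t := gray_tricat_data G) C D E)
    (gray_coh C D E).
Proof.
constructor.
- intros [m n]; cbn; unfold gprod1; cat_bd.
- intros [m n]; cbn; unfold gprod1; cat_bd.
- intros [x y]; cbn; unfold gprod1, gprod2; cat_bd.
- intros [x y]; cbn; unfold gprod1, gprod2; cat_bd.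
- intros [m n]; cbn; unfold gprod1, gprod2; cat_bd.
  rewrite lw_idc, rw_idc; apply hcomp_idc; cat_bd.
- intros [x y] [x' y'] [= H1 H2]; cbn; unfold gprod2; cat_bd.
  rewrite lw_vcomp, rw_vcomp, interchange by cat_bd; reflexivity.
- intros [m1 m2] [n1 n2] [= H1 H2]; cbn.
  now apply gray_phi_cell.
- intros [m1 m2] [n1 n2] [= H1 H2]; cbn.
  now apply gray_phi_inv.
- intros [g f]; cbn; unfold gprod1; split; cat_bd.
  rewrite lw_idm, rw_idm.
  pose proof (comp1m (idm (g □ f))) as K; rewrite tgt_idm in K; auto.
- intros [g f]; apply inverse_cells_idc.
- intros [x x2] [y y2] [= H1 H2]; exact (gray_phi_nat H1 H2).
- intros [a1 a2] [b1 b2] [d1 d2] [= H1 H2] [= H3 H4].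
  exact (gray_phi_assoc H1 H2 H3 H4).
- intros [m n]; exact (gray_phi_unitr m n).
- intros [m n]; exact (gray_phi_unitl m n).
Qed.

Lemma gprod1A (B C D E : gobj G) (l : mor (ghom D E)) (m : mor (ghom C D))
    (n : mor (ghom B C)) : gprod1 l (gprod1 m n) = gprod1 (gprod1 l m) n.
Proof.
unfold gprod1; cat_bd.
rewrite lw_comp, rw_comp by cat_bd.
rewrite rwmA, lrwmA, lwmA; cat_assoc.
Qed.

Lemma gprod2A (B C D E : gobj G) (x : cell (ghom D E)) (y : cell (ghom C D))
    (z : cell (ghom B C)) : gprod2 x (gprod2 y z) = gprod2 (gprod2 x y) z.
Proof.
unfold gprod2; cat_bd.
rewrite lw_hcomp, rw_hcomp by cat_bd.
rewrite rwcA, lrwcA, lwcA, hcompA; cat_bd.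
Qed.

Lemma gprod1_unitl (C D : gobj G) (m : mor (ghom C D)) :
  gprod1 (idm (gunit D)) m = m.
Proof.
unfold gprod1; rewrite rw_idm, src_idm, lwm1u, gprod1u; apply comp1m.
Qed.
Lemma gprod1_unitr (C D : gobj G) (m : mor (ghom C D)) :
  gprod1 m (idm (gunit C)) = m.
Proof.
unfold gprod1; rewrite lw_idm, tgt_idm, rwmu1, gprodu1; apply compm1.
Qed.
Lemma gprod2_unitl (C D : gobj G) (x : cell (ghom C D)) :
  gprod2 (idc (idm (gunit D))) x = x.
Proof.
unfold gprod2; rewrite rw_idc, rw_idm, dom_idc, src_idm, lwc1u, gprod1u.
apply hcomp1c.
Qed.
Lemma gprod2_unitr (C D : gobj G) (x : cell (ghom C D)) :
  gprod2 x (idc (idm (gunit C))) = x.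
Proof.
unfold gprod2; rewrite lw_idc, lw_idm, dom_idc, tgt_idm, rwcu1, gprodu1.
apply hcompc1.
Qed.

Lemma gray_phiA (B C D E : gobj G) (l l' : mor (ghom D E))
    (m m' : mor (ghom C D)) (n n' : mor (ghom B C)) :
  src l = tgt l' -> src m = tgt m' -> src n = tgt n' ->
  gprod2 (idc (l ▷ tgt m) ⊛ tens_inv l' m ⊛ idc (src l' ◁ m')) (idc (n ∘ n'))
    • (idc (gprod1 l m ▷ tgt n) ⊛ tens_inv (gprod1 l' m') n
         ⊛ idc (src (gprod1 l' m') ◁ n')) =
  gprod2 (idc (l ∘ l')) (idc (m ▷ tgt n) ⊛ tens_inv m' n ⊛ idc (src m' ◁ n'))
    • (idc (l ▷ tgt (gprod1 m n)) ⊛ tens_inv l' (gprod1 m n)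
         ⊛ idc (src l' ◁ gprod1 m' n')).
Proof.
intros H1 H2 H3; unfold gprod2.
repeat rewrite lw_hcomp by cat_bd.
repeat rewrite rw_hcomp by cat_bd.
unfold gprod1.
rewrite tens_inv_compl, tens_inv_compr by cat_bd.
rewrite tens_inv_mid, tens_inv_lw, tens_inv_rw by cat_bd.
rewrite !lw_idc, !rw_idc; cat_bd.
rewrite !rwmA, !rw_comp, !lw_comp by cat_bd.
rewrite !lrwmA, !lwmA.
apply coh_assoc2 with (L1 := l' ▷ tgt m' ▷ tgt n) (M1 := (src l' ◁ m) ▷ tgt n)
  (N1 := (src l' □ tgt m') ◁ n)
  (N0 := (tgt l' □ tgt m') ◁ n) (L2 := l' ▷ tgt m' ▷ tgt n'); try split; cat_bd.
all: rewrite ?rw_comp, ?lw_comp by cat_bd.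
all: now rewrite ?lrwmA, ?lwmA, ?rwmA.
Qed.

Lemma gray_phi_1u (C D : gobj G) (m n : mor (ghom C D)) : src m = tgt n ->
  idc (idm (gunit D) ▷ tgt m) ⊛ tens_inv (idm (gunit D)) m
    ⊛ idc (src (idm (gunit D)) ◁ n) = idc (m ∘ n).
Proof.
intros H; rewrite gray_phi_id, !gprod1_unitl; cat_bd.
right; unfold is_id_mor; cat_bd.
Qed.
Lemma gray_phi_u1 (C D : gobj G) (m n : mor (ghom C D)) : src m = tgt n ->
  idc (m ▷ tgt (idm (gunit C))) ⊛ tens_inv n (idm (gunit C))
    ⊛ idc (src n ◁ idm (gunit C)) = idc (m ∘ n).
Proof.
intros H; rewrite gray_phi_id, !gprod1_unitr; cat_bd.
left; unfold is_id_mor; cat_bd.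
Qed.

Lemma gray_tricat_laws : tricat_laws (gray_tricat_data G).
Proof.
constructor.
- exact gray_weak.
- intros C D E g f; apply gprod1_idm.
- reflexivity.
- intros; apply gprodA.
- intros; apply gprod1A.
- intros; apply gprod2A.
- intros B C D E l l' m m' n n' H1 H2 H3; exact (gray_phiA H1 H2 H3).
- intros; apply gprod1u.
- intros; apply gprodu1.
- intros; apply gprod1_unitl.
- intros; apply gprod1_unitr.
- intros; apply gprod2_unitl.
- intros; apply gprod2_unitr.
- intros C D m n H; exact (gray_phi_1u H).
- intros C D m n H; exact (gray_phi_u1 H).
Qed.
End GrayTricat.

Definition gray_tricat (G : GrayCat) : Tricat := MkTricat (gray_tricat_laws G).

(** [pstar1], [pstar2] are the action of [*] on 1- and 2-morphisms; [*] is
    the identity on objects. *)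
Record PlanarData (C : TwoCatData) : Type := MkPlanarData {
  pstar1 : mor C -> mor C;
  pstar2 : cell C -> cell C;
  peps : mor C -> cell C
}.

Class planar_laws (C : TwoCatData) (P : PlanarData C) : Prop := {
  pstar_functor : strict_functor_laws
    (@CatMap C (op_data C) (fun A => A) (pstar1 P) (pstar2 P));
  pstar1K : forall a, pstar1 P (pstar1 P a) = a;
  pstar2K : forall x, pstar2 P (pstar2 P x) = x;
  peps_cell : forall a, is_cell (peps P a) (idm (tgt a)) (a ∘ pstar1 P a);
  peps_nat : forall x,
    (x ⊛ idc (pstar1 P (dom x))) • peps P (dom x) =
    (idc (cod x) ⊛ pstar2 P x) • peps P (cod x);
  peps_snake : forall a,
    (idc a ⊛ pstar2 P (peps P (pstar1 P a))) • (peps P a ⊛ idc a) = idc a;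
  peps_comp : forall a c, src a = tgt c ->
    (idc a ⊛ peps P c ⊛ idc (pstar1 P a)) • peps P a = peps P (a ∘ c)
}.

Record GrayDualsData : Type := MkGrayDualsData {
  gd_gray :> GrayCat;
  gd_planar : forall C D : gobj gd_gray, PlanarData (ghom C D);
  dual : forall C D : gobj gd_gray, ob (ghom C D) -> ob (ghom D C);
  eta : forall C D : gobj gd_gray, ob (ghom C D) -> mor (ghom D D);
  triang : forall C D : gobj gd_gray, ob (ghom C D) -> cell (ghom C D)
}.

Section Star.
Context {G : GrayDualsData} {C D : gobj G}.
Definition star1 (m : mor (ghom C D)) : mor (ghom C D) :=
  pstar1 (gd_planar C D) m.
Definition star2 (x : cell (ghom C D)) : cell (ghom C D) :=
  pstar2 (gd_planar C D) x.
Definition eps (m : mor (ghom C D)) : cell (ghom C D) :=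
  peps (gd_planar C D) m.
End Star.

(** [f^#] on 1-morphisms, [m^*] on 2-morphisms and [x^⋆] on 3-morphisms. *)
Notation "f ^#" := (dual f) (at level 2, left associativity, format "f ^#")
  : gray_scope.
Notation "m ^*" := (star1 m) (at level 2, left associativity, format "m ^*")
  : gray_scope.
Notation "x ^⋆" := (star2 x) (at level 2, left associativity, format "x ^⋆")
  : gray_scope.

Class gray_duals_laws (G : GrayDualsData) : Prop := {
  gd_planar_laws : forall C D : gobj G, planar_laws (gd_planar C D);
  star_whisker : forall (B C D E : gobj G) (k : ob (ghom D E))
      (m : mor (ghom C D)) (h : ob (ghom B C)),
    (k ◁ (m ▷ h))^* = k ◁ (m^* ▷ h);
  eps_whisker : forall (B C D E : gobj G) (k : ob (ghom D E))
      (m : mor (ghom C D)) (h : ob (ghom B C)),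
    k ◀ (eps m ▶ h) = eps (k ◁ (m ▷ h));
  eta_mor : forall (C D : gobj G) (f : ob (ghom C D)),
    is_mor (eta f) (gunit D) (f □ f^#);
  triang_cell : forall (C D : gobj G) (f : ob (ghom C D)),
    is_cell (triang f) (((eta f)^* ▷ f) ∘ (f ◁ eta f^#)) (idm f);
  triang_inv : forall (C D : gobj G) (f : ob (ghom C D)),
    invertible (triang f);
  dualK : forall (C D : gobj G) (f : ob (ghom C D)), f^#^# = f;
  dual_unit : forall C : gobj G, (gunit C)^# = gunit C;
  eta_unit : forall C : gobj G, eta (gunit C) = idm (gunit C);
  triang_unit : forall C : gobj G, triang (gunit C) = idc (idm (gunit C));
  dual_gprod : forall (C D E : gobj G)
      (f : ob (ghom D E)) (g : ob (ghom C D)), (f □ g)^# = g^# □ f^#;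
  eta_gprod : forall (C D E : gobj G)
      (f : ob (ghom D E)) (g : ob (ghom C D)),
    eta (f □ g) = (f ◁ (eta g ▷ f^#)) ∘ eta f;
  triang_gprod : forall (C D E : gobj G)
      (f : ob (ghom D E)) (g : ob (ghom C D)),
    triang (f □ g) =
    ((triang f ▶ g) ⊛ (f ◀ triang g))
      • (idc ((eta f)^* ▷ (f □ g)) ⊛ tens (f ◁ (eta g)^*) (eta f^# ▷ g)
           ⊛ idc ((f □ g) ◁ eta g^#));
  triang_snake : forall (C D : gobj G) (f : ob (ghom C D)),
    (idc (eta f)^* ⊛ (triang f ▶ f^#))
      • (tens (eta f)^* (eta f)^* ⊛ idc (f ◁ (eta f^# ▷ f^#)))
      • (idc (eta f)^* ⊛ (f ◀ (triang f^#)^⋆)) =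
    idc (eta f)^*
}.

Record GrayCatWithDuals : Type := MkGrayCatWithDuals {
  gray_duals_data :> GrayDualsData;
  gray_duals_ax : gray_duals_laws gray_duals_data
}.
#[export] Existing Instances gray_duals_ax gd_planar_laws pstar_functor.

Definition star_map (G : GrayDualsData) :
    tri_map (gray_tricat G) (op_tricat (gray_tricat G)) :=
  @TriMap (gray_tricat G) (op_tricat (gray_tricat G)) (fun C => C)
    (fun C D => @CatMap (ghom C D) (op_cat (ghom C D))
       (fun f => f) (fun m => m^*) (fun x => x^⋆)).

Definition sharp1 (G : GrayDualsData) (C D : gobj G) (n : mor (ghom C D)) :
    mor (ghom D C) :=
  let f := src n in let g := tgt n in
  (f^# ◁ (eta g)^*) ∘ (f^# ◁ (n ▷ g^#)) ∘ (eta f^# ▷ g^#).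
Definition sharp2 (G : GrayDualsData) (C D : gobj G) (x : cell (ghom C D)) :
    cell (ghom D C) :=
  let f := src (dom x) in let g := tgt (dom x) in
  idc (f^# ◁ (eta g)^*) ⊛ (f^# ◀ (x ▶ g^#)) ⊛ idc (eta f^# ▷ g^#).

Definition sharp_map (G : GrayDualsData) :
    tri_map (gray_tricat G) (co_tricat (gray_tricat G)) :=
  @TriMap (gray_tricat G) (co_tricat (gray_tricat G)) (fun C => C)
    (fun C D => @CatMap (ghom C D) (co_cat (ghom D C))
       (fun f => f^#) (@sharp1 G C D) (@sharp2 G C D)).

(* Main.v *)
From Stdlib Require Import ClassicalEpsilon.
Require Import Defs.

(** For [*], everything reduces to [(tens m n)^⋆ = tens m^* n^*]: in a planar
    2-category [x^⋆] is the only mate of [x] with respect to the units [eps],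
    and [tens m^* n^*] is a mate of [tens m n] because the tensorator is
    natural with respect to [eps].

    For [#], write [e f = (eta f)^*].  A square over [m : f => g] and
    [n : g^# => f^#] is a 3-morphism from [e f ∘ (f ◁ n)] to
    [e g ∘ (m ▷ g^#)].  The triangulator makes [n |-> e f ∘ (f ◁ n)] an
    equivalence onto the 2-morphisms into the unit, so there is a universal
    invertible square over [m] and [#m], through which every other square over
    [m] factors uniquely.  Squares can be composed and multiplied, strictly
    associatively, and the coherence data of [#] are the factorisations of the
    composites and of the products of universal squares.  Every coherence law
    of [#] then says that two factorisations of the same square agree. *)

Set Implicit Arguments.
Unset Strict Implicit.
Unset Printing Implicit Defensive.

(** The axioms relate [*] to whiskered 2-morphisms and to [eps], but say nothing about the dual of a
    tensorator or of a whiskered 3-morphism. Uniqueness of mates supplies both, and it rests on the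
    second triangle identity.

    For [#] the obstacle is size: written out, the coherence cells are pastings of folds,
    triangulators and tensorators, and their laws are equalities of far larger pastings. Apart from
    the case of the unit 1-morphism, universality confines the triangulator to the study of
    transposition along a fold. Composition, whiskering and product of squares involve tensorators
    only, and they fit together strictly because the fold of [f □ g] equals a composite of whiskered
    folds on the nose. Only the compatibility of [kappa] with the coherence of the Gray product
    makes two squares change places; naturality of the tensorator with respect to a whole square is
    what allows it. *)

Section TwoCatUnits.
Context (C : TwoCat).
Implicit Types (a : mor C) (x y : cell C).
Lemma comp_idl A a : tgt a = A -> idm A ∘ a = a.
Proof. intros <-; apply comp1m. Qed.
Lemma comp_idr A a : src a = A -> a ∘ idm A = a.
Proof. intros <-; apply compm1. Qed.
Lemma vcomp_idl a x : cod x = a -> idc a • x = x.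
Proof. intros <-; apply vcomp1c. Qed.
Lemma vcomp_idr a x : dom x = a -> x • idc a = x.
Proof. intros <-; apply vcompc1. Qed.
Lemma hcomp_idl A x : tgt (dom x) = A -> idc (idm A) ⊛ x = x.
Proof. intros <-; apply hcomp1c. Qed.
Lemma hcomp_idr A x : src (dom x) = A -> x ⊛ idc (idm A) = x.
Proof. intros <-; apply hcompc1. Qed.
Lemma vcomp_idc a : idc a • idc a = idc a.
Proof. apply vcomp_idl, cod_idc. Qed.
Lemma hcomp_split x y : src (dom x) = tgt (dom y) ->
  x ⊛ y = (idc (cod x) ⊛ y) • (x ⊛ idc (dom y)).
Proof.
intros H; rewrite <- interchange, vcomp1c, vcompc1
  by (rewrite ?dom_idc, ?cod_idc; auto); reflexivity.
Qed.
Lemma hcomp_split_l x y : src (dom x) = tgt (dom y) ->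
  x ⊛ y = (x ⊛ idc (cod y)) • (idc (dom x) ⊛ y).
Proof.
intros H; rewrite <- interchange, vcomp1c, vcompc1
  by (rewrite ?dom_idc, ?cod_idc; auto); reflexivity.
Qed.
Lemma vcomp_cancel2 (t x y r : cell C) :
  dom t = cod x -> dom x = cod y -> x • y = r -> t • x • y = t • r.
Proof. intros H1 H2 E; rewrite <- !vcompA by assumption; congruence. Qed.
Lemma vcomp_cancel3 (t x y z r : cell C) :
  dom t = cod x -> dom x = cod y -> dom y = cod z ->
  x • y • z = r -> t • x • y • z = t • r.
Proof.
intros H1 H2 H3 E.
rewrite <- E, (vcompA (x := t) (y := x • y)), (vcompA (x := t) (y := x));
  rewrite ?cod_vcomp, ?dom_vcomp by auto; congruence.
Qed.
End TwoCatUnits.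

(** [bd] rewrites sources, targets, domains and codomains, and composites of
    1-morphisms, to a normal form in which composites are associated to the
    left and whiskerings are distributed over them; the hooks are extended
    once further boundaries are known. *)
Ltac bd_hook_star := fail.
Ltac bd_hook_dual := fail.
Ltac bd_hook_sharp := fail.
Ltac bd :=
  repeat first
    [ lazymatch goal with |- context [@ghom] => bd_gray end
    | match goal with
      | H : src ?a = _ |- context [src ?a] => is_var a; rewrite H
      | H : tgt ?a = _ |- context [tgt ?a] => is_var a; rewrite H
      | H : dom ?a = _ |- context [dom ?a] => is_var a; rewrite H
      | H : cod ?a = _ |- context [cod ?a] => is_var a; rewrite H
      end
    | match goal with
      | |- context [src (cod _)] => rewrite src_cod
      | |- context [tgt (cod _)] => rewrite tgt_cod
      | |- context [src (idm _)] => rewrite src_idm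
      | |- context [tgt (idm _)] => rewrite tgt_idm
      | |- context [dom (idc _)] => rewrite dom_idc
      | |- context [cod (idc _)] => rewrite cod_idc
      | |- context [src (comp _ _)] => rewrite src_comp by bd
      | |- context [tgt (comp _ _)] => rewrite tgt_comp by bd
      | |- context [dom (hcomp _ _)] => rewrite dom_hcomp by bd
      | |- context [cod (hcomp _ _)] => rewrite cod_hcomp by bd
      | |- context [dom (vcomp _ _)] => rewrite dom_vcomp by bd
      | |- context [cod (vcomp _ _)] => rewrite cod_vcomp by bd
      | |- context [comp (idm _) _] => rewrite comp_idl by bd
      | |- context [comp _ (idm _)] => rewrite comp_idr by bd
      | |- context [comp _ (comp _ _)] => rewrite compA by bd
      end ];
  try solve [ assumption | reflexivity | congruence ]
with bd_gray :=
  first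
    [ match goal with
      | |- context [src (lwm _ _)] => rewrite src_lw
      | |- context [tgt (lwm _ _)] => rewrite tgt_lw
      | |- context [src (rwm _ _)] => rewrite src_rw
      | |- context [tgt (rwm _ _)] => rewrite tgt_rw
      | |- context [dom (lwc _ _)] => rewrite dom_lw
      | |- context [cod (lwc _ _)] => rewrite cod_lw
      | |- context [dom (rwc _ _)] => rewrite dom_rw
      | |- context [cod (rwc _ _)] => rewrite cod_rw
      | |- context [dom (tens _ _)] => rewrite dom_tens
      | |- context [cod (tens _ _)] => rewrite cod_tens
      | |- context [dom (tens_inv _ _)] => rewrite dom_tens_inv
      | |- context [cod (tens_inv _ _)] => rewrite cod_tens_inv
      | |- context [lwm _ (lwm _ _)] => rewrite lwmA
      | |- context [lwm _ (rwm _ _)] => rewrite lrwmA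
      | |- context [rwm _ (gprod _ _)] => rewrite rwmA
      | |- context [gprod _ (gprod _ _)] => rewrite gprodA
      | |- context [gprod (gunit _) _] => rewrite gprod1u
      | |- context [gprod _ (gunit _)] => rewrite gprodu1
      | |- context [lwm (gunit _) _] => rewrite lwm1u
      | |- context [rwm _ (gunit _)] => rewrite rwmu1
      | |- context [lwm _ (comp _ _)] => rewrite lw_comp by bd
      | |- context [rwm (comp _ _) _] => rewrite rw_comp by bd
      | |- context [lwm _ (idm _)] => rewrite lw_idm
      | |- context [rwm (idm _) _] => rewrite rw_idm
      end
    | bd_hook_star | bd_hook_dual | bd_hook_sharp ].

(** [wh_norm] turns a pasting into a vertical composite of whiskered cells. *)
Ltac wh_norm :=
  repeat first
    [ rewrite whisker_vcompl by bd | rewrite whisker_vcompr by bd ];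
  repeat (rewrite hcompA by bd);
  repeat first [ rewrite hcomp_idc by bd
    | rewrite vcomp_idl by bd | rewrite vcomp_idr by bd ];
  repeat (rewrite <- hcomp_idc by bd);
  repeat (rewrite hcompA by bd);
  repeat first [ rewrite hcomp_idl by bd | rewrite hcomp_idr by bd ];
  repeat (rewrite vcompA by bd).

(** The goal is hidden behind a local definition to keep it unchanged. *)
Ltac normalize_with tac K :=
  match goal with |- ?g =>
    let h := fresh in pose (h := g); change h; revert K; tac;
    intros K; subst h
  end.
Ltac normalize K := normalize_with ltac:(bd; wh_norm) K.
(** [use K] rewrites with [K] inside a left-associated vertical composite. *)
Ltac use_fwd K :=
  first [ rewrite K
        | rewrite (fun t a b => vcomp_cancel2 (t := t) a b K) by bd
        | rewrite (fun t a b c => vcomp_cancel3 (t := t) a b c K) by bd ];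
  repeat (rewrite vcompA by bd).
Ltac use K :=
  first
    [ use_fwd K
    | let K' := fresh in pose proof (eq_sym K) as K'; use_fwd K'; clear K' ].
(** [slide x y] exchanges the heights of [x] and [y] in a pasting. *)
Ltac slide x y :=
  let K := fresh in
  assert (K : src (dom x) = tgt (dom y)) by bd;
  apply interchange_swap in K; normalize K;
  use K; clear K.

(** * Tensorators at identities and normal forms of 3-morphisms *)

Section TensUnits.
Context (G : GrayCat) (C D E : gobj G).
Implicit Types (m : mor (ghom D E)) (n : mor (ghom C D)).
Lemma tens_idr m (f : ob (ghom C D)) : tens m (idm f) = idc (m ▷ f).
Proof.
assert (K : is_id_cell (tens m (idm f)))
  by (apply tens_id; right; unfold is_id_mor; bd).
rewrite K; bd.
Qed.
Lemma tens_idl (g : ob (ghom D E)) n : tens (idm g) n = idc (g ◁ n).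
Proof.
assert (K : is_id_cell (tens (idm g) n))
  by (apply tens_id; left; unfold is_id_mor; bd).
rewrite K; bd.
Qed.
Lemma tens_inv_idr m (f : ob (ghom C D)) : tens_inv m (idm f) = idc (m ▷ f).
Proof.
apply inverse_cells_unique with (tens m (idm f)); [apply tens_invP|].
rewrite tens_idr; apply inverse_cells_idc.
Qed.
Lemma tens_inv_idl (g : ob (ghom D E)) n : tens_inv (idm g) n = idc (g ◁ n).
Proof.
apply inverse_cells_unique with (tens (idm g) n); [apply tens_invP|].
rewrite tens_idl; apply inverse_cells_idc.
Qed.
End TensUnits.

Ltac gray_cells :=
  repeat match goal with
  | |- context [lwc _ (idc _)] => rewrite lw_idc
  | |- context [rwc (idc _) _] => rewrite rw_idc
  | |- context [lwc (gunit _) _] => rewrite lwc1u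
  | |- context [rwc _ (gunit _)] => rewrite rwcu1
  | |- context [lwc _ (lwc _ _)] => rewrite lwcA
  | |- context [lwc _ (rwc _ _)] => rewrite lrwcA
  | |- context [rwc _ (gprod _ _)] => rewrite rwcA
  | |- context [lwc _ (hcomp _ _)] => rewrite lw_hcomp by bd
  | |- context [rwc (hcomp _ _) _] => rewrite rw_hcomp by bd
  | |- context [lwc _ (vcomp _ _)] => rewrite lw_vcomp by bd
  | |- context [rwc (vcomp _ _) _] => rewrite rw_vcomp by bd
  | |- context [tens (idm _) _] => rewrite tens_idl
  | |- context [tens (lwm _ _) _] => rewrite tens_lw
  | |- context [tens (rwm _ _) _] => rewrite tens_mid
  | |- context [tens (comp _ _) _] => rewrite tens_compl by bd
  | |- context [tens _ (idm _)] => rewrite tens_idr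
  | |- context [tens _ (rwm _ _)] => rewrite tens_rw
  | |- context [tens _ (comp _ _)] => rewrite tens_compr by bd
  | |- context [tens_inv (lwm _ _) _] => rewrite tens_inv_lw
  | |- context [tens_inv (rwm _ _) _] => rewrite tens_inv_mid
  | |- context [tens_inv _ (rwm _ _)] => rewrite tens_inv_rw
  end.
Ltac gnorm := bd; gray_cells; bd; gray_cells; bd; wh_norm.
Ltac gnormalize K := normalize_with ltac:(gnorm) K.

(** * The functor [*] *)

Section PlanarLaws.
Context (G : GrayCatWithDuals) (C D : gobj G).
Implicit Types (m n : mor (ghom C D)) (x y : cell (ghom C D)).
Let S := @CatMap (ghom C D) (op_data (ghom C D)) (fun A => A)
  (@star1 G C D) (@star2 G C D).
#[local] Instance star_functor : strict_functor_laws S.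
Proof. exact (pstar_functor (planar_laws := gd_planar_laws C D)). Qed.

Lemma src_star m : src m^* = tgt m.
Proof. exact (sf_tgt (F := S) m). Qed.
Lemma tgt_star m : tgt m^* = src m.
Proof. exact (sf_src (F := S) m). Qed.
Lemma dom_star x : dom x^⋆ = (cod x)^*.
Proof. exact (sf_cod (F := S) x). Qed.
Lemma cod_star x : cod x^⋆ = (dom x)^*.
Proof. exact (sf_dom (F := S) x). Qed.
Lemma star_idm (f : ob (ghom C D)) : (idm f)^* = idm f.
Proof. exact (sf_idm (F := S) f). Qed.
Lemma star_idc m : (idc m)^⋆ = idc m^*.
Proof. exact (sf_idc (F := S) m). Qed.
Lemma star_comp m n : src m = tgt n -> (m ∘ n)^* = n^* ∘ m^*.
Proof. exact (sf_comp (F := S) (a := m) (b := n)). Qed.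
Lemma star_hcomp x y : src (dom x) = tgt (dom y) ->
  (x ⊛ y)^⋆ = y^⋆ ⊛ x^⋆.
Proof. exact (sf_hcomp (F := S) (x := x) (y := y)). Qed.
Lemma star_vcomp x y : dom x = cod y -> (x • y)^⋆ = y^⋆ • x^⋆.
Proof. exact (sf_vcomp (F := S) (x := x) (y := y)). Qed.
Lemma star1K m : m^*^* = m.
Proof. exact (pstar1K (planar_laws := gd_planar_laws C D) m). Qed.
Lemma star2K x : x^⋆^⋆ = x.
Proof. exact (pstar2K (planar_laws := gd_planar_laws C D) x). Qed.
Lemma dom_eps m : dom (eps m) = idm (tgt m).
Proof. apply (peps_cell (planar_laws := gd_planar_laws C D) m). Qed.
Lemma cod_eps m : cod (eps m) = m ∘ m^*.
Proof. apply (peps_cell (planar_laws := gd_planar_laws C D) m). Qed.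
Lemma eps_nat x :
  (x ⊛ idc (dom x)^*) • eps (dom x) = (idc (cod x) ⊛ x^⋆) • eps (cod x).
Proof. exact (peps_nat (planar_laws := gd_planar_laws C D) x). Qed.
Lemma eps_snake m : (idc m ⊛ (eps m^*)^⋆) • (eps m ⊛ idc m) = idc m.
Proof. exact (peps_snake (planar_laws := gd_planar_laws C D) m). Qed.
Lemma eps_comp m n : src m = tgt n ->
  (idc m ⊛ eps n ⊛ idc m^*) • eps m = eps (m ∘ n).
Proof.
exact (peps_comp (planar_laws := gd_planar_laws C D) (a := m) (c := n)).
Qed.

Lemma star_inverse x y : inverse_cells x y -> inverse_cells x^⋆ y^⋆.
Proof.
intros [[H1 H2] [H3 H4]]; repeat split.
- rewrite dom_star, cod_star; congruence.
- rewrite dom_star, cod_star; congruence.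
- rewrite <- star_vcomp, H4, star_idc, cod_star by congruence; reflexivity.
- rewrite <- star_vcomp, H3, star_idc, dom_star by congruence; reflexivity.
Qed.
End PlanarLaws.

Section WhiskerStar.
Context (G : GrayCatWithDuals) (B C D : gobj G).
Lemma star_lw (k : ob (ghom C D)) (m : mor (ghom B C)) :
  (k ◁ m)^* = k ◁ m^*.
Proof.
pose proof (star_whisker k m (gunit B)) as K.
now rewrite !rwmu1 in K.
Qed.
Lemma star_rw (m : mor (ghom C D)) (h : ob (ghom B C)) :
  (m ▷ h)^* = m^* ▷ h.
Proof.
pose proof (star_whisker (gunit D) m h) as K.
now rewrite !lwm1u in K.
Qed.
Lemma eps_lw (k : ob (ghom C D)) (m : mor (ghom B C)) :
  k ◀ eps m = eps (k ◁ m).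
Proof.
pose proof (eps_whisker k m (gunit B)) as K.
now rewrite rwmu1, rwcu1 in K.
Qed.
Lemma eps_rw (m : mor (ghom C D)) (h : ob (ghom B C)) :
  eps m ▶ h = eps (m ▷ h).
Proof.
pose proof (eps_whisker (gunit D) m h) as K.
now rewrite lwm1u, lwc1u in K.
Qed.
End WhiskerStar.

Ltac bd_hook_star ::=
  match goal with
  | |- context [src (star1 _)] => rewrite src_star
  | |- context [tgt (star1 _)] => rewrite tgt_star
  | |- context [dom (star2 _)] => rewrite dom_star
  | |- context [cod (star2 _)] => rewrite cod_star
  | |- context [dom (eps _)] => rewrite dom_eps
  | |- context [cod (eps _)] => rewrite cod_eps
  | |- context [star1 (star1 _)] => rewrite star1K
  | |- context [star1 (idm _)] => rewrite star_idm
  | |- context [star1 (lwm _ _)] => rewrite star_lw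
  | |- context [star1 (rwm _ _)] => rewrite star_rw
  | |- context [star1 (comp _ _)] => rewrite star_comp by bd
  end.

(** * The second triangle identity and uniqueness of mates *)

Section UniqueMate.
Context (C : TwoCat).
(** Only one triangle identity is an axiom of planar 2-categories.  The other
    composite [p] satisfies [(p ⊛ b) • v' = v'] by naturality of the units, and
    the first triangle for [c] then gives [p = 1]. *)
Lemma second_snake (b c : mor C) (A B : ob C) (u v u' v' p p' : cell C) :
  src b = A -> tgt b = B -> src c = B -> tgt c = A ->
  dom u = idm B -> cod u = b ∘ c ->
  dom v = c ∘ b -> cod v = idm A ->
  dom u' = b ∘ c -> cod u' = idm B ->
  dom v' = idm A -> cod v' = c ∘ b ->
  p = (v ⊛ idc c) • (idc c ⊛ u) ->
  p' = (u' ⊛ idc b) • (idc b ⊛ v') ->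
  (idc c ⊛ u') • (v' ⊛ idc c) = idc c ->
  (p ⊛ idc b) • v' = (idc c ⊛ p') • v' ->
  p = idc c.
Proof.
intros sb tb sc tc du cu dv cv du' cu' dv' cv' Hp Hp' Hs Hn.
assert (dp : dom p = c) by (rewrite Hp; bd).
assert (cp : cod p = c) by (rewrite Hp; bd).
assert (E : (p ⊛ idc b) • v' = v').
{ rewrite Hn, Hp'. wh_norm.
  (* By interchange the two copies of [v'] can be inserted in either order; the other order exposes
     the first triangle [Hs], whiskered by [b]. *)
  symmetry; slide v' v'.
  apply (f_equal (fun z => z ⊛ idc b)) in Hs; normalize Hs; use Hs.
  wh_norm; reflexivity. }
(* After whiskering by [c] and closing with [u'], the left side becomes [p] composed with the first
   triangle once [p] has slid past [u']; the right side is that triangle alone. *)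
apply (f_equal (fun z => (idc c ⊛ u') • (z ⊛ idc c))) in E; normalize E.
revert E; slide p u'; repeat use_fwd Hs; rewrite vcomp_idr by bd; auto.
Qed.
End UniqueMate.

Section StarUnique.
Context (G : GrayCatWithDuals).

Lemma eps_snake2 (C D : gobj G) (b : mor (ghom C D)) :
  ((eps b^*)^⋆ ⊛ idc b^*) • (idc b^* ⊛ eps b) = idc b^*.
Proof.
(* Naturality of the unit is applied to the triangle composite itself; its dual is the composite
   [p'], which yields the last hypothesis of [second_snake]. *)
pose proof (eps_nat (((eps b^*)^⋆ ⊛ idc b^*) • (idc b^* ⊛ eps b))) as Hn.
rewrite star_vcomp, !star_hcomp, star_idc, star2K in Hn by bd.
revert Hn; bd; intros Hn.
assert (d' : dom (eps b^*)^⋆ = b^* ∘ b) by bd.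
assert (c' : cod (eps b^*)^⋆ = idm (src b)) by bd.
assert (d'' : dom (eps b)^⋆ = b ∘ b^*) by bd.
assert (c'' : cod (eps b)^⋆ = idm (tgt b)) by bd.
pose proof (eps_snake b^*) as Hs; rewrite star1K in Hs.
apply second_snake with (b := b) (A := src b) (B := tgt b) (u := eps b)
  (v := (eps b^*)^⋆) (u' := (eps b)^⋆) (v' := eps b^*)
  (p' := ((eps b)^⋆ ⊛ idc b) • (idc b ⊛ eps b^*)); auto; bd.
Qed.

Lemma star_unique (C D : gobj G) (x y : cell (ghom C D)) (a b : mor (ghom C D)) :
  src a = src b -> tgt a = tgt b -> is_cell x a b -> is_cell y b^* a^* ->
  (x ⊛ idc a^*) • eps a = (idc b ⊛ y) • eps b -> x^⋆ = y.
Proof.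
intros Hs Ht [Hdx Hcx] [Hdy Hcy] H.
assert (U : forall z, is_cell z b^* a^* ->
  ((eps b^*)^⋆ ⊛ idc a^*) • (idc b^* ⊛ ((idc b ⊛ z) • eps b)) = z).
{ intros z [Hdz Hcz]; wh_norm.
  slide (eps b^*)^⋆ z.
  pose proof (eps_snake2 b) as K; use K; apply vcomp_idr; bd. }
assert (E : (idc b ⊛ x^⋆) • eps b = (idc b ⊛ y) • eps b).
{ rewrite <- H; pose proof (eps_nat x) as K; rewrite Hdx, Hcx in K.
  now symmetry. }
rewrite <- (U y), <- E; [symmetry; apply U|]; split; bd.
Qed.
End StarUnique.

(** * Duals of tensorators and of whiskered 3-morphisms *)

Section TensMate.
Context (C : TwoCat).
(** [s], [s'] and [t] stand for [tens m n], [tens m^* n^*] and [tens m n^*].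
    After composition with the invertible [N2 ⊛ t ⊛ M2'], naturality with
    respect to the units reduces both sides to [eN2 ⊛ eM2]. *)
Lemma tens_mates (M1 M2 N1 N2 M1' M2' N1' N2' : mor C)
    (s s' t t' eM1 eM2 eN1 eN2 : cell C) (A B A' B' : ob C) :
  src M1 = A -> tgt M1 = B -> src M2 = A' -> tgt M2 = B' ->
  src N1 = A -> tgt N1 = A' -> src N2 = B -> tgt N2 = B' ->
  src M1' = B -> tgt M1' = A -> src M2' = B' -> tgt M2' = A' ->
  src N1' = A' -> tgt N1' = A -> src N2' = B' -> tgt N2' = B ->
  dom s = M2 ∘ N1 -> cod s = N2 ∘ M1 ->
  dom s' = M1' ∘ N2' -> cod s' = N1' ∘ M2' ->
  dom t = M1 ∘ N1' -> cod t = N2' ∘ M2 ->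
  dom eM1 = idm B -> cod eM1 = M1 ∘ M1' ->
  dom eM2 = idm B' -> cod eM2 = M2 ∘ M2' ->
  dom eN1 = idm A' -> cod eN1 = N1 ∘ N1' ->
  dom eN2 = idm B' -> cod eN2 = N2 ∘ N2' ->
  inverse_cells t t' ->
  ((idc N2 ⊛ t) • (s ⊛ idc N1')) • (idc M2 ⊛ eN1) = eN2 ⊛ idc M2 ->
  ((t ⊛ idc M2') • (idc M1 ⊛ s')) • (eM1 ⊛ idc N2') = idc N2' ⊛ eM2 ->
  (s ⊛ idc (N1' ∘ M2')) • ((idc M2 ⊛ eN1 ⊛ idc M2') • eM2) =
  (idc (N2 ∘ M1) ⊛ s') • ((idc N2 ⊛ eM1 ⊛ idc N2') • eN2).
Proof.
intros; match goal with H : inverse_cells t t' |- _ =>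
  destruct H as [[dt' ct'] [_ Hi]] end.
match goal with H : _ = eN2 ⊛ _, H' : _ = _ ⊛ eM2 |- _ =>
  rename H into E1, H' into E2 end.
assert (dt : dom t' = N2' ∘ M2) by congruence.
assert (ct : cod t' = M1 ∘ N1') by congruence.
assert (U : forall z, dom z = idm B' -> cod z = N2 ∘ M1 ∘ N1' ∘ M2' ->
  (idc N2 ⊛ t' ⊛ idc M2') • ((idc N2 ⊛ t ⊛ idc M2') • z) = z).
{ intros z dz cz.
  apply (f_equal (fun z => idc N2 ⊛ z ⊛ idc M2')) in Hi; normalize Hi.
  wh_norm. rewrite Hi. wh_norm. reflexivity. }
match goal with |- ?l = ?r => rewrite <- (U l), <- (U r) by bd end.
f_equal.
apply (f_equal (fun z => z ⊛ idc M2')) in E1; normalize E1.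
apply (f_equal (fun z => idc N2 ⊛ z)) in E2; normalize E2.
wh_norm. rewrite E1, E2. slide eN2 eM2.
reflexivity.
Qed.
End TensMate.

Section StarTensorator.
Context (G : GrayCatWithDuals) (C D E : gobj G).
Lemma star_tens (m : mor (ghom D E)) (n : mor (ghom C D)) :
  (tens m n)^⋆ = tens m^* n^*.
Proof.
apply star_unique with (a := (m ▷ tgt n) ∘ (src m ◁ n))
  (b := (tgt m ◁ n) ∘ (m ▷ src n)); try split; bd.
rewrite <- !eps_comp by bd. bd.
apply tens_mates with (N1 := src m ◁ n) (M1' := m^* ▷ src n)
  (t := tens m n^*) (t' := tens_inv m n^*)
  (A := src m □ src n) (B := tgt m □ src n) (A' := src m □ tgt n)
  (B' := tgt m □ tgt n); try apply tens_invP; bd.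
(* The two hypotheses on [t] are naturality of the tensorator at [eps n] and at [eps m], expanded
   along [n ∘ n^*] and [m ∘ m^*]; the tensorators with an identity argument drop out. *)
- pose proof (tens_nat (idc m) (eps n)) as K.
  revert K; bd; rewrite tens_compr, rw_idc, !eps_lw, tens_idr by bd; bd.
  intros K; rewrite K; apply vcomp_idr; bd.
- pose proof (tens_nat (eps m) (idc n^*)) as K.
  revert K; bd; rewrite tens_compl, lw_idc, !eps_rw, tens_idl by bd; bd.
  intros K; rewrite K; apply vcomp_idr; bd.
Qed.

Lemma star_tens_inv (m : mor (ghom D E)) (n : mor (ghom C D)) :
  (tens_inv m n)^⋆ = tens_inv m^* n^*.
Proof.
apply inverse_cells_unique with (tens m^* n^*); [|apply tens_invP].
rewrite <- star_tens; apply star_inverse, tens_invP.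
Qed.
End StarTensorator.

Section WhiskerStarCells.
Context (G : GrayCatWithDuals) (B C D : gobj G).
(** Whiskering preserves [eps], hence carries the mate equation of [x] to that of [k ◀ x];
    uniqueness of mates concludes. *)
Lemma star_lwc (k : ob (ghom C D)) (x : cell (ghom B C)) :
  (k ◀ x)^⋆ = k ◀ x^⋆.
Proof.
apply star_unique with (k ◁ dom x) (k ◁ cod x); try split; bd.
rewrite <- !eps_lw, <- !lw_idc, <- !lw_hcomp, <- !lw_vcomp by bd.
now rewrite eps_nat.
Qed.
Lemma star_rwc (x : cell (ghom C D)) (h : ob (ghom B C)) :
  (x ▶ h)^⋆ = x^⋆ ▶ h.
Proof.
apply star_unique with (dom x ▷ h) (cod x ▷ h); try split; bd.
rewrite <- !eps_rw, <- !rw_idc, <- !rw_hcomp, <- !rw_vcomp by bd.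
now rewrite eps_nat.
Qed.
End WhiskerStarCells.

(** * Coherence and strictness of the functor [*] *)

Section StarTphi.
Context (G : GrayCatWithDuals).
(** The law [kappa_tphi] for [*], read in [G], where vertical composites are reversed. Expanding the
    last [tens_inv] gives four factors, one for each pair of a first and a second component. *)
Lemma star_tphi (C D E : gobj G) (m1 n1 : mor (ghom D E)) (m2 n2 : mor (ghom C D)) :
  src m1 = tgt n1 -> src m2 = tgt n2 ->
  (tens_inv n1^* n2^* ⊛ tens_inv m1^* m2^*)
     • (idc (gprod1 m1 m2 ∘ gprod1 n1 n2)^*
       • (idc (m1 ▷ tgt m2) ⊛ tens_inv n1 m2 ⊛ idc (src n1 ◁ n2))^⋆) =
    (idc (n1^* ▷ tgt n2^*) ⊛ tens m1^* n2^* ⊛ idc (src m1^* ◁ m2^*))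
    • (gprod2 (idc (m1 ∘ n1)^*) (idc (m2 ∘ n2)^*) •
     tens_inv (m1 ∘ n1)^* (m2 ∘ n2)^*).
Proof.
intros H1 H2; unfold gprod1, gprod2.
rewrite !star_hcomp, !star_idc, star_tens_inv, lw_idc, rw_idc by bd; bd.
rewrite !tens_inv_compl, !tens_inv_compr by bd; bd; wh_norm.
(* The tensorator contributed by the coherence of the opposite cancels one of the four factors; the
   other three are those of the left side. *)
pose proof (tens_invP m1^* n2^*) as [_ [K _]].
apply (f_equal (fun x => idc (n1^* ▷ src n2) ⊛ x ⊛ idc (tgt m1 ◁ m2^*))) in K.
normalize K; rewrite K; clear K.
wh_norm.
rewrite (hcomp_split (x := tens_inv n1^* n2^*) (y := tens_inv m1^* m2^*)) by bd.
bd; wh_norm; reflexivity.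
Qed.

Lemma star_kappa_id (C D E : gobj G) (g : ob (ghom D E)) (f : ob (ghom C D)) :
  gprod2 (idc (idm g)) (idc (idm f)) • tens_inv (idm g)^* (idm f)^*
   = idc (idm (g □ f)).
Proof.
unfold gprod2; rewrite lw_idc, rw_idc; bd; rewrite tens_inv_idl; bd.
rewrite hcomp_idc by bd; bd; apply vcomp_idc.
Qed.
(** After expansion this is naturality of the inverse tensorator with [l^*] at the 3-morphism
    [tens_inv m^* n^*], a relation of Yang-Baxter type. *)
Lemma star_kappa_assoc (B C D E : gobj G) (l : mor (ghom D E)) (m : mor (ghom C D))
    (n : mor (ghom B C)) :
  gprod2 (idc l^*) (tens_inv m^* n^*) • tens_inv l^* (gprod1 m n)^* =
    gprod2 (tens_inv l^* m^*) (idc n^*) • tens_inv (gprod1 l m)^* n^*.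
Proof.
unfold gprod1, gprod2; bd; rewrite tens_inv_compl, tens_inv_compr by bd.
pose proof (tens_inv_nat (idc l^*) (tens_inv m^* n^*)) as K; revert K; bd.
rewrite !tens_inv_compr by bd.
gray_cells; bd; gray_cells; bd; rewrite !vcompA by bd.
intros ->; reflexivity.
Qed.
End StarTphi.

Lemma op_inverse (C : TwoCat) (x y : cell C) :
  inverse_cells x y -> @inverse_cells (op_data C) x y.
Proof. now intros [[H1 H2] [H3 H4]]; repeat split. Qed.

Section StarFunctor.
Context (G : GrayCatWithDuals).
(** The direction of [kappa] is that of the opposite 2-category: in [G], [tens_inv m^* n^*] runs
    from [(gprod1 m n)^*] to [gprod1 m^* n^*]. *)
Definition star_coh : tri_coh (star_map G) :=
  @TriCoh (gray_tricat G) (op_tricat (gray_tricat G)) (star_map G)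
    (fun C D => @WeakCoh (ghom C D) (op_cat (ghom C D))
      (fun m n => idc (m ∘ n)^*) (fun m n => idc (m ∘ n)^*)
      (fun f => idc (idm f)) (fun f => idc (idm f)))
    (fun C D E m n => tens_inv m^* n^*).

Lemma star_laws : tri_functor_laws star_coh.
Proof.
constructor.
- intros C D; constructor; cbn.
  + intros; bd.
  + intros; bd.
  + intros; bd.
  + intros; bd.
  + intros; apply star_idc.
  + intros; apply star_vcomp; auto.
  + intros a b H; split; cbn; bd.
  + intros a b H; apply op_inverse, inverse_cells_idc.
  + intros f; split; cbn; bd.
  + intros f; apply op_inverse, inverse_cells_idc.
  + intros x y H. rewrite star_hcomp by auto. bd.
    rewrite vcomp_idl, vcomp_idr by bd. reflexivity.
  + intros a b d H1 H2. bd. rewrite !hcomp_idc by bd. bd.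
  + intros a. bd. rewrite !hcomp_idc by bd. bd. apply vcomp_idc.
  + intros a. bd. rewrite !hcomp_idc by bd. bd. apply vcomp_idc.
- reflexivity.
- reflexivity.
- intros C D E m n; split; cbn; unfold gprod1; bd.
- intros C D E m n; exists (tens m^* n^*).
  apply op_inverse, inverse_cells_sym, tens_invP.
- intros C D E x y; cbn.
  pose proof (tens_inv_nat x^⋆ y^⋆) as K; revert K.
  unfold gprod2. rewrite star_hcomp, star_lwc, star_rwc by bd. bd.
- intros C D E m1 n1 m2 n2 H1 H2.
  exact (star_tphi H1 H2).
- intros C D E g f.
  change (gprod2 (idc (idm g)) (idc (idm f)) • tens_inv (idm g)^* (idm f)^*
   = idc (idm (g □ f))).
  exact (star_kappa_id g f).
- intros B C D E l m n; exact (star_kappa_assoc l m n).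
- intros C D m.
  change (tens_inv m^* (idm (gunit C))^* = idc m^*).
  rewrite star_idm, tens_inv_idr. now rewrite rwmu1.
- intros C D m.
  change (tens_inv (idm (gunit D))^* m^* = idc m^*).
  rewrite star_idm, tens_inv_idl. now rewrite lwm1u.
Qed.

(** In the opposite 2-category [src] is [tgt], so [is_id_mor] takes there the form of this
    hypothesis. *)
Lemma is_id_mor_tgt (C D : gobj G) (m : mor (ghom C D)) :
  m = idm (tgt m) -> is_id_mor m.
Proof.
intros E; unfold is_id_mor; pose proof (f_equal (@src _) E) as K.
rewrite src_idm in K; congruence.
Qed.

(** The left side is [tphi (idm (tgt m)) n m (idm (src n))]: every inverse tensorator is itself a
    coherence cell of the Gray product. *)
Lemma tens_inv_unit_whisker (C D E : gobj G) (m : mor (ghom D E))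
    (n : mor (ghom C D)) :
  idc (idm (tgt m) ▷ tgt n) ⊛ tens_inv m n ⊛ idc (src m ◁ idm (src n)) =
  tens_inv m n.
Proof. bd. rewrite hcomp_idl, hcomp_idr by bd. reflexivity. Qed.

Lemma tens_unit_whisker (C D E : gobj G) (m : mor (ghom D E))
    (n : mor (ghom C D)) :
  idc (idm (tgt m) ▷ tgt n) ⊛ tens m n ⊛ idc (src m ◁ idm (src n)) =
  tens m n.
Proof. bd. rewrite hcomp_idl, hcomp_idr by bd. reflexivity. Qed.

(** In the degenerate case where a Gray category is cubical as well, or its
    opposite opcubical, [tri_functor_strict] prescribes [kappa] in several
    ways; they agree because all tensorators are then identities. *)
Lemma cubical_tens_inv (H : cubical (gray_tricat G)) (C D E : gobj G)
    (m : mor (ghom D E)) (n : mor (ghom C D)) :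
  tens_inv m n = idc (gprod1 m n).
Proof.
pose proof (H C D E (idm (tgt m)) m n (idm (src n))) as K.
assert (L : is_id_cell (tens_inv m n)).
{ rewrite <- tens_inv_unit_whisker; apply K.
  - exact (src_idm (tgt m)).
  - symmetry; exact (tgt_idm (src n)).
  - left; unfold is_id_mor; symmetry; f_equal; exact (src_idm (tgt m)). }
pose proof (cod_tens_inv m n) as Q; revert L Q; unfold is_id_cell.
intros L; rewrite L; unfold gprod1; rewrite cod_idc; congruence.
Qed.

Lemma opcubical_op_tens_inv (H : opcubical (op_tricat (gray_tricat G)))
    (C D E : gobj G) (m : mor (ghom D E)) (n : mor (ghom C D)) :
  tens_inv m n = idc (gprod1 m n).
Proof.
pose proof (H C D E m (idm (tgt m)) (idm (src n)) n) as K.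
assert (L : tens m n = idc (cod (tens m n))).
{ rewrite <- tens_unit_whisker; apply K.
  - symmetry; exact (src_idm (tgt m)).
  - exact (tgt_idm (src n)).
  - left; unfold is_id_mor; cbn; f_equal; symmetry; exact (tgt_idm (src n)). }
apply inverse_cells_unique with (tens m n); [apply tens_invP|].
assert (B : gprod1 m n = cod (tens m n)).
{ assert (B : dom (tens m n) = cod (tens m n)) by (rewrite L; bd).
  rewrite <- B; unfold gprod1; bd. }
rewrite B, L, cod_idc; apply inverse_cells_idc.
Qed.

(** The opposite coherence at [(m, n)] is the inverse of the original one at [(n, m)], so the
    tensorator in it is [tens m1 n2]. *)
Lemma op_gray_cubical : cubical (op_tricat (gray_tricat G)).
Proof.
intros C D E m1 n1 m2 n2 H1 H2 H; cbn in C, D, E, m1, n1, m2, n2, H1, H2.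
change (idc (n1 ▷ tgt n2) ⊛ tens m1 n2 ⊛ idc (src m1 ◁ m2) =
  idc (cod (idc (n1 ▷ tgt n2) ⊛ tens m1 n2 ⊛ idc (src m1 ◁ m2)))).
assert (K : is_id_cell (tens m1 n2)).
{ apply tens_id; destruct H as [H|H]; [left|right];
  apply is_id_mor_tgt; exact H. }
rewrite K, !hcomp_idc by bd; bd.
Qed.

Lemma star_unit_whisker (C D E : gobj G) (m : mor (ghom D E))
    (n : mor (ghom C D)) :
  idc (gprod1 m^* n^*) =
  idc (m^* ▷ tgt (idm (src n))^*) ⊛ tens_inv (idm (tgt m))^* (idm (src n))^*
  ⊛ idc (src (idm (tgt m))^* ◁ n^*).
Proof.
unfold gprod1; bd; rewrite tens_inv_idl; bd. rewrite hcomp_idr, hcomp_idc by bd; bd.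
Qed.

(** The left side is the cell that [strict_opcub_cub] prescribes for [kappa], unfolded in [G]. *)
Lemma star_tens_inv_whisker (C D E : gobj G) (m : mor (ghom D E))
    (n : mor (ghom C D)) :
  idc ((idm (src m))^* ▷ tgt n^*) ⊛ tens_inv m^* n^*
    ⊛ idc (src m^* ◁ (idm (tgt n))^*) = tens_inv m^* n^*.
Proof.
pose proof (tens_inv_unit_whisker m^* n^*) as K; revert K.
rewrite !star_idm, !tgt_star, !src_star; auto.
Qed.

Lemma star_strict : tri_functor_strict star_coh.
Proof.
assert (O : opcubical (gray_tricat G)).
{ intros C D E m1 n1 m2 n2 H1 H2 H.
  unfold is_id_cell. cbn. rewrite (gray_phi_id H1 H2 H). bd. }
constructor.
- now right.
- left; exact op_gray_cubical.
- intros C D m n H; unfold is_id_cell; cbn; bd.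
- intros C D f; unfold is_id_cell; cbn; bd.
- intros H C D E m n. unfold is_id_cell; cbn.
  assert (L : tens_inv m^* n^* = idc (gprod1 m^* n^*))
   by (destruct H as [[H _]|[_ H]];
       [exact (cubical_tens_inv H _ _) | exact (opcubical_op_tens_inv H _ _)]).
  rewrite L; bd.
- intros HC HS C D E m n. cbn.
  rewrite (cubical_tens_inv HC).
  exact (star_unit_whisker m n).
(* This is the clause for the actual types of source and target, opcubical and cubical; the two
   before it concern the degenerate case. *)
- intros HC HS C D E m n. symmetry.
  exact (star_tens_inv_whisker m n).
Qed.
End StarFunctor.

(** * The functor [#] *)

Section Invertible.
Context (C : TwoCat).
Implicit Types x y z : cell C.
Lemma invertible_idc (a : mor C) : invertible (idc a).
Proof. exists (idc a); apply inverse_cells_idc. Qed.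
Lemma invertible_vcomp x y : dom x = cod y ->
  invertible x -> invertible y -> invertible (x • y).
Proof. intros H [x' Hx] [y' Hy]; eexists; apply inverse_cells_vcomp; eauto. Qed.
Lemma invertible_hcomp x y : src (dom x) = tgt (dom y) ->
  invertible x -> invertible y -> invertible (x ⊛ y).
Proof. intros H [x' Hx] [y' Hy]; eexists; apply inverse_cells_hcomp; eauto. Qed.
Lemma invertible_sym x y : inverse_cells x y -> invertible y.
Proof. exists x; now apply inverse_cells_sym. Qed.
Lemma invertible_mono x y z : invertible x -> dom x = cod y -> dom x = cod z ->
  x • y = x • z -> y = z.
Proof.
intros [x' [[H1 H2] [_ H3]]] Hy Hz E.
rewrite <- (vcomp_idl (a := dom x) (x := y)), <- (vcomp_idl (a := dom x) (x := z))
  by congruence.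
rewrite <- H3, <- !vcompA by congruence; congruence.
Qed.
Lemma invertible_epi x y z : invertible x -> cod x = dom y -> cod x = dom z ->
  y • x = z • x -> y = z.
Proof.
intros [x' [[H1 H2] [H3 _]]] Hy Hz E.
rewrite <- (vcomp_idr (a := cod x) (x := y)), <- (vcomp_idr (a := cod x) (x := z))
  by congruence.
rewrite <- H3, !vcompA by congruence; congruence.
Qed.
End Invertible.

Section InvertibleWhisker.
Context (G : GrayCat) (B C D : gobj G).
Lemma invertible_lw (k : ob (ghom C D)) (x : cell (ghom B C)) :
  invertible x -> invertible (k ◀ x).
Proof.
intros [y H]; exists (k ◀ y).
exact (inverse_cells_sf (lwhisker_functor B k) H).
Qed.
Lemma invertible_rw (x : cell (ghom C D)) (k : ob (ghom B C)) :
  invertible x -> invertible (x ▶ k).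
Proof.
intros [y H]; exists (y ▶ k).
exact (inverse_cells_sf (rwhisker_functor D k) H).
Qed.
Lemma invertible_tens (m : mor (ghom C D)) (n : mor (ghom B C)) :
  invertible (tens m n).
Proof. eexists; apply tens_invP. Qed.
End InvertibleWhisker.

Section Fold.
Context (G : GrayCatWithDuals) (C D : gobj G).
Implicit Types f : ob (ghom C D).
Lemma src_eta f : src (eta f) = gunit D.
Proof. apply eta_mor. Qed.
Lemma tgt_eta f : tgt (eta f) = f □ f^#.
Proof. apply eta_mor. Qed.
Lemma dom_triang f : dom (triang f) = ((eta f)^* ▷ f) ∘ (f ◁ eta f^#).
Proof. apply triang_cell. Qed.
Lemma cod_triang f : cod (triang f) = idm f.
Proof. apply triang_cell. Qed.
End Fold.

Ltac bd_hook_dual ::=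
  match goal with
  | |- context [src (eta _)] => rewrite src_eta
  | |- context [tgt (eta _)] => rewrite tgt_eta
  | |- context [dom (triang _)] => rewrite dom_triang
  | |- context [cod (triang _)] => rewrite cod_triang
  | |- context [dual (gprod _ _)] => rewrite dual_gprod
  | |- context [dual (dual _)] => rewrite dualK
  | |- context [dual (gunit _)] => rewrite dual_unit
  | |- context [eta (gprod _ _)] => rewrite eta_gprod
  | |- context [eta (gunit _)] => rewrite eta_unit
  end.

(** * Transposition along a fold is an equivalence *)

Section Transpose.
Context (G : GrayCatWithDuals) (C D : gobj G) (f : ob (ghom C D)).
(** [ltr1] and [rtr1] are the two transpositions along the fold of [f]; the
    triangulator makes [trunit n : n -> rtr1 (ltr1 n)] and
    [trcounit b : ltr1 (rtr1 b) -> b] natural isomorphisms. *)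
Definition ltr1 (n : mor (ghom D C)) : mor (ghom D D) := (eta f)^* ∘ (f ◁ n).
Definition ltr2 (z : cell (ghom D C)) : cell (ghom D D) :=
  idc (eta f)^* ⊛ (f ◀ z).
Definition rtr1 (x : ob (ghom D C)) (b : mor (ghom D D)) : mor (ghom D C) :=
  (f^# ◁ b) ∘ (eta f^# ▷ x).
Definition rtr2 (x : ob (ghom D C)) (w : cell (ghom D D)) : cell (ghom D C) :=
  (f^# ◀ w) ⊛ idc (eta f^# ▷ x).
(** The dual triangulator inserts a zigzag on [f^#], and the tensorator moves [n] past its fold. *)
Definition trunit (n : mor (ghom D C)) : cell (ghom D C) :=
  (idc (f^# ◁ (eta f)^*) ⊛ tens (eta f^#) n) • ((triang f^#)^⋆ ⊛ idc n).
Definition trcounit (x : ob (ghom D C)) (b : mor (ghom D D)) :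
    cell (ghom D D) :=
  (idc b ⊛ (triang f ▶ x)) • (tens (eta f)^* b ⊛ idc (f ◁ (eta f^# ▷ x))).

Lemma trunit_cell n : tgt n = f^# ->
  is_cell (trunit n) n (rtr1 (src n) (ltr1 n)).
Proof. intros H; unfold trunit, rtr1, ltr1; split; bd. Qed.
Lemma trcounit_cell x b : src b = f □ x -> tgt b = gunit D ->
  is_cell (trcounit x b) (ltr1 (rtr1 x b)) b.
Proof. intros Hs Ht; unfold trcounit, rtr1, ltr1; split; bd. Qed.
Lemma trunit_invertible n : tgt n = f^# -> invertible (trunit n).
Proof.
intros H; apply invertible_vcomp; [bd|..].
- apply invertible_hcomp; [bd|apply invertible_idc|apply invertible_tens].
- apply invertible_hcomp; [bd| |apply invertible_idc].
  destruct (triang_inv f^#) as [y Hy]; eexists; apply star_inverse; eauto.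
Qed.
Lemma trcounit_invertible x b : src b = f □ x -> tgt b = gunit D ->
  invertible (trcounit x b).
Proof.
intros Hs Ht; apply invertible_vcomp; [bd|..].
- apply invertible_hcomp; [bd|apply invertible_idc|].
  apply invertible_rw, triang_inv.
- apply invertible_hcomp; [bd|apply invertible_tens|apply invertible_idc].
Qed.
Lemma trunit_nat z n n' : is_cell z n n' -> tgt n = f^# ->
  trunit n' • z = rtr2 (src n) (ltr2 z) • trunit n.
Proof.
intros [Hd Hc] H; unfold trunit, rtr2, ltr2.
assert (Hs : src n' = src n) by (rewrite <- Hd, <- Hc; apply src_cod).
assert (Ht : tgt n' = f^#) by (rewrite <- H, <- Hd, <- Hc; apply tgt_cod).
pose proof (tens_nat (idc (eta f^#)) z) as K.
apply (f_equal (fun x => (idc (f^# ◁ (eta f)^*) ⊛ x) •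
  ((triang f^#)^⋆ ⊛ idc n))) in K.
gnormalize K. gnorm. rewrite <- K.
slide (triang f^#)^⋆ z.
reflexivity.
Qed.
Lemma trcounit_nat x w b b' : is_cell w b b' -> src b = f □ x -> tgt b = gunit D ->
  trcounit x b' • ltr2 (rtr2 x w) = w • trcounit x b.
Proof.
intros [Hd Hc] H H'; unfold trcounit, rtr2, ltr2.
assert (Hs : src b' = f □ x) by (rewrite <- H, <- Hd, <- Hc; apply src_cod).
assert (Ht : tgt b' = gunit D) by (rewrite <- H', <- Hd, <- Hc; apply tgt_cod).
pose proof (tens_nat (idc (eta f)^*) w) as K.
apply (f_equal (fun z => (idc b' ⊛ (triang f ▶ x)) •
  (z ⊛ idc (f ◁ eta f^# ▷ x)))) in K.
gnormalize K. gnorm. rewrite K.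
slide w (triang f ▶ x).
reflexivity.
Qed.

Lemma ltr2_cell z n n' : is_cell z n n' -> tgt n = f^# ->
  is_cell (ltr2 z) (ltr1 n) (ltr1 n').
Proof. intros [Hd Hc] H; unfold ltr1, ltr2; split; bd. Qed.
Lemma rtr2_cell x w b b' : is_cell w b b' -> src b = f □ x ->
  is_cell (rtr2 x w) (rtr1 x b) (rtr1 x b').
Proof. intros [Hd Hc] H; unfold rtr1, rtr2; split; bd. Qed.
(** By naturality [trunit n' • z] depends on [ltr2 z] only, and [trunit n'] is invertible. *)
Lemma ltr_faithful z z' n n' : tgt n = f^# ->
  is_cell z n n' -> is_cell z' n n' -> ltr2 z = ltr2 z' -> z = z'.
Proof.
intros H Hz Hz' E.
assert (tgt n' = f^#)
  by (destruct Hz as [<- <-]; rewrite <- H; apply tgt_cod).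
destruct (@trunit_cell n') as [Hd Hc]; auto.
apply invertible_mono with (trunit n').
- now apply trunit_invertible.
- destruct Hz; congruence.
- destruct Hz'; congruence.
- rewrite (trunit_nat Hz H), (trunit_nat Hz' H), E; reflexivity.
Qed.
Lemma rtr_faithful x w w' b b' : src b = f □ x -> tgt b = gunit D ->
  is_cell w b b' -> is_cell w' b b' -> rtr2 x w = rtr2 x w' -> w = w'.
Proof.
intros H H' Hw Hw' E.
destruct (@trcounit_cell x b) as [Hd Hc]; auto.
apply invertible_epi with (trcounit x b).
- now apply trcounit_invertible.
- destruct Hw; congruence.
- destruct Hw'; congruence.
- rewrite <- (trcounit_nat Hw H H'), <- (trcounit_nat Hw' H H'), E; reflexivity.
Qed.
(** [ltr2 f] is full because [rtr2] is faithful and [trunit] is a natural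
    isomorphism from the identity to [rtr1 ∘ ltr1]. *)
Lemma ltr_full w n n' : src n' = src n -> tgt n = f^# -> tgt n' = f^# ->
  is_cell w (ltr1 n) (ltr1 n') -> exists z, is_cell z n n' /\ ltr2 z = w.
Proof.
intros Hs H H' Hw.
destruct (trunit_invertible H') as [u Hu].
destruct (trunit_cell H) as [Hd Hc], (trunit_cell H') as [Hd' Hc'].
assert (Hl : src (ltr1 n) = f □ src n) by (unfold ltr1; bd).
assert (Hl' : tgt (ltr1 n) = gunit D) by (unfold ltr1; bd).
destruct (rtr2_cell Hw Hl) as [Hrd Hrc].
destruct Hu as [[Hud Huc] [Hu1 Hu2]].
rewrite Hs in Hc'.
assert (Hz : is_cell (u • (rtr2 (src n) w • trunit n)) n n')
  by (split; rewrite ?dom_vcomp, ?cod_vcomp by (rewrite ?cod_vcomp; congruence);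
      congruence).
(* Naturality of [trunit] forces this witness: [u] is the inverse of [trunit n'], and
   [trunit n' • z] must be [rtr2 (src n) w • trunit n]. *)
exists (u • (rtr2 (src n) w • trunit n)); split; auto.
apply rtr_faithful with (src n) (ltr1 n) (ltr1 n'); auto.
{ now apply ltr2_cell. }
apply invertible_epi with (trunit n).
- now apply trunit_invertible.
- destruct (rtr2_cell (ltr2_cell Hz H) Hl) as [-> _]; auto.
- congruence.
- rewrite <- (trunit_nat Hz H), vcompA, Hu1; rewrite ?cod_vcomp; try congruence.
  apply vcomp_idl; rewrite cod_vcomp; congruence.
Qed.
Lemma ltr_invertible z n n' : src n' = src n -> tgt n = f^# -> tgt n' = f^# ->
  is_cell z n n' -> invertible (ltr2 z) -> invertible z.
Proof.
intros Hs H H' Hz [v [[Hvd Hvc] [Hv1 Hv2]]].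
destruct (ltr2_cell Hz H) as [Hd Hc].
destruct (@ltr_full v n' n) as [y [Hy Ey]]; auto.
{ split; congruence. }
destruct Hz as [Hzd Hzc], Hy as [Hyd Hyc].
exists y; repeat split; try congruence.
- apply ltr_faithful with n' n'; auto; try (split; bd).
  transitivity (ltr2 z • ltr2 y); [unfold ltr2; gnorm; reflexivity|].
  rewrite Ey, Hv1; unfold ltr2; gnorm; reflexivity.
- apply ltr_faithful with n n; auto; try (split; bd).
  transitivity (ltr2 y • ltr2 z); [unfold ltr2; gnorm; reflexivity|].
  rewrite Ey, Hv2; unfold ltr2; gnorm; reflexivity.
Qed.
End Transpose.

Section Factor.
Context (G : GrayCatWithDuals) (C D : gobj G) (f : ob (ghom C D)).
(** The counit being invertible, [s] can be divided by it, and fullness of [ltr2] lifts the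
    quotient. *)
Lemma ltr_factor x b n s : tgt n = f^# -> src n = x ->
  src b = f □ x -> tgt b = gunit D -> is_cell s (ltr1 f n) b ->
  exists z, is_cell z n (rtr1 f x b) /\ trcounit f x b • ltr2 f z = s.
Proof.
intros H Hs Hb Hb' [Hsd Hsc].
destruct (trcounit_invertible Hb Hb') as [t [[Htd Htc] [Ht _]]].
destruct (trcounit_cell Hb Hb') as [Hd Hc].
destruct (@ltr_full G C D f (t • s) n (rtr1 f x b)) as [z [Hz Ez]]; auto.
- unfold rtr1; bd.
- unfold rtr1; bd.
- split; [rewrite dom_vcomp|rewrite cod_vcomp]; congruence.
- exists z; split; auto.
  rewrite Ez, vcompA, Ht by congruence; apply vcomp_idl; congruence.
Qed.
End Factor.

(** * Squares: composition and whiskering *)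

Section Squares.
Context (G : GrayCatWithDuals).

Definition fold1 (C D : gobj G) (m : mor (ghom C D)) : mor (ghom D D) :=
  (eta (tgt m))^* ∘ (m ▷ (tgt m)^#).
Definition fold2 (C D : gobj G) (x : cell (ghom C D)) : cell (ghom D D) :=
  idc (eta (tgt (dom x)))^* ⊛ (x ▶ (tgt (dom x))^#).

Definition square (C D : gobj G) (f g : ob (ghom C D)) (m : mor (ghom C D))
    (n : mor (ghom D C)) (s : cell (ghom D D)) : Prop :=
  (is_mor m f g /\ is_mor n g^# f^#)
    /\ is_cell s ((eta f)^* ∘ (f ◁ n)) ((eta g)^* ∘ (m ▷ g^#)).

(** [n'] and [m] are arguments because a square does not determine the
    2-morphisms on its boundary. *)
Definition sq_comp (C D : gobj G) (s' : cell (ghom D D)) (n' : mor (ghom D C))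
    (m : mor (ghom C D)) (s : cell (ghom D D)) : cell (ghom D D) :=
  (s' ⊛ idc (m ▷ src n')) • (idc (eta (tgt m))^* ⊛ tens m n')
    • (s ⊛ idc (src m ◁ n')).
End Squares.

Ltac sq_intro := intros;
  repeat match goal with
   | H : square _ _ _ _ _ |- _ => destruct H as [[[? ?] [? ?]] [? ?]]
   | H : is_cell _ _ _ |- _ => destruct H
   | H : is_mor _ _ _ |- _ => destruct H
  end.

Section SquareComposition.
Context (G : GrayCatWithDuals).

Lemma sq_comp_square (C D : gobj G) (f g h : ob (ghom C D)) m m' n n' s s' :
  square f g m n s -> square g h m' n' s' ->
  square f h (m' ∘ m) (n ∘ n') (sq_comp s' n' m s).
Proof. sq_intro; unfold sq_comp; repeat split; bd. Qed.

Lemma sq_comp_invertible (C D : gobj G) (f g h : ob (ghom C D)) m m' n n' s s' :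
  square f g m n s -> square g h m' n' s' ->
  invertible s -> invertible s' -> invertible (sq_comp s' n' m s).
Proof.
sq_intro; unfold sq_comp; repeat (apply invertible_vcomp; [bd|..]);
 (apply invertible_hcomp; [bd|..]);
 auto using invertible_idc, invertible_tens.
Qed.

(** Both sides expand to the same three squares and three tensorators; only [s2] and [tens m1 n3]
    occur at different heights. *)
Lemma sq_comp_assoc (C D : gobj G) (f g h k : ob (ghom C D))
    m1 m2 m3 n1 n2 n3 s1 s2 s3 :
  square f g m1 n1 s1 -> square g h m2 n2 s2 -> square h k m3 n3 s3 ->
  sq_comp s3 n3 (m2 ∘ m1) (sq_comp s2 n2 m1 s1) =
  sq_comp (sq_comp s3 n3 m2 s2) (n2 ∘ n3) m1 s1.
Proof.
sq_intro; unfold sq_comp; gnorm.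
slide s2 (tens m1 n3); reflexivity.
Qed.

Lemma sq_id_square (C D : gobj G) (f : ob (ghom C D)) :
  square f f (idm f) (idm f^#) (idc (eta f)^*).
Proof. repeat split; bd. Qed.

Lemma sq_comp_idl (C D : gobj G) (f g : ob (ghom C D)) m n s :
  square f g m n s -> sq_comp (idc (eta g)^*) (idm g^#) m s = s.
Proof. sq_intro; unfold sq_comp; gnorm; reflexivity. Qed.

Lemma sq_comp_idr (C D : gobj G) (f g : ob (ghom C D)) m n s :
  square f g m n s -> sq_comp s n (idm f) (idc (eta f)^*) = s.
Proof. sq_intro; unfold sq_comp; gnorm; reflexivity. Qed.

(** Naturality of the tensorator in its second argument carries [z'] past [m]. *)
Lemma sq_comp_pre (C D : gobj G) (f g h : ob (ghom C D))
    m m' n n' n0 n0' s s' z z' :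
  square f g m n s -> square g h m' n' s' ->
  is_cell z n0 n -> is_cell z' n0' n' ->
  is_mor n0 g^# f^# -> is_mor n0' h^# g^# ->
  sq_comp (s' • ltr2 g z') n0' m (s • ltr2 f z) =
  sq_comp s' n' m s • ltr2 f (z ⊛ z').
Proof.
sq_intro; unfold sq_comp, ltr2.
gnorm.
pose proof (tens_nat (idc m) z') as K.
apply (f_equal (fun x => idc (eta g)^* ⊛ x)) in K.
gnormalize K; use K; slide s (f ◀ z').
rewrite (hcomp_split (x := idc (eta f)^* ⊛ (f ◀ z)) (y := f ◀ z')) by bd.
gnorm; reflexivity.
Qed.

Lemma sq_comp_post (C D : gobj G) (f g h : ob (ghom C D))
    m m' n n' m1 m1' s s' x x' :
  square f g m n s -> square g h m' n' s' ->
  is_cell x m m1 -> is_cell x' m' m1' ->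
  is_mor m1 f g -> is_mor m1' g h ->
  sq_comp (fold2 x' • s') n' m1 (fold2 x • s) =
  fold2 (x' ⊛ x) • sq_comp s' n' m s.
Proof.
sq_intro; unfold sq_comp, fold2.
gnorm.
pose proof (tens_nat x (idc n')) as K.
apply (f_equal (fun x => idc (eta g)^* ⊛ x)) in K.
gnormalize K; use K.
rewrite (hcomp_split_l (x := idc (eta h)^* ⊛ (x' ▶ h^#)) (y := x ▶ h^#)) by bd.
gnorm.
slide s' (x ▶ h^#); reflexivity.
Qed.

(** The fold of [k □ f] is the fold of [k] followed by that of [f], whiskered by [k] and [k^#]; a
    square therefore fits inside the fold of [k]. *)
Definition sq_lw (D E : gobj G) (k : ob (ghom D E)) (s : cell (ghom D D)) :
    cell (ghom E E) := idc (eta k)^* ⊛ (k ◀ (s ▶ k^#)).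
(** [sq_rw] first moves the fold of [h] past [n], then past [m]. *)
Definition sq_rw (C D E : gobj G) (s : cell (ghom E E)) (m : mor (ghom D E))
    (n : mor (ghom E D)) (h : ob (ghom C D)) : cell (ghom E E) :=
  (idc (eta (tgt m))^* ⊛ tens m ((eta h)^* ▷ src n))
    • (s ⊛ idc (src m ◁ ((eta h)^* ▷ src n)))
    • (idc (eta (src m))^* ⊛ tens (src m ◁ (eta h)^*) n).

Lemma sq_lw_square (C D E : gobj G) (k : ob (ghom D E)) (f g : ob (ghom C D))
    m n s :
  square f g m n s ->
  square (k □ f) (k □ g) (k ◁ m) (n ▷ k^#) (sq_lw k s).
Proof. sq_intro; unfold sq_lw; repeat split; bd. Qed.

Lemma sq_rw_square (C D E : gobj G) (f g : ob (ghom D E)) (h : ob (ghom C D))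
    m n s :
  square f g m n s ->
  square (f □ h) (g □ h) (m ▷ h) (h^# ◁ n) (sq_rw s m n h).
Proof. sq_intro; unfold sq_rw; repeat split; bd. Qed.
End SquareComposition.

Section LeftWhisker.
Context (G : GrayCatWithDuals).
Lemma sq_lw_comp (C D E : gobj G) (k : ob (ghom D E)) (f g h : ob (ghom C D))
    m m' n n' s s' :
  square f g m n s -> square g h m' n' s' ->
  sq_lw k (sq_comp s' n' m s) =
  sq_comp (sq_lw k s') (n' ▷ k^#) (k ◁ m) (sq_lw k s).
Proof. sq_intro; unfold sq_lw, sq_comp; gnorm; reflexivity. Qed.

Lemma sq_lw_id (C D E : gobj G) (k : ob (ghom D E)) (f : ob (ghom C D)) :
  sq_lw k (idc (eta f)^*) = idc (eta (k □ f))^*.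
Proof. unfold sq_lw; gnorm; reflexivity. Qed.

Lemma sq_lw_lw (C D E F : gobj G) (k : ob (ghom E F)) (k' : ob (ghom D E))
    (f g : ob (ghom C D)) m n s :
  square f g m n s -> sq_lw k (sq_lw k' s) = sq_lw (k □ k') s.
Proof. sq_intro; unfold sq_lw; gnorm; reflexivity. Qed.

Lemma sq_lw_unit (C D : gobj G) (f g : ob (ghom C D)) m n s :
  square f g m n s -> sq_lw (gunit D) s = s.
Proof. sq_intro; unfold sq_lw; gnorm; reflexivity. Qed.

Lemma sq_lw_pre (C D E : gobj G) (k : ob (ghom D E)) (f g : ob (ghom C D))
    m n n0 s z :
  square f g m n s -> is_cell z n0 n -> is_mor n0 g^# f^# ->
  sq_lw k (s • ltr2 f z) = sq_lw k s • ltr2 (k □ f) (z ▶ k^#).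
Proof. sq_intro; unfold sq_lw, ltr2; gnorm; reflexivity. Qed.

Lemma sq_lw_post (C D E : gobj G) (k : ob (ghom D E)) (f g : ob (ghom C D))
    m m1 n s x :
  square f g m n s -> is_cell x m m1 -> is_mor m1 f g ->
  sq_lw k (fold2 x • s) = fold2 (k ◀ x) • sq_lw k s.
Proof. sq_intro; unfold sq_lw, fold2; gnorm; reflexivity. Qed.

Lemma sq_lw_invertible (C D E : gobj G) (k : ob (ghom D E))
    (f g : ob (ghom C D)) m n s :
  square f g m n s -> invertible s -> invertible (sq_lw k s).
Proof.
sq_intro; unfold sq_lw; apply invertible_hcomp; [bd|apply invertible_idc|].
now apply invertible_lw, invertible_rw.
Qed.
End LeftWhisker.

Section RightWhisker.
Context (G : GrayCatWithDuals).
Lemma sq_rw_invertible (C D E : gobj G) (f g : ob (ghom D E))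
    (h : ob (ghom C D)) m n s :
  square f g m n s -> invertible s -> invertible (sq_rw s m n h).
Proof.
sq_intro; unfold sq_rw; repeat (apply invertible_vcomp; [bd|..]);
 (apply invertible_hcomp; [bd|..]);
 auto using invertible_idc, invertible_tens.
Qed.
Lemma sq_rw_id (C D E : gobj G) (f : ob (ghom D E)) (h : ob (ghom C D)) :
  sq_rw (idc (eta f)^*) (idm f) (idm f^#) h = idc (eta (f □ h))^*.
Proof. unfold sq_rw; gnorm; reflexivity. Qed.

Lemma sq_rw_unit (D E : gobj G) (f g : ob (ghom D E)) m n s :
  square f g m n s -> sq_rw s m n (gunit D) = s.
Proof. sq_intro; unfold sq_rw; gnorm; reflexivity. Qed.

Lemma sq_rw_rw (B C D E : gobj G) (f g : ob (ghom D E)) (h : ob (ghom C D))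
   (h' : ob (ghom B C)) m n s :
  square f g m n s -> sq_rw (sq_rw s m n h) (m ▷ h) (h^# ◁ n) h' =
   sq_rw s m n (h □ h').
Proof. sq_intro; unfold sq_rw; gnorm; reflexivity. Qed.

Lemma sq_rw_comp (C D E : gobj G) (f1 f2 f3 : ob (ghom D E)) (h : ob (ghom C D))
   m m' n n' s s' :
  square f1 f2 m n s -> square f2 f3 m' n' s' ->
  sq_rw (sq_comp s' n' m s) (m' ∘ m) (n ∘ n') h =
  sq_comp (sq_rw s' m' n' h) (h^# ◁ n') (m ▷ h) (sq_rw s m n h).
Proof.
sq_intro; unfold sq_rw, sq_comp; gnorm.
(* Naturality at a tensorator, of Yang-Baxter type: [m], the fold of [h] and [n'] cross pairwise in
   either order. *)
pose proof (tens_nat (idc m) (tens (eta h)^* n')) as K.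
apply (f_equal (fun x => idc (eta f2)^* ⊛ x)) in K; gnormalize K; use K.
slide s (f1 ◀ tens (eta h)^* n').
slide s' (tens m (eta h)^* ▶ f3^#).
reflexivity.
Qed.

Lemma sq_rw_pre (C D E : gobj G) (f g : ob (ghom D E)) (h : ob (ghom C D))
    m n n0 s z :
  square f g m n s -> is_cell z n0 n -> is_mor n0 g^# f^# ->
  sq_rw (s • ltr2 f z) m n0 h = sq_rw s m n h • ltr2 (f □ h) (h^# ◀ z).
Proof.
sq_intro; unfold sq_rw, ltr2; gnorm.
pose proof (tens_nat (idc (eta h)^*) z) as K.
apply (f_equal (fun x => idc (eta f)^* ⊛ (f ◀ x))) in K; gnormalize K; use K.
reflexivity.
Qed.

Lemma sq_rw_post (C D E : gobj G) (f g : ob (ghom D E)) (h : ob (ghom C D))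
    m m1 n s x :
  square f g m n s -> is_cell x m m1 -> is_mor m1 f g ->
  sq_rw (fold2 x • s) m1 n h = fold2 (x ▶ h) • sq_rw s m n h.
Proof.
sq_intro; unfold sq_rw, fold2; gnorm.
pose proof (tens_nat x (idc (eta h)^*)) as K.
apply (f_equal (fun x => idc (eta g)^* ⊛ (x ▶ g^#))) in K; gnormalize K; use K.
reflexivity.
Qed.
End RightWhisker.

Section BothWhiskers.
Context (G : GrayCatWithDuals).
Lemma sq_lw_rw (B C D E : gobj G) (k : ob (ghom D E)) (f g : ob (ghom C D))
    (h : ob (ghom B C)) m n s :
  square f g m n s ->
  sq_lw k (sq_rw s m n h) = sq_rw (sq_lw k s) (k ◁ m) (n ▷ k^#) h.
Proof. sq_intro; unfold sq_rw, sq_lw; gnorm; reflexivity. Qed.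

(** An interchange law: naturality of the tensorator carries the whole square [s'] past [n] and past
    [m], which leaves one tensorator on each boundary. *)
Lemma sq_swap (C D E : gobj G) (f1 f2 : ob (ghom D E)) (h1 h2 : ob (ghom C D))
    m n s m' n' s' :
  square f1 f2 m n s -> square h1 h2 m' n' s' ->
  fold2 (tens m m')
    • sq_comp (sq_rw s m n h2) (h2^# ◁ n) (f1 ◁ m') (sq_lw f1 s') =
  sq_comp (sq_lw f2 s') (n' ▷ f2^#) (m ▷ h1) (sq_rw s m n h1)
    • ltr2 (f1 □ h1) (tens n' n).
Proof.
sq_intro; unfold sq_rw, sq_lw, sq_comp, fold2, ltr2; gnorm.
pose proof (tens_nat s' (idc n)) as K.
apply (f_equal (fun x => idc (eta f1)^* ⊛ (f1 ◀ x))) in K; gnormalize K.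
pose proof (tens_nat (idc m) s') as K'.
apply (f_equal (fun x => idc (eta f2)^* ⊛ (x ▶ f2^#))) in K'; gnormalize K'.
use K; use K'; slide s ((f1 ◀ s') ▶ f2^#); reflexivity.
Qed.
End BothWhiskers.

(** * Products of squares *)

Section Product.
Context (G : GrayCatWithDuals).

(** The whiskered squares are composed in the order of the factors of [gprod1 m m']; the opposite
    boundary is then [gprod1 n' n], as the reversed product of the target of [#] requires. *)
Definition sq_prod (C D E : gobj G) (s : cell (ghom E E)) (m : mor (ghom D E))
    (n : mor (ghom E D)) (s' : cell (ghom D D)) (m' : mor (ghom C D)) :
    cell (ghom E E) :=
  sq_comp (sq_rw s m n (tgt m')) ((tgt m')^# ◁ n) (src m ◁ m')
    (sq_lw (src m) s').

Lemma square_eq (C D : gobj G) (f g : ob (ghom C D)) m m0 n n0 s :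
  square f g m0 n0 s -> m0 = m -> n0 = n -> square f g m n s.
Proof. now intros H -> ->. Qed.

Section Laws.
Context (C D E : gobj G) (f1 f2 : ob (ghom D E)) (h1 h2 : ob (ghom C D)).
Context (m : mor (ghom D E)) (n : mor (ghom E D)) (s : cell (ghom E E)).
Context (m' : mor (ghom C D)) (n' : mor (ghom D C)) (s' : cell (ghom D D)).

Lemma sq_prodE : square f1 f2 m n s -> square h1 h2 m' n' s' ->
  sq_prod s m n s' m' =
  sq_comp (sq_rw s m n h2) (h2^# ◁ n) (f1 ◁ m') (sq_lw f1 s').
Proof. unfold sq_prod; sq_intro; bd. Qed.

Lemma sq_prod_square : square f1 f2 m n s -> square h1 h2 m' n' s' ->
  square (f1 □ h1) (f2 □ h2) (gprod1 m m') (gprod1 n' n) (sq_prod s m n s' m').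
Proof.
intros Hs Hs'; rewrite (sq_prodE Hs Hs').
eapply square_eq.
- eapply sq_comp_square; [apply sq_lw_square|apply sq_rw_square]; eauto.
- unfold gprod1; sq_intro; bd.
- unfold gprod1; sq_intro; bd.
Qed.

Lemma sq_prod_invertible : square f1 f2 m n s -> square h1 h2 m' n' s' ->
  invertible s -> invertible s' -> invertible (sq_prod s m n s' m').
Proof.
intros Hs Hs' ? ?; rewrite (sq_prodE Hs Hs'); eapply sq_comp_invertible.
- eapply sq_lw_square; eauto.
- eapply sq_rw_square; eauto.
- eapply sq_lw_invertible; eauto.
- eapply sq_rw_invertible; eauto.
Qed.

End Laws.

Lemma ltr2_square (C D : gobj G) (f g : ob (ghom C D)) m n n0 s z :
  square f g m n s -> is_cell z n0 n -> is_mor n0 g^# f^# ->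
  square f g m n0 (s • ltr2 f z).
Proof. sq_intro; unfold ltr2; repeat split; bd. Qed.
Lemma fold2_square (C D : gobj G) (f g : ob (ghom C D)) m m1 n s x :
  square f g m n s -> is_cell x m m1 -> is_mor m1 f g ->
  square f g m1 n (fold2 x • s).
Proof. sq_intro; unfold fold2; repeat split; bd. Qed.

Section Natural.
Context (C D E : gobj G) (f1 f2 : ob (ghom D E)) (h1 h2 : ob (ghom C D)).
Context (m m1 : mor (ghom D E)) (n n1 : mor (ghom E D)) (s : cell (ghom E E)).
Context (m' m1' : mor (ghom C D)) (n' n1' : mor (ghom D C)) (s' : cell (ghom D D)).

Lemma sq_prod_pre z z' :
  square f1 f2 m n s -> square h1 h2 m' n' s' ->
  is_cell z n1 n -> is_mor n1 f2^# f1^# ->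
  is_cell z' n1' n' -> is_mor n1' h2^# h1^# ->
  sq_prod (s • ltr2 f1 z) m n1 (s' • ltr2 h1 z') m' =
  sq_prod s m n s' m' • ltr2 (f1 □ h1) (gprod2 z' z).
Proof.
intros Hs Hs' Hz Hn Hz' Hn'.
rewrite (sq_prodE Hs Hs'),
  (sq_prodE (ltr2_square Hs Hz Hn) (ltr2_square Hs' Hz' Hn')).
rewrite (sq_rw_pre h2 Hs Hz Hn), (sq_lw_pre f1 Hs' Hz' Hn').
rewrite (sq_comp_pre (z := z' ▶ f1^#) (z' := h2^# ◀ z) (n0 := n1' ▷ f1^#)
  (n0' := h2^# ◁ n1) (sq_lw_square f1 Hs') (sq_rw_square h2 Hs))
  by (sq_intro; split; bd).
f_equal; f_equal; f_equal; unfold gprod2; sq_intro; bd.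
Qed.

Lemma sq_prod_post x x' :
  square f1 f2 m n s -> square h1 h2 m' n' s' ->
  is_cell x m m1 -> is_mor m1 f1 f2 ->
  is_cell x' m' m1' -> is_mor m1' h1 h2 ->
  sq_prod (fold2 x • s) m1 n (fold2 x' • s') m1' =
  fold2 (gprod2 x x') • sq_prod s m n s' m'.
Proof.
intros Hs Hs' Hz Hn Hz' Hn'.
rewrite (sq_prodE Hs Hs'),
  (sq_prodE (fold2_square Hs Hz Hn) (fold2_square Hs' Hz' Hn')).
rewrite (sq_rw_post h2 Hs Hz Hn), (sq_lw_post f1 Hs' Hz' Hn').
rewrite (sq_comp_post (x := f1 ◀ x') (x' := x ▶ h2) (m1 := f1 ◁ m1')
  (m1' := m1 ▷ h2) (sq_lw_square f1 Hs') (sq_rw_square h2 Hs))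
  by (sq_intro; split; bd).
f_equal; f_equal; f_equal; unfold gprod2; sq_intro; bd.
Qed.
End Natural.

Lemma sq_prod_id (C D E : gobj G) (f : ob (ghom D E)) (h : ob (ghom C D)) :
  sq_prod (idc (eta f)^* ) (idm f) (idm f^#) (idc (eta h)^* ) (idm h) =
  idc (eta (f □ h))^*.
Proof.
rewrite (sq_prodE (sq_id_square f) (sq_id_square h)), sq_rw_id, sq_lw_id.
pose proof (sq_comp_idl (sq_id_square (f □ h))) as K; revert K; bd.
Qed.

Lemma sq_prod_unitr (D E : gobj G) (f g : ob (ghom D E)) m n s :
  square f g m n s ->
  sq_prod s m n (idc (eta (gunit D))^* ) (idm (gunit D)) = s.
Proof.
intros Hs; rewrite (sq_prodE Hs (sq_id_square _)), (sq_rw_unit Hs), sq_lw_id.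
pose proof (sq_comp_idr Hs) as K; revert K; bd.
Qed.

Lemma sq_prod_unitl (D E : gobj G) (f g : ob (ghom D E)) m n s :
  square f g m n s ->
  sq_prod (idc (eta (gunit E))^* ) (idm (gunit E)) (idm (gunit E)) s m = s.
Proof.
intros Hs; pose proof (sq_id_square (gunit E)) as Hi.
rewrite dual_unit in Hi.
rewrite (sq_prodE Hi Hs), (sq_lw_unit Hs).
pose proof (sq_rw_id (gunit E) g) as Hr; rewrite dual_unit in Hr; rewrite Hr.
pose proof (sq_comp_idl Hs) as K; revert K; bd.
Qed.

(** Once whiskerings are distributed over composites, both sides compose [c] whiskered on the left,
    [b] on both sides and [a] on the right; [sq_comp_assoc] then rebrackets. *)
Lemma sq_prod_assoc (B C D E : gobj G) (g1 g2 : ob (ghom D E))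
    (h1 h2 : ob (ghom C D)) (k1 k2 : ob (ghom B C)) a b c m1 m2 m3 n1 n2 n3 :
  square g1 g2 m1 n1 a -> square h1 h2 m2 n2 b -> square k1 k2 m3 n3 c ->
  sq_prod a m1 n1 (sq_prod b m2 n2 c m3) (gprod1 m2 m3) =
  sq_prod (sq_prod a m1 n1 b m2) (gprod1 m1 m2) (gprod1 n2 n1) c m3.
Proof.
intros Ha Hb Hc.
rewrite (sq_prodE Ha (sq_prod_square Hb Hc)), (sq_prodE (sq_prod_square Ha Hb) Hc).
rewrite (sq_prodE Hb Hc), (sq_prodE Ha Hb).
pose proof (sq_lw_square h1 Hc) as Lc.
pose proof (sq_rw_square k2 Hb) as Rb.
pose proof (sq_lw_square g1 Hb) as Lb.
pose proof (sq_rw_square h2 Ha) as Ra.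
rewrite (sq_lw_comp g1 Lc Rb), (sq_lw_lw g1 h1 Hc), (sq_lw_rw g1 k2 Hb).
assert (Em : gprod1 m1 m2 = (m1 ▷ h2) ∘ (g1 ◁ m2))
  by (unfold gprod1; sq_intro; bd).
assert (En : gprod1 n2 n1 = (n2 ▷ g1^#) ∘ (h2^# ◁ n1))
  by (unfold gprod1; sq_intro; bd).
assert (Em' : g1 ◁ gprod1 m2 m3 = ((g1 ◁ m2) ▷ k2) ∘ ((g1 □ h1) ◁ m3))
  by (unfold gprod1; sq_intro; bd).
rewrite Em, En, Em', (sq_rw_comp k2 Lb Ra), <- (sq_rw_rw h2 k2 Ha).
pose proof (sq_comp_assoc (sq_lw_square (g1 □ h1) Hc) (sq_rw_square k2 Lb)
  (sq_rw_square k2 Ra)) as K.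
assert (En' : k2^# ◁ ((n2 ▷ g1^#) ∘ (h2^# ◁ n1)) =
  ((k2^# ◁ n2) ▷ g1^#) ∘ ((k2^# □ h2^#) ◁ n1)) by (sq_intro; bd).
revert K; rewrite En', !dual_gprod, ?rwmA, ?lwmA, ?lrwmA; auto.
Qed.

Lemma fold2_inverse (C D : gobj G) (x y : cell (ghom C D)) :
  inverse_cells x y -> inverse_cells (fold2 x) (fold2 y).
Proof.
intros H; pose proof H as [[Hd Hc] _]; unfold fold2.
assert (E : tgt (dom y) = tgt (dom x)) by (rewrite Hd; apply tgt_cod).
rewrite E; apply inverse_cells_hcomp; [bd|apply inverse_cells_idc|].
exact (inverse_cells_sf (rwhisker_functor D _) H).
Qed.
Lemma ltr2_inverse (C D : gobj G) (f : ob (ghom C D)) (x y : cell (ghom D C)) :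
  tgt (dom x) = f^# -> inverse_cells x y -> inverse_cells (ltr2 f x) (ltr2 f y).
Proof.
intros E H; unfold ltr2; apply inverse_cells_hcomp; [bd|apply inverse_cells_idc|].
exact (inverse_cells_sf (lwhisker_functor D _) H).
Qed.

Lemma fold2_idc (C D : gobj G) (f g : ob (ghom C D)) m n s :
  square f g m n s -> fold2 (idc m) • s = s.
Proof. sq_intro; unfold fold2; gnorm; reflexivity. Qed.
Lemma ltr2_idc (C D : gobj G) (f g : ob (ghom C D)) m n s :
  square f g m n s -> s • ltr2 f (idc n) = s.
Proof. sq_intro; unfold ltr2; gnorm; reflexivity. Qed.

(** Exchanging the two middle squares of a composite of four. *)
Lemma sq_comp_middle (C D : gobj G) (x0 x1 x2 y2 x3 x4 : ob (ghom C D))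
    mA mB mB' mC mC' mD nA nB nB' nC nC' nD sA sB sB' sC sC' sD t u :
  square x3 x4 mA nA sA -> square x2 x3 mC nC sC -> square x1 x2 mB nB sB ->
  square x1 y2 mC' nC' sC' -> square y2 x3 mB' nB' sB' ->
  square x0 x1 mD nD sD ->
  is_cell t (mC ∘ mB) (mB' ∘ mC') -> is_cell u (nB ∘ nC) (nC' ∘ nB') ->
  fold2 t • sq_comp sC nC mB sB = sq_comp sB' nB' mC' sC' • ltr2 x1 u ->
  fold2 (idc mA ⊛ t ⊛ idc mD)
    • sq_comp (sq_comp sA nA mC sC) (nC ∘ nA) (mB ∘ mD) (sq_comp sB nB mD sD) =
  sq_comp (sq_comp sA nA mB' sB') (nB' ∘ nA) (mC' ∘ mD) (sq_comp sC' nC' mD sD)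
    • ltr2 x0 (idc nD ⊛ u ⊛ idc nA).
Proof.
intros HA HC HB HC' HB' HD Ht Hu E.
pose proof (sq_comp_square HB HC) as HBC.
pose proof (sq_comp_square HC' HB') as HBC'.
pose proof (sq_comp_square HD HBC) as HDBC.
pose proof (sq_comp_square HD HBC') as HDBC'.
assert (Mt : is_mor (mB' ∘ mC') x1 x3) by (sq_intro; split; bd).
assert (Mu : is_mor (nB ∘ nC) x3^# x1^#) by (sq_intro; split; bd).
assert (Mt' : is_mor (mB' ∘ mC' ∘ mD) x0 x3) by (sq_intro; split; bd).
assert (Mu' : is_mor (nD ∘ (nB ∘ nC)) x3^# x0^#) by (sq_intro; split; bd).
assert (MA : is_mor mA x3 x4) by apply HA.
assert (NA : is_mor nA x4^# x3^#) by apply HA.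
assert (MD : is_mor mD x0 x1) by apply HD.
assert (ND : is_mor nD x1^# x0^#) by apply HD.
assert (I : forall (a : mor (ghom C D)), is_cell (idc a) a a) by (intros; split; bd).
assert (J : forall (a : mor (ghom D C)), is_cell (idc a) a a) by (intros; split; bd).
(* [P1] and [P2] extend [E] by the square over [mD], [P3] and [P4] by the one over [mA]; the
   boundary cells added each time are identities. *)
pose proof (sq_comp_post HD HBC (I mD) Ht MD Mt) as P1.
rewrite (fold2_idc HD), E in P1.
pose proof (sq_comp_pre HD HBC' (J nD) Hu ND Mu) as P2.
rewrite (ltr2_idc HD) in P2.
assert (Ct : is_cell (t ⊛ idc mD) (mC ∘ mB ∘ mD) (mB' ∘ mC' ∘ mD))
  by (sq_intro; split; bd).
assert (Cu : is_cell (idc nD ⊛ u) (nD ∘ (nB ∘ nC)) (nD ∘ (nC' ∘ nB')))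
  by (sq_intro; split; bd).
pose proof (sq_comp_post HDBC HA Ct (I mA) Mt' MA) as P3.
rewrite (fold2_idc HA), <- P1 in P3.
pose proof (sq_comp_pre HDBC' HA Cu (J nA) Mu' NA) as P4.
rewrite (ltr2_idc HA), <- P2, P3 in P4.
assert (S1 : mC ∘ (mB ∘ mD) = mC ∘ mB ∘ mD) by (apply compA; sq_intro; bd).
assert (S2 : mB' ∘ (mC' ∘ mD) = mB' ∘ mC' ∘ mD) by (apply compA; sq_intro; bd).
assert (S3 : idc mA ⊛ (t ⊛ idc mD) = idc mA ⊛ t ⊛ idc mD)
  by (apply hcompA; sq_intro; bd).
rewrite <- (sq_comp_assoc (sq_comp_square HD HB) HC HA), S1,
  (sq_comp_assoc HD HB HC), <- (sq_comp_assoc (sq_comp_square HD HC') HB' HA), S2,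
  (sq_comp_assoc HD HC' HB'), <- S3; exact P4.
Qed.

(** Each side is a composite of four whiskered squares, one for each of [a], [b], [c], [d]; only
    those of [b] and [c], in the middle, come in opposite orders, and [sq_swap] exchanges them. *)
Lemma sq_prod_comp (C D E : gobj G) (f1 f2 f3 : ob (ghom D E))
    (h1 h2 h3 : ob (ghom C D)) a b c d m1 m2 n1 n2 p1 p2 q1 q2 :
  square f2 f3 m1 p1 a -> square h2 h3 m2 p2 b ->
  square f1 f2 n1 q1 c -> square h1 h2 n2 q2 d ->
  fold2 (idc (m1 ▷ tgt m2) ⊛ tens_inv n1 m2 ⊛ idc (src n1 ◁ n2))
    • sq_comp (sq_prod a m1 p1 b m2) (gprod1 p2 p1) (gprod1 n1 n2)
        (sq_prod c n1 q1 d n2) =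
  sq_prod (sq_comp a p1 n1 c) (m1 ∘ n1) (q1 ∘ p1) (sq_comp b p2 n2 d) (m2 ∘ n2)
    • ltr2 (f1 □ h1) (idc (q2 ▷ tgt q1) ⊛ tens_inv p2 q1 ⊛ idc (src p2 ◁ p1)).
Proof.
intros Ha Hb Hc Hd.
(* Conjugation by the inverses replaces [tens_inv] by [tens], the direction in which [sq_swap] is
   stated. *)
symmetry; apply inverse_cells_square with
  (fold2 (idc (m1 ▷ tgt m2) ⊛ tens n1 m2 ⊛ idc (src n1 ◁ n2)))
  (ltr2 (f1 □ h1) (idc (q2 ▷ tgt q1) ⊛ tens p2 q1 ⊛ idc (src p2 ◁ p1))).
- pose proof (sq_prod_square (sq_comp_square Hc Ha) (sq_comp_square Hd Hb)) as P.
  revert P; generalize (sq_prod (sq_comp a p1 n1 c) (m1 ∘ n1) (q1 ∘ p1)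
    (sq_comp b p2 n2 d) (m2 ∘ n2)).
  unfold gprod1, fold2; sq_intro; bd.
- pose proof (sq_comp_square (sq_prod_square Hc Hd) (sq_prod_square Ha Hb)) as P.
  revert P; generalize (sq_comp (sq_prod a m1 p1 b m2) (gprod1 p2 p1)
    (gprod1 n1 n2) (sq_prod c n1 q1 d n2)).
  unfold gprod1, ltr2; sq_intro; bd.
- apply fold2_inverse; repeat apply inverse_cells_hcomp;
    try apply inverse_cells_idc; try apply tens_invP; sq_intro; bd.
- apply ltr2_inverse.
  { sq_intro; bd. }
  repeat apply inverse_cells_hcomp;
    try apply inverse_cells_idc; try apply tens_invP; sq_intro; bd.
- rewrite (sq_prodE (sq_comp_square Hc Ha) (sq_comp_square Hd Hb)).
  rewrite (sq_prodE Ha Hb), (sq_prodE Hc Hd).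
  pose proof (sq_rw_square h3 Ha) as Ra.
  pose proof (sq_lw_square f2 Hb) as Lb.
  pose proof (sq_rw_square h3 Hc) as Rc.
  pose proof (sq_lw_square f1 Hb) as Lb1.
  pose proof (sq_rw_square h2 Hc) as Rc2.
  pose proof (sq_lw_square f1 Hd) as Ld.
  rewrite (sq_rw_comp h3 Hc Ha), (sq_lw_comp f1 Hd Hb).
  pose proof (sq_swap Hc Hb) as S.
  assert (Ct : is_cell (tens n1 m2) ((n1 ▷ h3) ∘ (f1 ◁ m2)) ((f2 ◁ m2) ∘ (n1 ▷ h2)))
    by (sq_intro; split; bd).
  assert (Cu : is_cell (tens p2 q1) ((p2 ▷ f1^#) ∘ (h3^# ◁ q1))
    ((h2^# ◁ q1) ∘ (p2 ▷ f2^#))) by (sq_intro; split; bd).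
  pose proof (sq_comp_middle Ra Rc Lb1 Rc2 Lb Ld Ct Cu S) as M.
  replace (tgt m2) with h3 by (symmetry; apply Hb).
  replace (src n1) with f1 by (symmetry; apply Hc).
  replace (src p2) with h3^# by (symmetry; apply Hb).
  replace (tgt q1) with f1^# by (symmetry; apply Hc).
  replace (gprod1 p2 p1) with ((p2 ▷ f2^#) ∘ (h3^# ◁ p1))
    by (unfold gprod1; sq_intro; bd).
  replace (gprod1 n1 n2) with ((n1 ▷ h2) ∘ (f1 ◁ n2))
    by (unfold gprod1; sq_intro; bd).
  replace (f1 ◁ (m2 ∘ n2)) with ((f1 ◁ m2) ∘ (f1 ◁ n2)) by (sq_intro; bd).
  replace (h3^# ◁ (q1 ∘ p1)) with ((h3^# ◁ q1) ∘ (h3^# ◁ p1)) by (sq_intro; bd).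
  exact M.
Qed.
End Product.

(** * The universal square and factorisation through it *)

Section UniversalSquare.
Context (G : GrayCatWithDuals) (C D : gobj G).
Implicit Types (m : mor (ghom C D)) (n : mor (ghom D C)).
Implicit Types (x : cell (ghom C D)) (s : cell (ghom D D)).

(** The universal square over [m]: [sharp1 m] is [rtr1] of [fold1 m]. *)
Definition sharp_sq m : cell (ghom D D) :=
  trcounit (src m) (tgt m)^# (fold1 m).

Lemma sharp1E m : sharp1 m = rtr1 (src m) (tgt m)^# (fold1 m).
Proof. unfold sharp1, rtr1, fold1; bd. Qed.
Lemma sharp2E x :
  sharp2 x = rtr2 (src (dom x)) (tgt (dom x))^# (fold2 x).
Proof. unfold sharp2, rtr2, fold2; gnorm; reflexivity. Qed.

Lemma src_sharp1 m : src (sharp1 m) = (tgt m)^#.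
Proof. unfold sharp1; bd. Qed.
Lemma tgt_sharp1 m : tgt (sharp1 m) = (src m)^#.
Proof. unfold sharp1; bd. Qed.
Lemma src_fold1 m : src (fold1 m) = src m □ (tgt m)^#.
Proof. unfold fold1; bd. Qed.
Lemma tgt_fold1 m : tgt (fold1 m) = gunit D.
Proof. unfold fold1; bd. Qed.
Lemma fold2_cell x : is_cell (fold2 x) (fold1 (dom x)) (fold1 (cod x)).
Proof. unfold fold1, fold2; split; bd. Qed.

Lemma sharp_sq_square m f g : is_mor m f g ->
  square f g m (sharp1 m) (sharp_sq m).
Proof.
intros [<- <-].
destruct (trcounit_cell (src_fold1 m) (tgt_fold1 m)) as [Hd Hc].
unfold square, sharp_sq, is_mor.
rewrite src_sharp1, tgt_sharp1; repeat split; auto.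
rewrite Hd, sharp1E; reflexivity.
Qed.

Lemma sharp_sq_invertible m : invertible (sharp_sq m).
Proof. exact (trcounit_invertible (src_fold1 m) (tgt_fold1 m)). Qed.

Lemma sharp2_cell x : is_cell (sharp2 x) (sharp1 (dom x)) (sharp1 (cod x)).
Proof.
rewrite sharp2E, !sharp1E, src_cod, tgt_cod.
exact (rtr2_cell (fold2_cell x) (src_fold1 _)).
Qed.

(** Naturality of [trcounit] at [fold2 x]. It identifies [sharp2 x] by its effect on universal
    squares, so that naturality of the coherence data can be tested there. *)
Lemma sharp_sq_nat x m m' f g : is_cell x m m' -> is_mor m f g ->
  sharp_sq m' • ltr2 f (sharp2 x) = fold2 x • sharp_sq m.
Proof.
intros [<- <-] [<- _].
unfold sharp_sq; rewrite sharp2E, src_cod, tgt_cod.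
exact (trcounit_nat (fold2_cell x) (src_fold1 _) (tgt_fold1 _)).
Qed.

Section Factor.
Context (f g : ob (ghom C D)) (m : mor (ghom C D)) (n : mor (ghom D C)).
Context (s : cell (ghom D D)).
Lemma sharp_factor : square f g m n s ->
  exists z, is_cell z n (sharp1 m) /\ sharp_sq m • ltr2 f z = s.
Proof.
intros [[[<- <-] [Hs Ht]] Hc]; rewrite sharp1E; apply ltr_factor; auto.
- exact (src_fold1 m).
- exact (tgt_fold1 m).
Qed.

Lemma sharp_unique z z' : is_mor m f g -> tgt n = f^# ->
  is_cell z n (sharp1 m) -> is_cell z' n (sharp1 m) ->
  sharp_sq m • ltr2 f z = sharp_sq m • ltr2 f z' -> z = z'.
Proof.
intros Hm H Hz Hz' E.
apply ltr_faithful with f n (sharp1 m); auto.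
apply invertible_mono with (sharp_sq m); auto using sharp_sq_invertible.
- destruct (ltr2_cell Hz H) as [_ ->]; apply (sharp_sq_square Hm).
- destruct (ltr2_cell Hz' H) as [_ ->]; apply (sharp_sq_square Hm).
Qed.

(** Junk unless [s] is a square. *)
Definition factor : cell (ghom D C) :=
  epsilon (inhabits (idc n))
    (fun z => is_cell z n (sharp1 m) /\ sharp_sq m • ltr2 f z = s).

Lemma factor_cell : square f g m n s -> is_cell factor n (sharp1 m).
Proof. intros H; apply (epsilon_spec (inhabits (idc n)) _ (sharp_factor H)). Qed.
Lemma factorP : square f g m n s -> sharp_sq m • ltr2 f factor = s.
Proof. intros H; apply (epsilon_spec (inhabits (idc n)) _ (sharp_factor H)). Qed.
(** [ltr2 f factor] is the quotient of [s] by the invertible universal square, and [ltr2] reflects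
    invertibility. *)
Lemma factor_invertible : square f g m n s -> invertible s -> invertible factor.
Proof.
intros H Hi.
pose proof (factor_cell H) as K; pose proof (factorP H) as E.
destruct H as [[Hm [Hs Ht]] [Hd Hc]].
destruct (sharp_sq_square Hm) as [[_ [Ss St]] [Sd Sc]].
apply ltr_invertible with f n (sharp1 m); auto.
- congruence.
- destruct (sharp_sq_invertible m) as [t Hp].
  destruct (ltr2_cell K Ht) as [Kd Kc].
  pose proof Hp as [[Hpd Hpc] [_ Hpi]].
  replace (ltr2 f factor) with (t • s).
  + apply invertible_vcomp; auto.
    * congruence.
    * apply (invertible_sym Hp).
  + transitivity (t • (sharp_sq m • ltr2 f factor)); [now rewrite E|].
    rewrite vcompA, Hpi; [apply vcomp_idl| |]; unfold ltr1 in *; congruence.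
Qed.
End Factor.
Lemma dom_sharp2 x : dom (sharp2 x) = sharp1 (dom x).
Proof. apply sharp2_cell. Qed.
Lemma cod_sharp2 x : cod (sharp2 x) = sharp1 (cod x).
Proof. apply sharp2_cell. Qed.
End UniversalSquare.

Ltac bd_hook_sharp ::=
  match goal with
  | |- context [src (sharp1 _)] => rewrite src_sharp1
  | |- context [tgt (sharp1 _)] => rewrite tgt_sharp1
  | |- context [dom (sharp2 _)] => rewrite dom_sharp2
  | |- context [cod (sharp2 _)] => rewrite cod_sharp2
  end.

(** * The weak 2-functors underlying [#] *)

Section Sharp.
Context (G : GrayCatWithDuals).

Definition sharp_phi (C D : gobj G) (a b : mor (ghom C D)) : cell (ghom D C) :=
  factor (src b) (a ∘ b) (sharp1 b ∘ sharp1 a)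
    (sq_comp (sharp_sq a) (sharp1 a) b (sharp_sq b)).
Definition sharp_phi1 (C D : gobj G) (f : ob (ghom C D)) : cell (ghom D C) :=
  factor f (idm f) (idm f^#) (idc (eta f)^*).
Definition sharp_kappa (C D E : gobj G) (m : mor (ghom D E)) (n : mor (ghom C D)) :
    cell (ghom E C) :=
  factor (src m □ src n) (gprod1 m n) (gprod1 (sharp1 n) (sharp1 m))
    (sq_prod (sharp_sq m) m (sharp1 m) (sharp_sq n) n).
(** [weak_coh] carries inverses as data, whereas factorisation yields only their existence; hence a
    choice. *)
Definition chosen_inverse (C : TwoCat) (x : cell C) : cell C :=
  epsilon (inhabits x) (fun y => inverse_cells x y).
Lemma chosen_inverseP (C : TwoCat) (x : cell C) :
  invertible x -> inverse_cells x (chosen_inverse x).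
Proof. exact (epsilon_spec (inhabits x) (fun y => inverse_cells x y)). Qed.

Definition sharp_coh : tri_coh (sharp_map G) :=
  @TriCoh (gray_tricat G) (co_tricat (gray_tricat G)) (sharp_map G)
    (fun C D => @WeakCoh (ghom C D) (co_cat (ghom D C))
      (@sharp_phi C D) (fun m n => chosen_inverse (sharp_phi m n))
      (@sharp_phi1 C D) (fun f => chosen_inverse (sharp_phi1 f)))
    (@sharp_kappa).

Section SquareAction.
Context (C D : gobj G) (f g : ob (ghom C D)) (m : mor (ghom C D)).
Context (n : mor (ghom D C)) (s : cell (ghom D D)).
Lemma square_ltr2_vcomp n0 n1 z w : square f g m n s ->
  is_cell z n0 n -> is_cell w n1 n0 ->
  s • ltr2 f (z • w) = s • ltr2 f z • ltr2 f w.
Proof.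
intros Hs Hz Hw.
assert (T : tgt n0 = f^#).
{ destruct Hz as [<- Hz]; rewrite <- tgt_cod, Hz; apply Hs. }
assert (T' : src n0 = g^#).
{ destruct Hz as [<- Hz]; rewrite <- src_cod, Hz; apply Hs. }
assert (U : tgt n1 = f^#).
{ destruct Hw as [<- Hw]; rewrite <- tgt_cod, Hw; apply T. }
sq_intro; unfold ltr2; gnorm; reflexivity.
Qed.
Lemma square_fold2_ltr2 n0 z m1 x : square f g m n s ->
  is_cell z n0 n -> is_cell x m m1 ->
  fold2 x • (s • ltr2 f z) = fold2 x • s • ltr2 f z.
Proof.
intros Hs Hz Hx.
assert (T : tgt n0 = f^#).
{ destruct Hz as [<- Hz]; rewrite <- tgt_cod, Hz; apply Hs. }
sq_intro; unfold ltr2, fold2; bd; rewrite vcompA by bd; reflexivity.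
Qed.
End SquareAction.

Lemma hcomp_cell (C : TwoCat) (x y : cell C) a b c d : is_cell x a b ->
  is_cell y c d -> src a = tgt c -> is_cell (x ⊛ y) (a ∘ c) (b ∘ d).
Proof. intros [<- <-] [<- <-] H; split; bd. Qed.
Lemma vcomp_cell (C : TwoCat) (x y : cell C) a b c : is_cell x b c ->
  is_cell y a b -> is_cell (x • y) a c.
Proof. intros [Hx <-] [<- Hy]; split; bd. Qed.
Lemma idc_cell (C : TwoCat) (a : mor C) : is_cell (idc a) a a.
Proof. split; bd. Qed.

Section Weak.
Context (C D : gobj G).
Implicit Types (f g h k : ob (ghom C D)) (a b m : mor (ghom C D)).
Implicit Types (x y : cell (ghom C D)).

Lemma sharp_comp_square f g h a b : is_mor a g h -> is_mor b f g ->
  square f h (a ∘ b) (sharp1 b ∘ sharp1 a)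
    (sq_comp (sharp_sq a) (sharp1 a) b (sharp_sq b)).
Proof.
intros Ha Hb; exact (sq_comp_square (sharp_sq_square Hb) (sharp_sq_square Ha)).
Qed.
Lemma sharp_phi_cell f g h a b : is_mor a g h -> is_mor b f g ->
  is_cell (sharp_phi a b) (sharp1 b ∘ sharp1 a) (sharp1 (a ∘ b)).
Proof.
intros Ha Hb; pose proof Hb as [<- _].
exact (factor_cell (sharp_comp_square Ha Hb)).
Qed.
Lemma sharp_phi_inv f g h a b : is_mor a g h -> is_mor b f g ->
  invertible (sharp_phi a b).
Proof.
intros Ha Hb; pose proof Hb as [<- _].
apply (factor_invertible (sharp_comp_square Ha Hb)).
apply (sq_comp_invertible (sharp_sq_square Hb) (sharp_sq_square Ha));
  apply sharp_sq_invertible.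
Qed.
Lemma sharp_phiP f g h a b : is_mor a g h -> is_mor b f g ->
  sharp_sq (a ∘ b) • ltr2 f (sharp_phi a b) =
  sq_comp (sharp_sq a) (sharp1 a) b (sharp_sq b).
Proof.
intros Ha Hb; pose proof Hb as [<- _]; exact (factorP (sharp_comp_square Ha Hb)).
Qed.
Lemma sharp_phi1_cell f : is_cell (sharp_phi1 f) (idm f^#) (sharp1 (idm f)).
Proof. exact (factor_cell (sq_id_square f)). Qed.
Lemma sharp_phi1_inv f : invertible (sharp_phi1 f).
Proof. apply (factor_invertible (sq_id_square f)), invertible_idc. Qed.
Lemma sharp_phi1P f : sharp_sq (idm f) • ltr2 f (sharp_phi1 f) = idc (eta f)^*.
Proof. exact (factorP (sq_id_square f)). Qed.

Lemma sharp2_idc a : sharp2 (idc a) = idc (sharp1 a).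
Proof. unfold sharp2, sharp1; gnorm; reflexivity. Qed.
Lemma sharp2_vcomp x y : dom x = cod y ->
  sharp2 (x • y) = sharp2 x • sharp2 y.
Proof. intros H; unfold sharp2; rewrite H; gnorm; reflexivity. Qed.
Lemma sharp2_cell' x m m' : is_cell x m m' ->
  is_cell (sharp2 x) (sharp1 m) (sharp1 m').
Proof. intros [<- <-]; apply sharp2_cell. Qed.

Lemma is_mor_cell x m m' f g : is_cell x m m' -> is_mor m f g -> is_mor m' f g.
Proof. intros [<- <-] [<- <-]; split; [apply src_cod|apply tgt_cod]. Qed.

(** Against the universal square over [a' ∘ b'], both sides give the composite of the universal
    squares over [a] and [b], followed by [fold2 (x ⊛ y)]. *)
Lemma sharp_phi_nat x y a a' b b' f g h : is_cell x a a' -> is_cell y b b' ->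
  is_mor a g h -> is_mor b f g ->
  sharp_phi a' b' • (sharp2 y ⊛ sharp2 x) = sharp2 (x ⊛ y) • sharp_phi a b.
Proof.
intros Hx Hy Ha Hb.
pose proof (is_mor_cell Hx Ha) as Ha'.
pose proof (is_mor_cell Hy Hb) as Hb'.
pose proof (sharp2_cell' Hx) as Cx; pose proof (sharp2_cell' Hy) as Cy.
assert (Hm : is_mor (a' ∘ b') f h) by (sq_intro; split; bd).
assert (Cz : is_cell (sharp2 y ⊛ sharp2 x) (sharp1 b ∘ sharp1 a)
  (sharp1 b' ∘ sharp1 a')) by (sq_intro; split; bd).
assert (Cxy : is_cell (x ⊛ y) (a ∘ b) (a' ∘ b')) by (sq_intro; split; bd).
assert (Hm0 : is_mor (a ∘ b) f h) by (sq_intro; split; bd).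
pose proof (sharp2_cell' Cxy) as Cs.
pose proof (sharp_phi_cell Ha Hb) as Cp.
pose proof (sharp_phi_cell Ha' Hb') as Cp'.
pose proof (sharp_sq_square Hm) as S.
apply (sharp_unique (n := sharp1 b ∘ sharp1 a)) with (1 := Hm).
- sq_intro; bd.
- sq_intro; split; bd.
- sq_intro; split; bd.
- rewrite (square_ltr2_vcomp S Cp' Cz), (square_ltr2_vcomp S Cs Cp).
  rewrite (sharp_phiP Ha' Hb'), (sharp_sq_nat Cxy Hm0).
  rewrite <- (square_fold2_ltr2 (sharp_sq_square Hm0) Cp Cxy), (sharp_phiP Ha Hb).
  rewrite <- (sq_comp_post (sharp_sq_square Hb) (sharp_sq_square Ha) Hy Hx Hb' Ha').
  rewrite <- (sharp_sq_nat Hx Ha), <- (sharp_sq_nat Hy Hb).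
  symmetry; apply (sq_comp_pre (sharp_sq_square Hb') (sharp_sq_square Ha') Cy Cx).
  + sq_intro; split; bd.
  + sq_intro; split; bd.
Qed.

(** The square factored by both sides is the composite of the universal squares over [d], [b] and
    [a]. *)
Lemma sharp_phi_assoc a b d f g h k : is_mor a h k -> is_mor b g h -> is_mor d f g ->
  sharp_phi (a ∘ b) d • (idc (sharp1 d) ⊛ sharp_phi a b) =
  sharp_phi a (b ∘ d) • (sharp_phi b d ⊛ idc (sharp1 a)).
Proof.
intros Ha Hb Hd.
assert (Hab : is_mor (a ∘ b) g k) by (sq_intro; split; bd).
assert (Hbd : is_mor (b ∘ d) f h) by (sq_intro; split; bd).
assert (Habd : is_mor (a ∘ b ∘ d) f k) by (sq_intro; split; bd).
assert (E : a ∘ (b ∘ d) = a ∘ b ∘ d) by (apply compA; sq_intro; congruence).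
pose proof (sharp_phi_cell Ha Hb) as Cab.
pose proof (sharp_phi_cell Hb Hd) as Cbd.
pose proof (sharp_phi_cell Hab Hd) as Cabd.
pose proof (sharp_phi_cell Ha Hbd) as Cabd'; rewrite E in Cabd'.
pose proof (sharp_sq_square Ha) as Sa.
pose proof (sharp_sq_square Hb) as Sb.
pose proof (sharp_sq_square Hd) as Sd.
pose proof (sharp_sq_square Hab) as Sab.
pose proof (sharp_sq_square Hbd) as Sbd.
pose proof (sharp_sq_square Habd) as Sabd.
assert (M1 : src (sharp1 d) = tgt (sharp1 b ∘ sharp1 a)) by (sq_intro; bd).
assert (M2 : src (sharp1 d ∘ sharp1 b) = tgt (sharp1 a)) by (sq_intro; bd).
assert (M3 : sharp1 d ∘ (sharp1 b ∘ sharp1 a) = sharp1 d ∘ sharp1 b ∘ sharp1 a)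
  by (apply compA; sq_intro; bd).
pose proof (hcomp_cell (idc_cell (sharp1 d)) Cab M1) as L; rewrite M3 in L.
pose proof (hcomp_cell Cbd (idc_cell (sharp1 a)) M2) as R.
apply (sharp_unique (n := sharp1 d ∘ sharp1 b ∘ sharp1 a)) with (1 := Habd).
- sq_intro; bd.
- exact (vcomp_cell Cabd L).
- exact (vcomp_cell Cabd' R).
- rewrite (square_ltr2_vcomp Sabd Cabd L), (square_ltr2_vcomp Sabd Cabd' R).
  rewrite (sharp_phiP Hab Hd), <- E, (sharp_phiP Ha Hbd).
  rewrite <- (sq_comp_pre Sd Sab (idc_cell _) Cab),
    <- (sq_comp_pre Sbd Sa Cbd (idc_cell _)).
  + rewrite (ltr2_idc Sd), (ltr2_idc Sa), (sharp_phiP Ha Hb), (sharp_phiP Hb Hd).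
    symmetry; exact (sq_comp_assoc Sd Sb Sa).
  + sq_intro; split; bd.
  + sq_intro; split; bd.
  + sq_intro; split; bd.
  + sq_intro; split; bd.
Qed.

Lemma sharp_phi_unitr a f g : is_mor a f g ->
  sharp_phi a (idm f) • (sharp_phi1 f ⊛ idc (sharp1 a)) = idc (sharp1 a).
Proof.
intros Ha.
assert (Hi : is_mor (idm f) f f) by (split; bd).
assert (E : a ∘ idm f = a) by (apply comp_idr; apply Ha).
pose proof (sharp_phi1_cell f) as C1.
pose proof (sharp_phi_cell Ha Hi) as Ca; rewrite E in Ca.
pose proof (sharp_sq_square Ha) as Sa.
pose proof (sharp_sq_square Hi) as Si.
assert (M : src (idm f^#) = tgt (sharp1 a)) by (sq_intro; bd).
pose proof (hcomp_cell C1 (idc_cell (sharp1 a)) M) as L.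
rewrite comp_idl in L by apply Sa.
apply (sharp_unique (n := sharp1 a)) with (1 := Ha).
- sq_intro; bd.
- exact (vcomp_cell Ca L).
- apply idc_cell.
- rewrite (square_ltr2_vcomp Sa Ca L), (ltr2_idc Sa).
  rewrite <- E at 1; rewrite (sharp_phiP Ha Hi).
  rewrite <- (sq_comp_pre Si Sa C1 (idc_cell _)), (ltr2_idc Sa), sharp_phi1P.
  + exact (sq_comp_idr Sa).
  + split; bd.
  + apply Sa.
Qed.

Lemma sharp_phi_unitl a f g : is_mor a f g ->
  sharp_phi (idm g) a • (idc (sharp1 a) ⊛ sharp_phi1 g) = idc (sharp1 a).
Proof.
intros Ha.
assert (Hi : is_mor (idm g) g g) by (split; bd).
assert (E : idm g ∘ a = a) by (apply comp_idl; apply Ha).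
pose proof (sharp_phi1_cell g) as C1.
pose proof (sharp_phi_cell Hi Ha) as Ca; rewrite E in Ca.
pose proof (sharp_sq_square Ha) as Sa.
pose proof (sharp_sq_square Hi) as Si.
assert (M : src (sharp1 a) = tgt (idm g^#)) by (sq_intro; bd).
pose proof (hcomp_cell (idc_cell (sharp1 a)) C1 M) as L.
rewrite comp_idr in L by apply Sa.
apply (sharp_unique (n := sharp1 a)) with (1 := Ha).
- sq_intro; bd.
- exact (vcomp_cell Ca L).
- apply idc_cell.
- rewrite (square_ltr2_vcomp Sa Ca L), (ltr2_idc Sa).
  rewrite <- E at 1; rewrite (sharp_phiP Hi Ha).
  rewrite <- (sq_comp_pre Sa Si (idc_cell _) C1), (ltr2_idc Sa), sharp_phi1P.
  + exact (sq_comp_idl Sa).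
  + apply Sa.
  + split; bd.
Qed.
End Weak.

Lemma sharp_weak (C D : gobj G) :
  weak_functor_laws (fhom (sharp_map G) C D) (fcoh sharp_coh C D).
Proof.
constructor; cbn.
- intros a; apply tgt_sharp1.
- intros a; apply src_sharp1.
- intros x; apply sharp2_cell.
- intros x; apply sharp2_cell.
- intros a; apply sharp2_idc.
- intros x y H; apply sharp2_vcomp; exact H.
- intros a b H; apply (@sharp_phi_cell C D (src b) (tgt b) (tgt a));
    split; auto.
- intros a b H; apply (@chosen_inverseP (ghom D C)).
  apply (@sharp_phi_inv C D (src b) (tgt b) (tgt a)); split; auto.
- intros f; apply sharp_phi1_cell.
- intros f; apply (@chosen_inverseP (ghom D C)), sharp_phi1_inv.
- intros x y H; apply (@sharp_phi_nat C D) with (src (dom y)) (tgt (dom y))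
   (tgt (dom x)); split; auto.
- intros a b d H1 H2; apply (@sharp_phi_assoc C D) with (src d) (tgt d)
   (tgt b) (tgt a); split; auto.
- intros a; apply (@sharp_phi_unitr C D) with (tgt a); split; auto.
- intros a; apply (@sharp_phi_unitl C D) with (src a); split; auto.
Qed.
End Sharp.

(** * Compatibility of [#] with the Gray product *)

Section Kappa.
Context (G : GrayCatWithDuals).

Lemma gprod1_mor (C D E : gobj G) (f g : ob (ghom D E)) (h k : ob (ghom C D)) m n :
  is_mor m f g -> is_mor n h k -> is_mor (gprod1 m n) (f □ h) (g □ k).
Proof.
intros [<- <-] [<- <-]; split; [apply src_gprod1|apply tgt_gprod1].
Qed.
Lemma gprod2_cell (C D E : gobj G) (x : cell (ghom D E)) (y : cell (ghom C D))
    a b c d : is_cell x a b -> is_cell y c d ->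
  is_cell (gprod2 x y) (gprod1 a c) (gprod1 b d).
Proof. intros [<- <-] [<- <-]; unfold gprod1, gprod2; split; bd. Qed.

Lemma sharp1_mor (C D : gobj G) (f g : ob (ghom C D)) m :
  is_mor m f g -> is_mor (sharp1 m) g^# f^#.
Proof. intros [<- <-]; split; [apply src_sharp1|apply tgt_sharp1]. Qed.

Section Basics.
Context (C D E : gobj G) (f f' : ob (ghom D E)) (g g' : ob (ghom C D)).
Context (m : mor (ghom D E)) (n : mor (ghom C D)).
Lemma sharp_kappa_cell :
  is_cell (sharp_kappa m n) (gprod1 (sharp1 n) (sharp1 m)) (sharp1 (gprod1 m n)).
Proof.
exact (factor_cell (sq_prod_square (sharp_sq_square (conj eq_refl eq_refl))
  (sharp_sq_square (conj eq_refl eq_refl)))).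
Qed.
Lemma sharp_kappa_invertible : invertible (sharp_kappa m n).
Proof.
assert (Hm : is_mor m (src m) (tgt m)) by (split; auto).
assert (Hn : is_mor n (src n) (tgt n)) by (split; auto).
apply (factor_invertible (sq_prod_square (sharp_sq_square Hm) (sharp_sq_square Hn))).
apply (sq_prod_invertible (sharp_sq_square Hm) (sharp_sq_square Hn));
  apply sharp_sq_invertible.
Qed.
Lemma sharp_kappaP : is_mor m f f' -> is_mor n g g' ->
  sharp_sq (gprod1 m n) • ltr2 (f □ g) (sharp_kappa m n) =
  sq_prod (sharp_sq m) m (sharp1 m) (sharp_sq n) n.
Proof.
intros Hm Hn.
pose proof (sq_prod_square (sharp_sq_square Hm) (sharp_sq_square Hn)) as K.
destruct Hm as [<- _], Hn as [<- _]; exact (factorP K).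
Qed.
End Basics.

Lemma sharp_kappa_nat (C D E : gobj G) (x : cell (ghom D E)) (y : cell (ghom C D)) :
  sharp_kappa (cod x) (cod y) • gprod2 (sharp2 y) (sharp2 x) =
  sharp2 (gprod2 x y) • sharp_kappa (dom x) (dom y).
Proof.
assert (Ha : is_mor (dom x) (src (dom x)) (tgt (dom x))) by (split; auto).
assert (Hb : is_mor (dom y) (src (dom y)) (tgt (dom y))) by (split; auto).
assert (Hx : is_cell x (dom x) (cod x)) by (split; auto).
assert (Hy : is_cell y (dom y) (cod y)) by (split; auto).
revert Ha Hb Hx Hy.
generalize (dom x) (cod x) (dom y) (cod y); intros a a' b b'.
generalize (src a) (tgt a) (src b) (tgt b); intros f f' g g' Ha Hb Hx Hy.
pose proof (is_mor_cell Hx Ha) as Ha'.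
pose proof (is_mor_cell Hy Hb) as Hb'.
pose proof (sharp2_cell' Hx) as Cx; pose proof (sharp2_cell' Hy) as Cy.
pose proof (gprod2_cell Cy Cx) as Cz.
pose proof (gprod2_cell Hx Hy) as Cxy.
pose proof (gprod1_mor Ha Hb) as Hm.
pose proof (gprod1_mor Ha' Hb') as Hm'.
pose proof (sharp2_cell' Cxy) as Cs.
pose proof (sharp_kappa_cell a b) as Cp.
pose proof (sharp_kappa_cell a' b') as Cp'.
pose proof (sharp_sq_square Hm') as S.
apply (sharp_unique (n := gprod1 (sharp1 b) (sharp1 a))) with (1 := Hm').
- rewrite tgt_gprod1, dual_gprod.
  now destruct (sharp1_mor Ha) as [_ ->], (sharp1_mor Hb) as [_ ->].
- exact (vcomp_cell Cp' Cz).
- exact (vcomp_cell Cs Cp).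
- rewrite (square_ltr2_vcomp S Cp' Cz), (square_ltr2_vcomp S Cs Cp).
  rewrite (sharp_kappaP Ha' Hb'), (sharp_sq_nat Cxy Hm).
  rewrite <- (square_fold2_ltr2 (sharp_sq_square Hm) Cp Cxy), (sharp_kappaP Ha Hb).
  rewrite <- (sq_prod_post (sharp_sq_square Ha) (sharp_sq_square Hb) Hx Ha' Hy Hb').
  rewrite <- (sharp_sq_nat Hx Ha), <- (sharp_sq_nat Hy Hb).
  symmetry; exact (sq_prod_pre (sharp_sq_square Ha') (sharp_sq_square Hb')
    Cx (sharp1_mor Ha) Cy (sharp1_mor Hb)).
Qed.

Lemma sharp_kappa_id (C D E : gobj G) (f : ob (ghom D E)) (g : ob (ghom C D)) :
  sharp_kappa (idm f) (idm g) • gprod2 (sharp_phi1 g) (sharp_phi1 f) =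
  sharp_phi1 (f □ g).
Proof.
assert (Hf : is_mor (idm f) f f) by (split; bd).
assert (Hg : is_mor (idm g) g g) by (split; bd).
pose proof (gprod1_mor Hf Hg) as H.
pose proof (sharp_kappa_cell (idm f) (idm g)) as Cp.
pose proof (gprod2_cell (sharp_phi1_cell g) (sharp_phi1_cell f)) as Cz.
pose proof (sharp_phi1_cell (f □ g)) as C1.
rewrite !gprod1_idm in *; rewrite dual_gprod in C1.
pose proof (sharp_sq_square H) as S.
apply (sharp_unique (n := idm (g^# □ f^#))) with (1 := H).
- bd.
- exact (vcomp_cell Cp Cz).
- exact C1.
- rewrite (square_ltr2_vcomp S Cp Cz), sharp_phi1P.
  rewrite <- (gprod1_idm f g), (sharp_kappaP Hf Hg).
  rewrite <- (sq_prod_pre (sharp_sq_square Hf) (sharp_sq_square Hg)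
    (sharp_phi1_cell f) (conj (src_idm _) (tgt_idm _))
    (sharp_phi1_cell g) (conj (src_idm _) (tgt_idm _))), !sharp_phi1P.
  apply sq_prod_id.
Qed.

(** The square factored by both sides is the threefold product of universal squares, which
    [sq_prod_assoc] makes unambiguous. *)
Lemma sharp_kappa_assoc (B C D E : gobj G) (l : mor (ghom D E)) (m : mor (ghom C D))
    (n : mor (ghom B C)) :
  sharp_kappa l (gprod1 m n) • gprod2 (sharp_kappa m n) (idc (sharp1 l)) =
  sharp_kappa (gprod1 l m) n • gprod2 (idc (sharp1 n)) (sharp_kappa l m).
Proof.
assert (Hl : is_mor l (src l) (tgt l)) by (split; auto).
assert (Hm : is_mor m (src m) (tgt m)) by (split; auto).
assert (Hn : is_mor n (src n) (tgt n)) by (split; auto).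
revert Hl Hm Hn; generalize (src l) (tgt l) (src m) (tgt m) (src n) (tgt n).
intros f f' g g' h h' Hl Hm Hn.
pose proof (gprod1_mor Hl Hm) as Hlm; pose proof (gprod1_mor Hm Hn) as Hmn.
pose proof (gprod1_mor Hl Hmn) as H.
pose proof (sharp_kappa_cell l (gprod1 m n)) as C1.
pose proof (sharp_kappa_cell (gprod1 l m) n) as C2.
pose proof (sharp_kappa_cell l m) as Clm.
pose proof (sharp_kappa_cell m n) as Cmn.
pose proof (gprod2_cell Cmn (idc_cell (sharp1 l))) as L.
pose proof (gprod2_cell (idc_cell (sharp1 n)) Clm) as R.
rewrite <- gprod1A in C2, L.
pose proof (sharp_sq_square H) as S.
apply (sharp_unique (n := gprod1 (sharp1 n) (gprod1 (sharp1 m) (sharp1 l))))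
  with (1 := H).
- rewrite !tgt_gprod1, !dual_gprod.
  destruct (sharp1_mor Hl) as [_ ->], (sharp1_mor Hm) as [_ ->],
    (sharp1_mor Hn) as [_ ->]; apply gprodA.
- exact (vcomp_cell C1 L).
- exact (vcomp_cell C2 R).
- rewrite (square_ltr2_vcomp S C1 L), (square_ltr2_vcomp S C2 R).
  rewrite (sharp_kappaP Hl Hmn), gprodA, gprod1A, (sharp_kappaP Hlm Hn).
  rewrite <- gprodA.
  pose proof (sharp_sq_square Hl) as Sl; pose proof (sharp_sq_square Hm) as Sm.
  pose proof (sharp_sq_square Hn) as Sn.
  pose proof (gprod1_mor (sharp1_mor Hn) (sharp1_mor Hm)) as Knm.
  pose proof (gprod1_mor (sharp1_mor Hm) (sharp1_mor Hl)) as Kml.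
  rewrite <- !dual_gprod in Knm, Kml.
  pose proof (sq_prod_pre Sl (sharp_sq_square Hmn) (idc_cell _) (sharp1_mor Hl)
    Cmn Knm) as K1.
  pose proof (sq_prod_pre (sharp_sq_square Hlm) Sn Clm Kml (idc_cell _)
    (sharp1_mor Hn)) as K2.
  rewrite <- gprodA in K2.
  rewrite <- K1, <- K2, (ltr2_idc Sl), (ltr2_idc Sn), (sharp_kappaP Hl Hm),
    (sharp_kappaP Hm Hn).
  exact (sq_prod_assoc Sl Sm Sn).
Qed.

Lemma sharp1_unit (C : gobj G) : sharp1 (idm (gunit C)) = idm (gunit C).
Proof. unfold sharp1; bd. Qed.
(** Fold and triangulator of the unit 1-morphism are identities; the unit laws of [kappa] thereby
    reduce to those of [sq_prod]. *)
Lemma sharp_sq_unit (C : gobj G) :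
  sharp_sq (idm (gunit C)) = idc (eta (gunit C))^*.
Proof.
unfold sharp_sq, trcounit, fold1; bd; rewrite triang_unit; gnorm; reflexivity.
Qed.

Lemma sharp_kappa_unitr (C D : gobj G) (m : mor (ghom C D)) :
  sharp_kappa m (idm (gunit C)) = idc (sharp1 m).
Proof.
assert (Hm : is_mor m (src m) (tgt m)) by (split; auto).
assert (Hi : is_mor (idm (gunit C)) (gunit C) (gunit C)) by (split; bd).
pose proof (sharp_sq_square Hm) as Sm.
pose proof (sharp_kappa_cell m (idm (gunit C))) as Cp.
pose proof (sharp_kappaP Hm Hi) as K.
rewrite sharp1_unit in Cp.
rewrite gprodu1 in K; rewrite ?gprod1_unitr, ?gprod1_unitl in *.
apply (sharp_unique (n := sharp1 m)) with (1 := Hm); auto using idc_cell.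
- apply (sharp1_mor Hm).
- rewrite (ltr2_idc Sm), K, sharp_sq_unit; exact (sq_prod_unitr Sm).
Qed.

Lemma sharp_kappa_unitl (C D : gobj G) (m : mor (ghom C D)) :
  sharp_kappa (idm (gunit D)) m = idc (sharp1 m).
Proof.
assert (Hm : is_mor m (src m) (tgt m)) by (split; auto).
assert (Hi : is_mor (idm (gunit D)) (gunit D) (gunit D)) by (split; bd).
pose proof (sharp_sq_square Hm) as Sm.
pose proof (sharp_kappa_cell (idm (gunit D)) m) as Cp.
pose proof (sharp_kappaP Hi Hm) as K.
rewrite sharp1_unit in Cp, K.
rewrite gprod1u in K; rewrite ?gprod1_unitr, ?gprod1_unitl in *.
apply (sharp_unique (n := sharp1 m)) with (1 := Hm); auto using idc_cell.
- apply (sharp1_mor Hm).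
- rewrite (ltr2_idc Sm), K, sharp_sq_unit; exact (sq_prod_unitl Sm).
Qed.

(** The coherence cell of the Gray tricategory, named so that it can be generalised: the next proof
    uses only its boundary and [sq_prod_comp]. *)
Definition gphi (C D E : gobj G) (m1 n1 : mor (ghom D E)) (m2 n2 : mor (ghom C D)) :
    cell (ghom C E) :=
  idc (m1 ▷ tgt m2) ⊛ tens_inv n1 m2 ⊛ idc (src n1 ◁ n2).

(** Unfolding the factorisations turns the left side into the composite of two products of universal
    squares and the right side into the product of two composites; [sq_prod_comp] compares them. *)
Lemma sharp_kappa_phi (C D E : gobj G) (m1 n1 : mor (ghom D E))
    (m2 n2 : mor (ghom C D)) : src m1 = tgt n1 -> src m2 = tgt n2 ->
  sharp2 (gphi m1 n1 m2 n2) • sharp_phi (gprod1 m1 m2) (gprod1 n1 n2)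
    • (sharp_kappa n1 n2 ⊛ sharp_kappa m1 m2) =
  sharp_kappa (m1 ∘ n1) (m2 ∘ n2) • gprod2 (sharp_phi m2 n2) (sharp_phi m1 n1)
    • gphi (sharp1 n2) (sharp1 m2) (sharp1 n1) (sharp1 m1).
Proof.
intros H1 H2.
assert (Hm1 : is_mor m1 (tgt n1) (tgt m1)) by (split; auto).
assert (Hn1 : is_mor n1 (src n1) (tgt n1)) by (split; auto).
assert (Hm2 : is_mor m2 (tgt n2) (tgt m2)) by (split; auto).
assert (Hn2 : is_mor n2 (src n2) (tgt n2)) by (split; auto).
pose proof (gray_phi_cell H1 H2) as Ct; fold (gphi m1 n1 m2 n2) in Ct.
assert (H3 : src (sharp1 n2) = tgt (sharp1 m2)) by (sq_intro; bd).
assert (H4 : src (sharp1 n1) = tgt (sharp1 m1)) by (sq_intro; bd).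
pose proof (gray_phi_cell H3 H4) as Cu;
  fold (gphi (sharp1 n2) (sharp1 m2) (sharp1 n1) (sharp1 m1)) in Cu.
pose proof (sq_prod_comp (sharp_sq_square Hm1) (sharp_sq_square Hm2)
  (sharp_sq_square Hn1) (sharp_sq_square Hn2)) as P.
fold (gphi m1 n1 m2 n2) in P.
fold (gphi (sharp1 n2) (sharp1 m2) (sharp1 n1) (sharp1 m1)) in P.
clear H1 H2 H3 H4; revert Hm1 Hn1 Hm2 Hn2 P.
generalize (src n1) (tgt n1) (tgt m1) (src n2) (tgt n2) (tgt m2).
intros f1 f2 f3 h1 h2 h3 Hm1 Hn1 Hm2 Hn2 P.
revert Ct Cu P; generalize (gphi m1 n1 m2 n2)
  (gphi (sharp1 n2) (sharp1 m2) (sharp1 n1) (sharp1 m1)); intros t u Ct Cu P.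
assert (H1 : is_mor (m1 ∘ n1) f1 f3) by (sq_intro; split; bd).
assert (H2 : is_mor (m2 ∘ n2) h1 h3) by (sq_intro; split; bd).
pose proof (gprod1_mor H1 H2) as H.
pose proof (gprod1_mor Hm1 Hm2) as Hm.
pose proof (gprod1_mor Hn1 Hn2) as Hn.
assert (Hmn : is_mor (gprod1 m1 m2 ∘ gprod1 n1 n2) (f1 □ h1) (f3 □ h3))
  by (destruct Hm, Hn; split; bd).
pose proof (sharp_sq_square H) as S.
pose proof (sharp_sq_square Hmn) as Smn.
pose proof (sharp_phi_cell Hm Hn) as Cp.
pose proof (sharp_phi_cell Hm1 Hn1) as Cp1.
pose proof (sharp_phi_cell Hm2 Hn2) as Cp2.
pose proof (sharp_kappa_cell m1 m2) as Ckm.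
pose proof (sharp_kappa_cell n1 n2) as Ckn.
pose proof (sharp_kappa_cell (m1 ∘ n1) (m2 ∘ n2)) as Ck.
pose proof (sharp2_cell' Ct) as Ct'.
pose proof (gprod1_mor (sharp1_mor Hm2) (sharp1_mor Hm1)) as Km.
pose proof (gprod1_mor (sharp1_mor Hn2) (sharp1_mor Hn1)) as Kn.
assert (M : src (gprod1 (sharp1 n2) (sharp1 n1)) =
    tgt (gprod1 (sharp1 m2) (sharp1 m1)))
  by (destruct Km, Kn; congruence).
pose proof (hcomp_cell Ckn Ckm M) as L.
pose proof (gprod2_cell Cp2 Cp1) as R.
apply (sharp_unique (n := gprod1 (sharp1 n2) (sharp1 n1)
    ∘ gprod1 (sharp1 m2) (sharp1 m1)))
  with (1 := H).
- destruct Kn; rewrite dual_gprod; bd.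
- exact (vcomp_cell (vcomp_cell Ct' Cp) L).
- exact (vcomp_cell (vcomp_cell Ck R) Cu).
- rewrite (square_ltr2_vcomp S (vcomp_cell Ct' Cp) L), (square_ltr2_vcomp S Ct' Cp).
  rewrite (square_ltr2_vcomp S (vcomp_cell Ck R) Cu), (square_ltr2_vcomp S Ck R).
  rewrite (sharp_sq_nat Ct Hmn).
  rewrite <- (square_fold2_ltr2 Smn Cp Ct), (sharp_phiP Hm Hn).
  rewrite <- (square_fold2_ltr2 (sharp_comp_square Hm Hn) L Ct).
  rewrite <- !dual_gprod in Km, Kn.
  rewrite <- (sq_comp_pre (sharp_sq_square Hn) (sharp_sq_square Hm) Ckn Ckm Kn Km).
  rewrite (sharp_kappaP Hm1 Hm2), (sharp_kappaP Hn1 Hn2), P.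
  rewrite (sharp_kappaP H1 H2).
  assert (K1 : is_mor (sharp1 n1 ∘ sharp1 m1) f3^# f1^#)
    by (clear - Hm1 Hn1; sq_intro; split; bd).
  assert (K2 : is_mor (sharp1 n2 ∘ sharp1 m2) h3^# h1^#)
    by (clear - Hm2 Hn2; sq_intro; split; bd).
  rewrite <- (sq_prod_pre (sharp_sq_square H1) (sharp_sq_square H2) Cp1 K1 Cp2 K2).
  rewrite (sharp_phiP Hm1 Hn1), (sharp_phiP Hm2 Hn2).
  reflexivity.
Qed.

Lemma sharp_laws : tri_functor_laws (sharp_coh G).
Proof.
constructor.
- exact (@sharp_weak G).
- intros C; apply dual_unit.
- intros C D E g f; apply dual_gprod.
- intros C D E m n; exact (sharp_kappa_cell m n).
- intros C D E m n.
  destruct (sharp_kappa_invertible m n) as [y Hy]; exists y; exact Hy.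
- intros C D E x y; exact (sharp_kappa_nat x y).
- intros C D E m1 n1 m2 n2 H1 H2; exact (sharp_kappa_phi H1 H2).
- intros C D E g f; exact (sharp_kappa_id g f).
- intros B C D E l m n; exact (sharp_kappa_assoc l m n).
- intros C D m; exact (sharp_kappa_unitr m).
- intros C D m; exact (sharp_kappa_unitl m).
Qed.
End Kappa.

Theorem theorem4p3 (G : GrayCatWithDuals) :
  extends_to_strict_functor (star_map G) /\
  extends_to_functor (sharp_map G).
Proof.
split.
- exists (star_coh G); split; [apply star_laws | apply star_strict].
- exists (sharp_coh G); apply sharp_laws.
Qed.
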